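(* Let $A$ be a regular ring containing a field of characteristic $p>0$, let $R=A[x_1,\ldots,x_m,y_1,\ldots,y_n]$ be standard bigraded over $A$, and let $M=\bigoplus_{(i,j)\in\mathbb{Z}^2}M_{(i,j)}$ be a bigraded $F_R$-finite $F_R$-module. Then: (1) $\bigcup_{(a,b)\in\mathbb{Z}^2}\operatorname{Ass}_A M_{(a,b)}$ is a finite set. (2) $\operatorname{Ass}_A M_{(a,b)}=\operatorname{Ass}_A M_{(0,0)}$ for all $(a,b)\in\mathbb{Z}^2$ with $a\geq0$ and $b\geq0$. (3) $\operatorname{Ass}_A M_{(a,b)}=\operatorname{Ass}_A M_{(-m,0)}$ for all $(a,b)\in\mathbb{Z}^2$ with $a\leq-m$ and $b\geq0$. (4) $\operatorname{Ass}_A M_{(a,b)}=\operatorname{Ass}_A M_{(-m,-n)}$ for all $(a,b)\in\mathbb{Z}^2$ with $a\leq-m$ and $b\leq-n$. (5) $\operatorname{Ass}_A M_{(a,b)}=\operatorname{Ass}_A M_{(0,-n)}$ for all $(a,b)\in\mathbb{Z}^2$ with $a\geq0$ and $b\leq-n$.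
   Context: Rings are commutative and Noetherian; $m,n\geq 1$. Standard bigraded means: elements of $A$ have bidegree $(0,0)$, each $x_i$ has bidegree $(1,0)$, each $y_j$ has bidegree $(0,1)$. For an $R$-module $M$, $F_R(M)={}^{1}R\otimes_R M$, where ${}^{1}R$ is $R$ with its usual left $R$-module structure and right structure $r'\cdot r=r^{p}r'$ (so $a\otimes rm=ar^p\otimes m$). If $M$ is bigraded, $F_R(M)$ is bigraded by $\operatorname{bideg}(r'\otimes m)=\operatorname{bideg}(r')+p\operatorname{bideg}(m)$. An $F_R$-module is an $R$-module $M$ with an $R$-isomorphism $\theta:M\to F_R(M)$; it is bigraded if $M$ is bigraded and $\theta$ preserves bidegree. A generating morphism of $M$ is an injective $R$-linear map $\beta:U\to F_R(U)$ such that $M=\varinjlim(U\xrightarrow{\beta}F_R(U)\xrightarrow{F_R(\beta)}F_R^2(U)\to\cdots)$ with $\theta$ induced by the maps $F_R^e(\beta)$. $M$ is $F_R$-finite if it has a generating morphism with $U$ a finitely generated $R$-module; it is a bigraded $F_R$-finite $F_R$-module if in addition $M$ (and $U$) are bigraded and $\beta$ preserves bidegree. *)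

(* Defs.v *)
From HB Require Import structures.
From mathcomp Require Import all_boot all_order all_algebra.
From mathcomp Require Import generic_quotient.
From mathcomp Require Import ring.
From mathcomp Require Import boolp classical_sets functions cardinality.
From mathcomp Require mpoly.

Set Implicit Arguments.
Unset Strict Implicit.
Unset Printing Implicit Defensive.

Import Order.TTheory GRing.Theory Num.Theory.
Local Open Scope classical_set_scope.
Local Open Scope ring_scope.
Local Open Scope quotient_scope.

Section Ideals.
Variable B : comNzRingType.
Implicit Types I J P : set B.

Definition ideal I : Prop :=
  [/\ I 0, forall x y, I x -> I y -> I (x + y) & forall a x, I x -> I (a * x)].

Definition prime_ideal P : Prop :=
  [/\ ideal P, ~ P 1 & forall x y, P (x * y) -> P x \/ P y].

Definition maximal_ideal I : Prop :=
  [/\ ideal I, ~ I 1 & forall J, ideal J -> I `<=` J -> ~ J 1 -> J = I].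

Definition ideal_gen k (g : 'I_k -> B) : set B :=
  [set x | exists c : 'I_k -> B, x = \sum_i c i * g i].

Definition noetherian : Prop :=
  forall I, ideal I -> exists k (g : 'I_k -> B), I = ideal_gen g.

(* A chain P_0 < P_1 < ... < P_d of prime ideals has length d. *)
Definition prime_chain (d : nat) : Prop :=
  exists P : nat -> set B,
    (forall i, (i <= d)%N -> prime_ideal (P i)) /\
    (forall i, (i < d)%N -> P i `<` P i.+1).

Definition krull_dim (d : nat) : Prop :=
  prime_chain d /\ forall d', prime_chain d' -> (d' <= d)%N.

Definition regular_local : Prop :=
  noetherian /\
  exists mm : set B,
    [/\ maximal_ideal mm, forall J, maximal_ideal J -> J = mm
      & exists d, krull_dim d /\ exists g : 'I_d -> B, mm = ideal_gen g].

End Ideals.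

Section Localization.
Variables (B : comNzRingType) (P : set B) (hP : prime_ideal P).

Definition fracs : choiceType := {x : B * B | x.2 \notin P}.
Implicit Types x y z : fracs.

Definition numer x : B := (val x).1.
Definition denom x : B := (val x).2.

Lemma denomP x : ~ P (denom x).
Proof. by have := valP x => /negP h /mem_set. Qed.

Lemma one_notin_prime : ~ P 1.
Proof. by case: hP. Qed.

Lemma mul_notin_prime (s t : B) : ~ P s -> ~ P t -> ~ P (s * t).
Proof. by move=> hs ht; case: hP => _ _ h /h []. Qed.

Definition mkfrac (a s : B) (hs : ~ P s) : fracs :=
  exist _ (a, s) (introN idP (fun h => hs (set_mem h))).

Lemma numer_mkfrac a s hs : numer (@mkfrac a s hs) = a. Proof. by []. Qed.

Lemma denom_mkfrac a s hs : denom (@mkfrac a s hs) = s. Proof. by []. Qed.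

Definition frac_eq x y : bool :=
  `[< exists2 u, ~ P u & u * (numer x * denom y) = u * (numer y * denom x) >].

Lemma frac_eq_refl : reflexive frac_eq.
Proof. by move=> x; apply/asboolP; exists 1 => //; exact: one_notin_prime. Qed.

Lemma frac_eq_sym : symmetric frac_eq.
Proof. by move=> x y; apply/asboolP/asboolP => -[u hu e]; exists u. Qed.

Lemma frac_eq_trans : transitive frac_eq.
Proof.
move=> y x z /asboolP[u hu e] /asboolP[v hv f]; apply/asboolP.
exists (u * v * denom y).
  by apply: mul_notin_prime; [exact: mul_notin_prime | exact: denomP].
transitivity (u * (numer x * denom y) * (v * denom z)); first by ring.
rewrite e; transitivity (v * (numer y * denom z) * (u * denom x)); first by ring.
by rewrite f; ring.
Qed.

Canonical frac_eq_equiv :=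
  EquivRel frac_eq frac_eq_refl frac_eq_sym frac_eq_trans.

Definition localization := {eq_quot frac_eq}.

HB.instance Definition _ := Choice.on localization.

Definition loc_pi (x : fracs) : localization := \pi_localization x.

Definition loc_frac (a s : B) (hs : ~ P s) : localization :=
  loc_pi (mkfrac a hs).

Lemma loc_piP x y :
  loc_pi x = loc_pi y <->
  exists2 u, ~ P u & u * (numer x * denom y) = u * (numer y * denom x).
Proof.
split; first by move=> /eqmodP /asboolP.
by move=> h; apply/eqmodP/asboolP.
Qed.

Lemma loc_piW (Q : localization -> Prop) : (forall x, Q (loc_pi x)) -> forall a, Q a.
Proof. by move=> h a; rewrite -[a]reprK; exact: h. Qed.

Lemma loc_pi_repr x :
  exists2 u, ~ P u &
    u * (numer (repr (loc_pi x)) * denom x) = u * (numer x * denom (repr (loc_pi x))).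
Proof. by apply/loc_piP; rewrite /loc_pi reprK. Qed.

Definition add_frac x y : fracs :=
  mkfrac (numer x * denom y + numer y * denom x) (mul_notin_prime (@denomP x) (@denomP y)).
Definition mul_frac x y : fracs :=
  mkfrac (numer x * numer y) (mul_notin_prime (@denomP x) (@denomP y)).
Definition opp_frac x : fracs := mkfrac (- numer x) (@denomP x).

Definition loc_add (a b : localization) := loc_pi (add_frac (repr a) (repr b)).
Definition loc_mul (a b : localization) := loc_pi (mul_frac (repr a) (repr b)).
Definition loc_opp (a : localization) := loc_pi (opp_frac (repr a)).

Lemma loc_addE x y : loc_add (loc_pi x) (loc_pi y) = loc_pi (add_frac x y).
Proof.
have [u hu e] := loc_pi_repr x; have [v hv f] := loc_pi_repr y.
apply/loc_piP; exists (u * v); first exact: mul_notin_prime.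
rewrite !(numer_mkfrac, denom_mkfrac).
set x' := repr _ in e *; set y' := repr _ in f *.
transitivity (u * (numer x' * denom x) * (v * denom y' * denom y) +
              v * (numer y' * denom y) * (u * denom x' * denom x)); first by ring.
by rewrite e f; ring.
Qed.

Lemma loc_mulE x y : loc_mul (loc_pi x) (loc_pi y) = loc_pi (mul_frac x y).
Proof.
have [u hu e] := loc_pi_repr x; have [v hv f] := loc_pi_repr y.
apply/loc_piP; exists (u * v); first exact: mul_notin_prime.
rewrite !(numer_mkfrac, denom_mkfrac).
set x' := repr _ in e *; set y' := repr _ in f *.
transitivity (u * (numer x' * denom x) * (v * (numer y' * denom y))); first by ring.
by rewrite e f; ring.
Qed.

Lemma loc_oppE x : loc_opp (loc_pi x) = loc_pi (opp_frac x).
Proof.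
have [u hu e] := loc_pi_repr x.
apply/loc_piP; exists u => //; rewrite !(numer_mkfrac, denom_mkfrac).
by rewrite !mulNr !mulrN e.
Qed.

Definition loc0 := loc_frac 0 one_notin_prime.
Definition loc1 := loc_frac 1 one_notin_prime.

Ltac loc_ring := apply/loc_piP; exists 1; [exact: one_notin_prime |
  unfold add_frac, mul_frac, opp_frac, mkfrac, numer, denom; simpl; ring].

Lemma loc_addA : associative loc_add.
Proof.
elim/loc_piW=> x; elim/loc_piW=> y; elim/loc_piW=> z; rewrite !loc_addE; loc_ring.
Qed.

Lemma loc_addC : commutative loc_add.
Proof. elim/loc_piW=> x; elim/loc_piW=> y; rewrite !loc_addE; loc_ring. Qed.

Lemma loc_add0 : left_id loc0 loc_add.
Proof. elim/loc_piW=> x; rewrite loc_addE; loc_ring. Qed.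

Lemma loc_addN : left_inverse loc0 loc_opp loc_add.
Proof. elim/loc_piW=> x; rewrite loc_oppE loc_addE; loc_ring. Qed.

HB.instance Definition _ :=
  GRing.isZmodule.Build localization loc_addA loc_addC loc_add0 loc_addN.

Lemma loc_mulA : associative loc_mul.
Proof.
elim/loc_piW=> x; elim/loc_piW=> y; elim/loc_piW=> z; rewrite !loc_mulE; loc_ring.
Qed.

Lemma loc_mulC : commutative loc_mul.
Proof. elim/loc_piW=> x; elim/loc_piW=> y; rewrite !loc_mulE; loc_ring. Qed.

Lemma loc_mul1 : left_id loc1 loc_mul.
Proof. elim/loc_piW=> x; rewrite loc_mulE; loc_ring. Qed.

Lemma loc_mulDl : left_distributive loc_mul loc_add.
Proof.
elim/loc_piW=> x; elim/loc_piW=> y; elim/loc_piW=> z.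
rewrite !(loc_addE, loc_mulE); loc_ring.
Qed.

Lemma loc_neq0 : loc1 != loc0.
Proof.
apply/eqP => /loc_piP[u hu]; rewrite !(numer_mkfrac, denom_mkfrac) mul0r !mulr1 mulr0 => u0.
by apply: hu; rewrite u0; case: hP => -[].
Qed.

HB.instance Definition _ := GRing.Zmodule_isComNzRing.Build localization
  loc_mulA loc_mulC loc_mul1 loc_mulDl loc_neq0.

End Localization.

Definition regular_ring (A : comNzRingType) : Prop :=
  noetherian A /\
  forall (P : set A) (hP : prime_ideal P), regular_local (localization hP).

Section FrobeniusFunctor.
Variables (R : comNzRingType) (p : nat).

Section Tensor.
Variable M : lmodType R.
Implicit Types s t : seq (R * M).

(* The sequence [:: (a1, x1); ...; (ak, xk)] stands for the formal sum
   a1 (x) x1 + ... + ak (x) xk; [tensor_rel] is the congruence of the free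
   commutative monoid on R * M generated by biadditivity and by
   a (x) r x = a r^p (x) x.  Inverses are given by (-a) (x) x. *)
Inductive tensor_rel : seq (R * M) -> seq (R * M) -> Prop :=
| tensor_refl s : tensor_rel s s
| tensor_sym s t : tensor_rel s t -> tensor_rel t s
| tensor_trans s t u : tensor_rel s t -> tensor_rel t u -> tensor_rel s u
| tensor_cat s s' t t' :
    tensor_rel s s' -> tensor_rel t t' -> tensor_rel (s ++ t) (s' ++ t')
| tensor_catC s t : tensor_rel (s ++ t) (t ++ s)
| tensor_0l x : tensor_rel [:: (0, x)] [::]
| tensor_Dl a b x : tensor_rel [:: (a + b, x)] [:: (a, x); (b, x)]
| tensor_Dr a x y : tensor_rel [:: (a, x + y)] [:: (a, x); (a, y)]
| tensor_bal a r x : tensor_rel [:: (a, r *: x)] [:: (a * r ^+ p, x)].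

Definition tensor_relb s t : bool := `[< tensor_rel s t >].

Lemma tensor_relb_refl : reflexive tensor_relb.
Proof. by move=> s; apply/asboolP; exact: tensor_refl. Qed.

Lemma tensor_relb_sym : symmetric tensor_relb.
Proof. by move=> s t; apply/asboolP/asboolP => /tensor_sym. Qed.

Lemma tensor_relb_trans : transitive tensor_relb.
Proof.
move=> s t u /asboolP h /asboolP k; apply/asboolP; exact: tensor_trans h k.
Qed.

Canonical tensor_relb_equiv :=
  EquivRel tensor_relb tensor_relb_refl tensor_relb_sym tensor_relb_trans.

Definition frob := {eq_quot tensor_relb}.

HB.instance Definition _ := Choice.on frob.

Definition frob_pi s : frob := \pi_frob s.

Lemma frob_piP s t : frob_pi s = frob_pi t <-> tensor_rel s t.
Proof.
split; first by move=> /eqmodP /asboolP.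
by move=> h; apply/eqmodP/asboolP.
Qed.

Lemma frob_piW (Q : frob -> Prop) : (forall s, Q (frob_pi s)) -> forall a, Q a.
Proof. by move=> h a; rewrite -[a]reprK; exact: h. Qed.

Lemma frob_pi_repr s : tensor_rel (repr (frob_pi s)) s.
Proof. by apply/frob_piP; rewrite /frob_pi reprK. Qed.

Definition mull_seq (b : R) s : seq (R * M) := [seq (b * w.1, w.2) | w <- s].

Lemma mull_seq_rel b s t : tensor_rel s t -> tensor_rel (mull_seq b s) (mull_seq b t).
Proof.
elim=> {s t} /=.
- by move=> s; exact: tensor_refl.
- by move=> s t _; exact: tensor_sym.
- by move=> s t u _ h _; exact: tensor_trans.
- by move=> s s' t t' _ h _ k; rewrite /mull_seq !map_cat; exact: tensor_cat.
- by move=> s t; rewrite /mull_seq !map_cat; exact: tensor_catC.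
- by move=> x; rewrite mulr0; exact: tensor_0l.
- by move=> a c x; rewrite mulrDr; exact: tensor_Dl.
- by move=> a x y; exact: tensor_Dr.
- by move=> a r x; rewrite mulrA; exact: tensor_bal.
Qed.

Definition frob_add (a b : frob) : frob := frob_pi (repr a ++ repr b).
Definition frob_scale (r : R) (a : frob) : frob := frob_pi (mull_seq r (repr a)).
Definition frob_opp (a : frob) : frob := frob_scale (-1) a.
Definition frob0 : frob := frob_pi [::].

Lemma frob_addE s t : frob_add (frob_pi s) (frob_pi t) = frob_pi (s ++ t).
Proof. by apply/frob_piP; apply: tensor_cat; exact: frob_pi_repr. Qed.

Lemma frob_scaleE r s : frob_scale r (frob_pi s) = frob_pi (mull_seq r s).
Proof. by apply/frob_piP/mull_seq_rel/frob_pi_repr. Qed.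

Lemma frob_addA : associative frob_add.
Proof.
by elim/frob_piW=> s; elim/frob_piW=> t; elim/frob_piW=> u;
  rewrite !frob_addE catA.
Qed.

Lemma frob_addC : commutative frob_add.
Proof.
elim/frob_piW=> s; elim/frob_piW=> t; rewrite !frob_addE; apply/frob_piP.
exact: tensor_catC.
Qed.

Lemma frob_add0 : left_id frob0 frob_add.
Proof. by elim/frob_piW=> s; rewrite frob_addE. Qed.

Lemma mull_seqD a b s :
  tensor_rel (mull_seq (a + b) s) (mull_seq a s ++ mull_seq b s).
Proof.
elim: s => [|t s IH] /=; first exact: tensor_refl.
rewrite mulrDl; set u := mull_seq a s in IH *; set v := mull_seq b s in IH *.
apply: (tensor_trans (tensor_cat (tensor_Dl _ _ _) IH)).
rewrite -[_ :: _ ++ _]/([:: (a * t.1, t.2)] ++ (u ++ ([:: (b * t.1, t.2)] ++ v))).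
rewrite -[[:: _; _] ++ _]/([:: (a * t.1, t.2)] ++ ([:: (b * t.1, t.2)] ++ (u ++ v))).
apply: tensor_cat; first exact: tensor_refl.
by rewrite !catA; apply: tensor_cat; [exact: tensor_catC | exact: tensor_refl].
Qed.

Lemma mull_seq0 s : tensor_rel (mull_seq 0 s) [::].
Proof.
elim: s => [|t s IH] /=; first exact: tensor_refl.
by rewrite mul0r; exact: (tensor_cat (tensor_0l _) IH).
Qed.

Lemma frob_addN : left_inverse frob0 frob_opp frob_add.
Proof.
elim/frob_piW=> s; rewrite /frob_opp frob_scaleE frob_addE; apply/frob_piP.
have h := mull_seqD (-1) 1 s; rewrite addNr in h.
have -> : mull_seq (-1) s ++ s = mull_seq (-1) s ++ mull_seq 1 s.
  by congr cat; rewrite -[LHS]map_id; apply: eq_map => -[a x] /=; rewrite mul1r.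
exact: tensor_trans (tensor_sym h) (mull_seq0 s).
Qed.

HB.instance Definition _ :=
  GRing.isZmodule.Build frob frob_addA frob_addC frob_add0 frob_addN.

Lemma frob_scaleA a b v : frob_scale a (frob_scale b v) = frob_scale (a * b) v.
Proof.
elim/frob_piW: v => s; rewrite !frob_scaleE; congr frob_pi.
by rewrite /mull_seq -map_comp; apply: eq_map => t /=; rewrite mulrA.
Qed.

Lemma frob_scale1 : left_id 1 frob_scale.
Proof.
elim/frob_piW=> s; rewrite frob_scaleE; congr frob_pi.
by rewrite -[RHS]map_id; apply: eq_map => -[a x] /=; rewrite mul1r.
Qed.

Lemma frob_scaleDr : right_distributive frob_scale +%R.
Proof.
move=> r; elim/frob_piW=> s; elim/frob_piW=> t.
by rewrite -[_ + _]/(frob_add _ _) -[RHS]/(frob_add _ _) !(frob_addE, frob_scaleE)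
           /mull_seq map_cat.
Qed.

Lemma frob_scaleDl v : {morph frob_scale^~ v : a b / a + b}.
Proof.
elim/frob_piW: v => s a b; rewrite -[RHS]/(frob_add _ _) !frob_scaleE frob_addE.
by apply/frob_piP; exact: mull_seqD.
Qed.

HB.instance Definition _ := GRing.Zmodule_isLmodule.Build R frob
  frob_scaleA frob_scale1 frob_scaleDr frob_scaleDl.

Definition tens (a : R) (x : M) : frob := frob_pi [:: (a, x)].

End Tensor.

Section Map.
Variables (M N : lmodType R) (f : {linear M -> N}).

Definition map_seq (s : seq (R * M)) : seq (R * N) := [seq (w.1, f w.2) | w <- s].

Lemma map_seq_rel s t : tensor_rel s t -> tensor_rel (map_seq s) (map_seq t).
Proof.
elim=> {s t} /=.
- by move=> s; exact: tensor_refl.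
- by move=> s t _; exact: tensor_sym.
- by move=> s t u _ h _; exact: tensor_trans.
- by move=> s s' t t' _ h _ k; rewrite /map_seq !map_cat; exact: tensor_cat.
- by move=> s t; rewrite /map_seq !map_cat; exact: tensor_catC.
- by move=> x; exact: tensor_0l.
- by move=> a c x; exact: tensor_Dl.
- by move=> a x y; rewrite linearD; exact: tensor_Dr.
- by move=> a r x; rewrite linearZ; exact: tensor_bal.
Qed.

Definition frob_map (a : frob M) : frob N := frob_pi (map_seq (repr a)).

Lemma frob_mapE s : frob_map (frob_pi s) = frob_pi (map_seq s).
Proof. by apply/frob_piP/map_seq_rel/frob_pi_repr. Qed.

Lemma frob_map_tens a x : frob_map (tens a x) = tens a (f x).
Proof. exact: frob_mapE. Qed.

Lemma frob_map_linear : linear frob_map.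
Proof.
move=> r; elim/frob_piW=> s; elim/frob_piW=> t.
rewrite -[r *: _]/(frob_scale _ _) -[_ + _]/(frob_add _ _).
rewrite -[r *: _]/(frob_scale _ _) -[RHS]/(frob_add _ _).
rewrite !(frob_scaleE, frob_addE, frob_mapE); congr frob_pi.
by rewrite /map_seq map_cat; congr cat; rewrite /mull_seq -!map_comp.
Qed.

HB.instance Definition _ :=
  GRing.isLinear.Build R (frob M) (frob N) _ frob_map frob_map_linear.

End Map.

Fixpoint frob_iter (U : lmodType R) (e : nat) : lmodType R :=
  if e is e'.+1 then frob (frob_iter U e') else U.

Fixpoint frob_iter_map (U : lmodType R) (beta : {linear U -> frob U}) (e : nat) :
    {linear frob_iter U e -> frob_iter U e.+1} :=
  if e is e'.+1 then frob_map (frob_iter_map beta e') else beta.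

Definition is_direct_limit (X : nat -> lmodType R)
    (f : forall e, {linear X e -> X e.+1})
    (L : lmodType R) (iota : forall e, {linear X e -> L}) : Prop :=
  (forall e x, iota e.+1 (f e x) = iota e x) /\
  forall (N : lmodType R) (kappa : forall e, {linear X e -> N}),
    (forall e x, kappa e.+1 (f e x) = kappa e x) ->
    exists h : {linear L -> N}, (forall e x, h (iota e x) = kappa e x) /\
      forall h' : {linear L -> N},
        (forall e x, h' (iota e x) = kappa e x) -> h' =1 h.

Definition F_module (M : lmodType R) (theta : {linear M -> frob M}) : Prop :=
  bijective theta.

(* The last clause says that theta is the map induced on direct limits by the
   F^e(beta), where F(M) is the direct limit of the F^(e+1)(U) along the
   F(iota_e). *)
Definition generating_morphism (M : lmodType R) (theta : {linear M -> frob M})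
    (U : lmodType R) (beta : {linear U -> frob U}) : Prop :=
  injective beta /\
  exists iota : forall e, {linear frob_iter U e -> M},
    is_direct_limit (frob_iter_map beta) iota /\
    forall e x, theta (iota e x) = frob_map (iota e) (frob_iter_map beta e x).

Definition fin_gen (U : lmodType R) : Prop :=
  exists k (g : 'I_k -> U), forall u, exists c : 'I_k -> R, u = \sum_i c i *: g i.

End FrobeniusFunctor.

Import mpoly.

Notation bidegree := (int * int)%type.

Section Bigraded.
Variables (A : comNzRingType) (m n p : nat).

(* The indeterminates x_i and y_j are 'X_(lshift n i) and 'X_(rshift m j). *)
Local Notation R := {mpoly A[(m + n)%N]}.

Definition bideg_mnm (u : 'X_{1..(m + n)%N}) : bidegree :=
  (Posz (\sum_(i < m) u (lshift n i)), Posz (\sum_(j < n) u (rshift m j))).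

Definition bihomog (d : bidegree) : set R :=
  [set r | forall u, u \in msupp r -> bideg_mnm u = d].

Section Module.
Variable M : lmodType R.

Definition is_bigrading (G : bidegree -> set M) : Prop :=
  [/\ forall d, G d 0 /\ (forall x y, G d x -> G d y -> G d (x - y)),
      forall d e r x, bihomog d r -> G e x -> G (d + e) (r *: x),
      forall x, exists (s : seq bidegree) (c : bidegree -> M),
        (forall d, G d (c d)) /\ x = \sum_(d <- s) c d
    & forall (s : seq bidegree) (c : bidegree -> M), uniq s ->
        (forall d, G d (c d)) -> \sum_(d <- s) c d = 0 ->
        forall d, d \in s -> c d = 0].

(* Closure under opposites is automatic as each [bihomog d] is closed under them. *)
Definition frob_grading (G : bidegree -> set M) (d : bidegree) : set (frob p M) :=
  [set z | exists s : seq (R * M),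
    (forall t, t \in s -> exists d1 d2 : bidegree,
       [/\ bihomog d1 t.1, G d2 t.2 & d = d1 + d2 *+ p]) /\
    z = \sum_(t <- s) tens p t.1 t.2].

(* Associated primes over A of an A-submodule N of M, A acting through
   constant polynomials. *)
Definition AssA (N : set M) : set (set A) :=
  [set P | prime_ideal P /\ exists2 x, N x & P = [set a | a%:MP *: x = 0]].

End Module.

Definition bidegree_preserving (M : lmodType R) (G : bidegree -> set M)
    (f : {linear M -> frob p M}) : Prop :=
  forall d x, G d x -> frob_grading G d (f x).

(* Nothing more relates G to the bigrading H of the generating module U; in
   particular U -> M is not required to preserve bidegrees. *)
Definition bigraded_F_finite (M : lmodType R) (G : bidegree -> set M)
    (theta : {linear M -> frob p M}) : Prop :=
  [/\ is_bigrading G, F_module theta, bidegree_preserving G theta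
    & exists (U : lmodType R) (H : bidegree -> set U) (beta : {linear U -> frob p U}),
      [/\ fin_gen U, is_bigrading H, bidegree_preserving H beta
        & generating_morphism theta beta]].

End Bigraded.

(* Main.v *)
(** Write phi(x) = theta^-1 (1 (x) x), a p-semilinear map M -> M, and q = p^e.  Since
  theta is bijective, every u in M_d is a finite sum of x^I z_I with all entries of I below
  q and z_I a combination over A of elements phi^e(v), v in M_c, deg(I) + q c = d.  Flatness
  of Frobenius on A makes the A-linear relations among these terms explicit: they are
  generated, separately for each I, by the q-th powers of the relations among the v.  Hence
  the annihilator of x^I z does not depend on I.  If P is prime and P = ann u, then
  P = ann z_I for some I, and x^J z_I has the same annihilator for every J.  When q is large
  and d, d' lie in the same quadrant, one can choose J such that x^J z_I has degree d'.  This
  gives (2)-(5) and reduces (1) to degrees d <= 0.  There the v can be taken among finitely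
  many monomial multiples of homogeneous generators, and P has to occur in a prime filtration
  of the A-module which these span.

  Flatness of Frobenius (Kunz) is proved elementwise.  In a regular local ring the generators
  of the maximal ideal form a permutable regular sequence, by Krull's principal ideal theorem,
  so Frobenius preserves their syzygies; Noetherian induction extends this to all ideals, and
  localization to all regular rings. *)
From HB Require Import structures.
Require Import Defs.
From mathcomp Require Import all_boot all_order all_algebra.
From mathcomp Require Import zify.
From mathcomp Require Import boolp classical_sets cardinality.
From mathcomp Require Import mpoly.

Set Implicit Arguments.
Unset Strict Implicit.
Unset Printing Implicit Defensive.

Import Order.TTheory GRing.Theory Num.Theory.
Local Open Scope classical_set_scope.
Local Open Scope ring_scope.

(** No tensor product or Tor group over A is ever built. A pullback along Frobenius is replaced by
    its image in a module of A-valued functions, and flatness becomes the statement that relations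
    on q-th powers are spanned by q-th powers of relations; exact sequences of Tor groups turn into
    comparisons of generating families. Two obstacles come from the gradings. The isomorphism
    [theta] carries M_d into F_R(M)_d, whereas moving monomials around needs phi to carry M_d into
    M_(pd); this is deduced from the separation of exponents. And the map from U to M need not
    respect bidegrees, so homogeneous generators are obtained by splitting the images of generators
    of U inside M. The two thresholds 0 and -m have one origin: a monomial in the x_i with exponents
    below q has degree from 0 to m (q - 1), so over a vector of degree c the degrees reached run
    from q c to q (c + m) - m. *)

Section Ideals.
Variable B : comNzRingType.
Implicit Types (I J K L P Q : set B) (x y z a b s t : B).

(** * Ideals, Noetherian induction, maximal ideals and saturation *)

Lemma ideal0 I : ideal I -> I 0. Proof. by case. Qed.
Lemma idealD I x y : ideal I -> I x -> I y -> I (x + y).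
Proof. by case=> _ h _; exact: h. Qed.
Lemma idealMl I a x : ideal I -> I x -> I (a * x).
Proof. by case=> _ _ h; exact: h. Qed.
Lemma idealMr I a x : ideal I -> I x -> I (x * a).
Proof. by move=> h k; rewrite mulrC; exact: idealMl. Qed.
Lemma idealN I x : ideal I -> I x -> I (- x).
Proof. by move=> h k; rewrite -mulN1r; exact: idealMl. Qed.
Lemma idealB I x y : ideal I -> I x -> I y -> I (x - y).
Proof. by move=> h k l; apply: idealD => //; exact: idealN. Qed.
Lemma ideal_sum (T : Type) (r : seq T) (c : pred T) (F : T -> B) I :
  ideal I -> (forall i, c i -> I (F i)) -> I (\sum_(i <- r | c i) F i).
Proof.
by move=> iI h; elim/big_ind: _ => //; [exact: ideal0 | move=> ? ?; exact: idealD].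
Qed.

Lemma idealDr I x y : ideal I -> I x -> I (x + y) -> I y.
Proof. by move=> iI hx hxy; rewrite -(addKr x y) addrC; exact: idealB. Qed.

Lemma ideal_unit I : ideal I -> I 1 -> forall x, I x.
Proof. by move=> iI h x; rewrite -(mulr1 x); exact: idealMl. Qed.

Lemma ideal_zero : ideal [set 0 : B].
Proof. by split=> [|x y /= -> ->|a x /= ->] //=; rewrite ?addr0 ?mulr0. Qed.

Lemma mem_ideal_gen k (g : 'I_k -> B) i : ideal_gen g (g i).
Proof.
exists (fun j => (j == i)%:R); rewrite (bigD1 i) //= eqxx mul1r big1 ?addr0 //.
by move=> j /negPf ->; rewrite mul0r.
Qed.

Definition idealadd I J : set B := [set z | exists2 x, I x & exists2 y, J y & z = x + y].
Definition principal a : set B := [set z | exists b, z = b * a].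
Definition adjoin I a : set B := idealadd I (principal a).
Definition colon I a : set B := [set b | I (b * a)].

Lemma idealadd_ideal I J : ideal I -> ideal J -> ideal (idealadd I J).
Proof.
move=> iI iJ; split.
- by exists 0; [exact: ideal0 | exists 0; [exact: ideal0 | rewrite addr0]].
- move=> _ _ [x hx [y hy ->]] [x' hx' [y' hy' ->]].
  exists (x + x'); first exact: idealD.
  by exists (y + y'); [exact: idealD | rewrite addrACA].
- move=> a _ [x hx [y hy ->]]; exists (a * x); first exact: idealMl.
  by exists (a * y); [exact: idealMl | rewrite mulrDr].
Qed.

Lemma principal_ideal a : ideal (principal a).
Proof.
split=> [|_ _ [b ->] [c ->]|b _ [c ->]].
- by exists 0; rewrite mul0r.
- by exists (b + c); rewrite mulrDl.
- by exists (b * c); rewrite mulrA.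
Qed.

Lemma adjoin_ideal I a : ideal I -> ideal (adjoin I a).
Proof. by move=> iI; apply: idealadd_ideal => //; exact: principal_ideal. Qed.

Lemma colon_ideal I a : ideal I -> ideal (colon I a).
Proof.
move=> iI; split=> [|x y hx hy|b x hx]; rewrite /colon /=.
- by rewrite mul0r; exact: ideal0.
- by rewrite mulrDl; exact: idealD.
- by rewrite -mulrA; exact: idealMl.
Qed.

Lemma sub_adjoin I a : I `<=` adjoin I a.
Proof.
by move=> x hx; exists x => //; exists 0; rewrite ?addr0 //; exists 0; rewrite mul0r.
Qed.

Lemma mem_adjoin I a : ideal I -> adjoin I a a.
Proof.
by move=> iI; exists 0; [exact: ideal0 | exists a; rewrite ?add0r //; exists 1; rewrite mul1r].
Qed.

Lemma adjoin_sub I J a : ideal J -> I `<=` J -> J a -> adjoin I a `<=` J.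
Proof.
move=> iJ IJ ha _ [x hx [_ [b ->] ->]]; apply: idealD => //; first exact: IJ.
exact: idealMl.
Qed.

Lemma adjoinS I J a : I `<=` J -> adjoin I a `<=` adjoin J a.
Proof. by move=> IJ _ [x hx [y hy ->]]; exists x; [exact: IJ | exists y]. Qed.

Lemma sub_colon I a : ideal I -> I `<=` colon I a.
Proof. by move=> iI x hx; rewrite /colon /=; exact: idealMr. Qed.

Lemma properI I J x : I `<=` J -> J x -> ~ I x -> I `<` J.
Proof. by move=> IJ Jx nIx; split=> // /(_ x Jx). Qed.

Lemma properE_notin I J : I `<` J -> I `<=` J /\ exists2 x, J x & ~ I x.
Proof.
move=> [IJ nJI]; split=> //; apply: contrapT => h; apply: nJI => x Jx.
by apply: contrapT => nI; apply: h; exists x.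
Qed.

(** A counterexample would start, by choice, a strictly increasing chain of ideals; the finitely
    many generators of its union all occur at one stage, where the chain must stop. *)
Lemma noetherian_ind (T : set B -> Prop) : noetherian B ->
  (forall I, ideal I -> (forall J, ideal J -> I `<` J -> T J) -> T I) ->
  forall I, ideal I -> T I.
Proof.
move=> nB step I iI; apply: contrapT => nT.
pose C := {J : set B | ideal J /\ ~ T J}.
have next (J : C) : {K : C | sval J `<` sval K}.
  apply: cid; case: J => J [iJ nTJ] /=; apply: contrapT => h; apply: nTJ.
  apply: step => // K iK JK; apply: contrapT => nTK; apply: h.
  by exists (exist _ K (conj iK nTK)).
pose c i : C := iter i (fun J : C => sval (next J) : C) (exist _ I (conj iI nT) : C).
have cS i : sval (c i) `<` sval (c i.+1) by exact: (svalP (next (c i))).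
have cle i j : (i <= j)%N -> sval (c i) `<=` sval (c j).
  move=> /subnK <-; elim: (j - i)%N => //= k IH; exact: subset_trans IH (properW (cS _)).
have ci i : ideal (sval (c i)) by case: (svalP (c i)).
pose U : set B := [set x | exists i, sval (c i) x].
have iU : ideal U.
  split=> [|x y [i hx] [j hy]|a x [i hx]].
  - by exists 0%N; exact: ideal0 (ci 0%N).
  - exists (maxn i j); apply: (idealD (ci _)).
      exact: (cle _ _ (leq_maxl i j)).
    exact: (cle _ _ (leq_maxr i j)).
  - by exists i; exact: idealMl.
have [k [g eU]] := nB U iU.
have hg i : exists j, sval (c j) (g i).
  by have : U (g i) by rewrite eU; exact: mem_ideal_gen.
pose j i := sval (cid (hg i)).
pose N := (\max_(i < k) j i)%N.
have UN : U `<=` sval (c N).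
  rewrite eU => _ [d ->]; apply: ideal_sum => // i _; apply: idealMl => //.
  by apply: (cle (j i)); [exact: leq_bigmax | exact: (svalP (cid (hg i)))].
by case: (cS N) => _; apply=> x hx; apply: UN; exists N.+1.
Qed.

Lemma maximal_prime P : maximal_ideal P -> prime_ideal P.
Proof.
move=> [iP nP mx]; split=> // x y hxy; apply: contrapT => /not_orP [nx ny].
have : adjoin P x = P -> False by move=> e; apply: nx; rewrite -e; exact: mem_adjoin.
apply; apply: mx; [exact: adjoin_ideal | exact: sub_adjoin |].
move=> -[u hu [_ [b ->] e]]; apply: ny.
by rewrite -(mul1r y) e mulrDl; apply: idealD; rewrite -?mulrA; [|apply: idealMr|apply: idealMl].
Qed.

Lemma exists_maximal I : noetherian B -> ideal I -> ~ I 1 ->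
  exists2 P, maximal_ideal P & I `<=` P.
Proof.
move=> nB; move: I; apply: noetherian_ind => // I iI IH nI.
have [[J [iJ IJ nJ]]|h] := pselect (exists J, [/\ ideal J, I `<` J & ~ J 1]).
  by have [P mP JP] := IH J iJ IJ nJ; exists P => //; apply: subset_trans JP; exact: properW.
exists I => //; split=> // J iJ IJ nJ; apply: contrapT => neq; apply: h; exists J; split=> //.
by split=> // JI; apply: neq; apply/seteqP.
Qed.

Lemma prime_pow P x n : prime_ideal P -> P (x ^+ n) -> P x.
Proof.
case=> _ n1 pM; elim: n => [|n IH]; first by rewrite expr0.
by rewrite exprS => /pM [].
Qed.

(* The contraction to B of the extension of I to the localization at P. *)
Definition saturation P I : set B := [set x | exists2 s, ~ P s & I (s * x)].

Lemma saturation_ideal P I : prime_ideal P -> ideal I -> ideal (saturation P I).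
Proof.
move=> [_ n1 pP] iI; split=> [|x y [s hs sx] [t ht ty]|a x [s hs sx]].
- by exists 1 => //; rewrite mulr0; exact: ideal0.
- exists (s * t); first by move=> /pP [].
  rewrite mulrDr; apply: idealD => //.
    by rewrite mulrAC; exact: idealMr.
  by rewrite -mulrA; exact: idealMl.
- by exists s => //; rewrite mulrCA; exact: idealMl.
Qed.

Lemma sub_saturation P I : prime_ideal P -> I `<=` saturation P I.
Proof. by move=> [_ n1 _] x hx; exists 1 => //; rewrite mul1r. Qed.

End Ideals.

(** * Nakayama's lemma *)

Section Nakayama.
Variables (B : comNzRingType) (V : lmodType B).
Implicit Types L : set V.

Definition submodule L : Prop :=
  L 0 /\ forall (a : B) x y, L x -> L y -> L (a *: x + y).

Lemma submodule_sum (T : Type) (r : seq T) (c : pred T) (F : T -> V) L :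
  submodule L -> (forall i, c i -> L (F i)) -> L (\sum_(i <- r | c i) F i).
Proof.
move=> [L0 LD] h; elim/big_ind: _ => // x y hx hy.
by rewrite -(scale1r x); exact: LD.
Qed.

Lemma submoduleZ L a x : submodule L -> L x -> L (a *: x).
Proof. by move=> [L0 LD] hx; rewrite -[X in L X]addr0; exact: LD. Qed.

Lemma submoduleD L x y : submodule L -> L x -> L y -> L (x + y).
Proof. by move=> [L0 LD] hx hy; rewrite -(scale1r x); exact: LD. Qed.

Lemma submoduleN L x : submodule L -> L x -> L (- x).
Proof. by move=> hL hx; rewrite -scaleN1r; exact: submoduleZ. Qed.

(* Nakayama's lemma over the local ring at P, with denominators cleared. *)
Lemma nakayama (P : set B) L k (g : 'I_k -> V) : prime_ideal P -> submodule L ->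
  (forall i, exists s (c : 'I_k -> B),
     [/\ ~ P s, forall j, P (c j) & L (s *: g i - \sum_j c j *: g j)]) ->
  forall i, exists2 s, ~ P s & L (s *: g i).
Proof.
move=> pP sL; have [iP n1 pM] := pP.
elim: k g => [|k IH] g h; first by case.
have [s [c [hs hc]]] := h ord_max; rewrite big_ord_recr /= opprD.
set r := \sum_(i < k) _ => h1.
(* Collecting the terms in [g ord_max] leaves this coefficient, still outside P. The relation then
   eliminates [g ord_max] from the others, once they are multiplied by [s1]. *)
pose s1 := s - c ord_max.
have hs1 : ~ P s1.
  by move=> h'; apply: hs; rewrite -(subrK (c ord_max) s); apply: idealD.
have {}h1 : L (s1 *: g ord_max - r) by rewrite scalerBl addrAC -addrA.
have h' (i : 'I_k) : exists s (d : 'I_k -> B), [/\ ~ P s, forall j, P (d j)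
    & L (s *: g (widen_ord (leqnSn k) i) - \sum_j d j *: g (widen_ord (leqnSn k) j))].
  have [t [d [ht hd]]] := h (widen_ord (leqnSn k) i); rewrite big_ord_recr /= => h2.
  exists (s1 * t),
    (fun j => s1 * d (widen_ord (leqnSn k) j) + d ord_max * c (widen_ord (leqnSn k) j)).
  split; first by move=> /pM [].
    by move=> j; apply: idealD => //; exact: idealMl.
  apply: (eq_ind _ L (submoduleD sL (submoduleZ s1 sL h2) (submoduleZ (d ord_max) sL h1))).
  under [in RHS]eq_bigr => j _ do rewrite scalerDl -!scalerA.
  rewrite [in RHS]big_split /= -!scaler_sumr -/r !scalerBr scalerDr !scalerA.
  by rewrite (mulrC (d ord_max) s1) !opprD !addrA subrK.
have IHg := IH _ h'.
have hL (i : 'I_k.+1) : i != ord_max -> exists2 s, ~ P s & L (s *: g i).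
  move=> ni; have lti : (i < k)%N by rewrite ltn_neqAle -ltnS ltn_ord andbT; exact: ni.
  have [t ht Lt] := IHg (Ordinal lti); exists t => //.
  by have <- : widen_ord (leqnSn k) (Ordinal lti) = i by exact: val_inj.
move=> i; have [->|] := eqVneq i ord_max; last exact: hL.
pose u j := s2val (cid2 (IHg j)).
pose w := \prod_j u j.
have hw : ~ P w.
  by rewrite /w; elim/big_ind: _ => // [x y hx hy /pM []//|j _]; exact: (s2valP (cid2 (IHg j))).
exists (w * s1); first by move=> /pM [].
rewrite -scalerA -(subrK r (s1 *: _)) scalerDr; apply: submoduleD => //; first exact: submoduleZ.
rewrite scaler_sumr; apply: submodule_sum => // j _.
rewrite scalerA mulrC -scalerA; apply: submoduleZ => //.
rewrite /w (bigD1 j) //= mulrC -scalerA; apply: submoduleZ => //.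
exact: (s2valP' (cid2 (IHg j))).
Qed.

End Nakayama.

(** * Krull's principal ideal theorem and chains of primes *)

Section PrincipalIdealTheorem.
Variable B : comNzRingType.
Hypothesis nB : noetherian B.
Implicit Types (I J K L P Q : set B) (x y z a b s t : B).

(* Modulo an ideal for which P is a minimal prime, the local ring at P is artinian. *)
Lemma local_dcc P I : prime_ideal P -> ideal I ->
  (forall Q, prime_ideal Q -> I `<=` Q -> Q `<=` P -> Q = P) ->
  forall K : nat -> set B, (forall n, ideal (K n)) -> (forall n, K n.+1 `<=` K n) ->
  (forall n, I `<=` K n) ->
  exists n, forall k, (n <= k)%N -> K n `<=` saturation P (K k).
Proof.
move=> pP; have [iP P1 pM] := pP.
move: I; apply: noetherian_ind => // I iI IH min K iK Kd IK.
have Kle n k : (n <= k)%N -> K k `<=` K n.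
  by move=> /subnK <-; elim: (k - n)%N => // j h; exact: subset_trans (Kd _) h.
have [[x Ix nPx]|IP] := pselect (exists2 x, I x & ~ P x).
  by exists 0%N => k _ u _; exists x => //; apply: idealMr => //; exact: IK.
have {}IP : I `<=` P by move=> x Ix; apply: contrapT => nP; apply: IP; exists x.
have [prI|nprI] := pselect (prime_ideal I).
  have eI : I = P by exact: min.
  have [[N hN]|h] := pselect (exists N, K N `<=` P).
    exists N => k _ u /hN; rewrite -{1}eI => /(IK k); exact: sub_saturation.
  exists 0%N => k _ u _; have [x Kx nPx] : exists2 x, K k x & ~ P x.
    apply: contrapT => h'; apply: h; exists k => x Kx.
    by apply: contrapT => nP; apply: h'; exists x.
  by exists x => //; exact: idealMr.
have [x [y [Ixy nIx nIy]]] : exists x y, [/\ I (x * y), ~ I x & ~ I y].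
  apply: contrapT => h; apply: nprI; split=> //; first by move=> /IP.
  move=> x y Ixy; apply: contrapT => /not_orP [nx ny]; apply: h; by exists x, y.
have iIx := adjoin_ideal x iI; have iIy := adjoin_ideal y iI.
have sIx := properI (@sub_adjoin _ I x) (mem_adjoin x iI) nIx.
have sIy := properI (@sub_adjoin _ I y) (mem_adjoin y iI) nIy.
have min' z Q : prime_ideal Q -> adjoin I z `<=` Q -> Q `<=` P -> Q = P.
  by move=> pQ IQ; apply: min => //; exact: subset_trans (@sub_adjoin _ I z) IQ.
(* Multiplication by [x] splits [K] into the chain of the K n + (x), above I + (x), and the chain of
   the K n : x, above I + (y) because x y lies in I. Both stabilize by induction. *)
have [n1 h1] := IH _ iIx sIx (min' x) (fun n => adjoin (K n) x)
  (fun n => adjoin_ideal x (iK n)) (fun n => @adjoinS _ _ _ x (Kd n))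
  (fun n => @adjoinS _ _ _ x (IK n)).
have [|n|n|n2 h2] := IH _ iIy sIy (min' y) (fun n => colon (K n) x).
- by move=> n; exact: colon_ideal.
- by move=> z; exact: Kd.
- apply: adjoin_sub; [exact: colon_ideal | exact: subset_trans (IK n) (sub_colon x (iK n)) |].
  by rewrite /colon /= mulrC; exact: IK.
exists (maxn n1 n2) => k; rewrite geq_max => /andP[le1 le2] u Ku.
have [s hs [v Kv [_ [b ->] e]]] : saturation P (adjoin (K k) x) u.
  by apply: (h1 k le1); apply: sub_adjoin; apply: Kle Ku; exact: leq_maxl.
have Kb : K (maxn n1 n2) (b * x).
  apply: (idealDr (iK _) (Kle _ _ _ v Kv)); rewrite ?geq_max ?le1 //.
  by rewrite -e; exact: idealMl.
have [t ht Kt] : saturation P (colon (K k) x) b.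
  by apply: (h2 k le2); apply: Kle Kb; exact: leq_maxr.
exists (t * s); first by move=> /pM [].
rewrite -mulrA e mulrDr; apply: idealD => //; first exact: idealMl.
by rewrite mulrA.
Qed.

Definition idealmul I J : set B :=
  [set z | forall K, ideal K -> (forall x y, I x -> J y -> K (x * y)) -> K z].

Lemma idealmul_ideal I J : ideal (idealmul I J).
Proof.
split=> [K iK _|x y hx hy K iK h|a x hx K iK h]; first exact: ideal0.
- by apply: idealD => //; [exact: hx | exact: hy].
- by apply: idealMl => //; exact: hx.
Qed.

Lemma mem_idealmul I J x y : I x -> J y -> idealmul I J (x * y).
Proof. by move=> hx hy K iK h; exact: h. Qed.

Lemma idealmulS I J J' : J `<=` J' -> idealmul I J `<=` idealmul I J'.
Proof. by move=> JJ x hx K iK h; apply: hx => // u v hu /JJ; exact: h. Qed.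

Lemma idealmul_gen I k (g : 'I_k -> B) z : ideal I -> idealmul I (ideal_gen g) z ->
  exists2 c : 'I_k -> B, forall j, I (c j) & z = \sum_j c j * g j.
Proof.
move=> iI h.
apply: (h [set z | exists2 c : 'I_k -> B, forall j, I (c j) & z = \sum_j c j * g j])
  => [|x _ hx [c ->]].
  split=> [|x y [c hc ->] [d hd ->]|a x [c hc ->]].
  - by exists (fun=> 0); [move=> _; exact: ideal0 | rewrite big1 // => i _; rewrite mul0r].
  - exists (fun i => c i + d i); first by move=> i; exact: idealD.
    by rewrite -big_split; apply: eq_bigr => i _; rewrite mulrDl.
  - exists (fun i => a * c i); first by move=> i; exact: idealMl.
    by rewrite mulr_sumr; apply: eq_bigr => i _; rewrite mulrA.
exists (fun i => x * c i); first by move=> i; exact: idealMr.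
by rewrite mulr_sumr; apply: eq_bigr => i _; rewrite mulrA.
Qed.

Lemma ideal_submodule I : ideal I -> @submodule B B^o I.
Proof.
by move=> iI; split=> [|a x y hx hy]; [exact: ideal0 | apply: idealD => //; exact: idealMl].
Qed.

(* The symbolic powers of Q modulo P. *)
Fixpoint sympow P Q n : set B :=
  if n is k.+1 then saturation Q (idealadd P (idealmul Q (sympow P Q k))) else setT.

Lemma sympow_ideal P Q n : ideal P -> prime_ideal Q -> ideal (sympow P Q n).
Proof.
move=> iP pQ; case: n => // n; apply: saturation_ideal => //.
by apply: idealadd_ideal => //; exact: idealmul_ideal.
Qed.

Lemma sympow_anti P Q n : sympow P Q n.+1 `<=` sympow P Q n.
Proof.
elim: n => // n IH x [s hs [u hu [v hv e]]]; exists s => //; exists u => //.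
by exists v => //; exact: idealmulS hv.
Qed.

Lemma sub_sympow P Q n : prime_ideal Q -> P `<=` sympow P Q n.
Proof.
move=> pQ; case: n => // n x hx; exists 1; first by case: pQ.
by exists x => //; exists 0; [exact: ideal0 (idealmul_ideal _ _) | rewrite addr0 mul1r].
Qed.

Lemma sympow_colon P Q n a b : prime_ideal Q -> ~ Q a -> sympow P Q n (b * a) ->
  sympow P Q n b.
Proof.
move=> [_ _ pM] ha; case: n => // n [s hs h]; exists (s * a); first by move=> /pM [].
by rewrite -mulrA (mulrC a).
Qed.

Lemma mem_sympow P Q n q : prime_ideal P -> prime_ideal Q -> Q q -> sympow P Q n (q ^+ n).
Proof.
move=> [iP _ _] pQ hq; elim: n => // n IH; exists 1; first by case: pQ.
exists 0; first exact: ideal0.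
by exists (q * q ^+ n); [exact: mem_idealmul | rewrite exprS mul1r add0r].
Qed.

(** Otherwise P is minimal over P0 + (a). Then the symbolic powers of Q modulo P0 stabilize modulo
    [a] in the local ring at P, Nakayama at P removes [a], and Nakayama at Q puts a symbolic power
    inside P0. It contains q^n for an element q of Q outside P0, which is absurd. *)
Theorem principal_ideal_theorem P0 Q P a :
  prime_ideal P0 -> prime_ideal Q -> prime_ideal P -> P0 `<` Q -> Q `<` P -> P a ->
  exists Q', [/\ prime_ideal Q', Q' a, P0 `<` Q' & Q' `<` P].
Proof.
move=> pP0 pQ pP /properE_notin[PQ0 [q Qq nq]] sQP Pa.
have [QP nPQ] := sQP.
have [Qa|nQa] := pselect (Q a); first by exists Q; split=> //; exact: properI Qq nq.
apply: contrapT => none.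
have iP0 : ideal P0 by case: pP0.
have iP : ideal P by case: pP.
have nP0a : ~ P0 a by move=> /PQ0.
have min Q' : prime_ideal Q' -> adjoin P0 a `<=` Q' -> Q' `<=` P -> Q' = P.
  move=> pQ' h QP'; apply: contrapT => ne; apply: none; exists Q'.
  have Qa' : Q' a by apply: h; exact: mem_adjoin.
  split=> //; first by apply: properI Qa' _ => //; exact: subset_trans (@sub_adjoin _ _ a) h.
  by split=> // h'; apply: ne; apply/seteqP.
pose S := sympow P0 Q.
have iS n : ideal (S n) by exact: sympow_ideal.
have [n hn] := local_dcc pP (adjoin_ideal a iP0) min (fun n => adjoin_ideal a (iS n))
  (fun n => @adjoinS _ _ _ a (@sympow_anti P0 Q n))
  (fun n => @adjoinS _ _ _ a (@sub_sympow P0 Q n pQ)).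
have {}hn u : S n u -> exists s b, [/\ ~ P s, S n b & S n.+1 (s * u - b * a)].
  move=> Su; have [s hs [v Sv [_ [b ->] e]]] := hn _ (leqnSn n) u (sub_adjoin _ Su).
  exists s, b; split=> //; last by rewrite e addrK.
  apply: (sympow_colon pQ nQa); apply: (idealDr (iS n) (sympow_anti Sv)).
  by rewrite -e; exact: idealMl.
have [k [g eg]] := nB (iS n).
have Sg i : S n (g i) by rewrite eg; exact: mem_ideal_gen.
have SS i : S n.+1 (g i).
  have [j|s hs h] := @nakayama _ B^o P (S n.+1) k g pP (ideal_submodule (iS _)) _ i.
    have [s [b [hs]]] := hn _ (Sg j); rewrite {1}eg => -[c ->] h.
    exists s, (fun j => a * c j); split=> //; first by move=> l; exact: idealMr.
    rewrite (_ : \sum_j _ = (\sum_i c i * g i) * a) // mulr_suml.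
    by apply: eq_bigr => l _; rewrite -[LHS]/(a * c l * g l) -mulrA mulrC.
  apply: (@sympow_colon _ _ _ s) => //; last by rewrite mulrC.
  by move=> /QP.
have gP0 i : P0 (g i).
  have [j|s hs] := @nakayama _ B^o Q P0 k g pQ (ideal_submodule iP0) _ i.
    have [s hs [u hu [v hv e]]] := SS j.
    have [c hc ev] : exists2 c : 'I_k -> B, forall j, Q (c j) & v = \sum_j c j * g j.
      by apply: idealmul_gen; [case: pQ | rewrite -eg].
    by exists s, c; split=> //; rewrite -[s *: _]/(s * g j) e ev addrK.
  by case: (pP0) => _ _ /[apply] -[/PQ0|].
apply: nq; apply: (@prime_pow _ P0 q n) => //.
have : S n (q ^+ n) by exact: mem_sympow.
by rewrite eg => -[c ->]; apply: ideal_sum => // i _; exact: idealMl.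
Qed.

Definition is_chain l (P : nat -> set B) : Prop :=
  (forall i, (i <= l)%N -> prime_ideal (P i)) /\ (forall i, (i < l)%N -> P i `<` P i.+1).

Lemma is_chain_rcons l (P : nat -> set B) Q : is_chain l P -> prime_ideal Q -> P l `<` Q ->
  is_chain l.+1 (fun i => if (i <= l)%N then P i else Q).
Proof.
move=> [pP sP] pQ lQ; split=> [i _|i].
  by case: ifP => //; exact: pP.
rewrite ltnS => il; rewrite il; case: ifP => [|/negbT]; first exact: sP.
by rewrite -leqNgt => li; have -> : i = l by apply/eqP; rewrite eqn_leq il li.
Qed.

(** The element [t] is pushed down the chain: the principal ideal theorem replaces the last prime
    but one by a prime containing [t], and induction treats the chain that ends there. *)
Lemma chain_shift l (P : nat -> set B) t : is_chain l.+1 P -> P l.+1 t ->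
  exists P' : nat -> set B, [/\ is_chain l P', P' 0%N t, P 0%N `<=` P' 0%N & P' l = P l.+1].
Proof.
elim: l P => [|l IH] P [pP sP] Pt.
  exists (fun=> P 1%N); split=> //; last exact: properW (sP _ _).
  by split=> // i _; exact: pP.
have [Q [pQ Qt lQ Ql]] := principal_ideal_theorem (pP l (leqW (leqnSn l))) (pP l.+1 (leqnSn _))
  (pP l.+2 (leqnn _)) (sP l (leqnSn _)) (sP l.+1 (leqnn _)) Pt.
have cPl : is_chain l P by split=> i h; [apply: pP | apply: sP]; rewrite ltnW // ltnW.
have [|P' [cP' P't PP' eP']] := IH _ (is_chain_rcons cPl pQ lQ); first by rewrite ltnn.
exists (fun i => if (i <= l)%N then P' i else P l.+2); split=> //=; last by rewrite ltnn.
apply: is_chain_rcons => //; first exact: pP.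
by rewrite eP' ltnn.
Qed.

End PrincipalIdealTheorem.

(** * Regular systems of parameters in a local ring *)

Section RegularSequences.
Variable B : comNzRingType.
Implicit Types (I J K Q : set B) (ts : seq B).

Definition adjoins I ts : set B :=
  [set z | forall K, ideal K -> I `<=` K -> (forall t, t \in ts -> K t) -> K z].

Lemma adjoins_ideal I ts : ideal (adjoins I ts).
Proof.
split=> [K iK _ _|x y hx hy K iK h h'|a x hx K iK h h']; first exact: ideal0.
- by apply: idealD => //; [exact: hx | exact: hy].
- by apply: idealMl => //; exact: hx.
Qed.

Lemma sub_adjoins I ts : I `<=` adjoins I ts.
Proof. by move=> x hx K _ IK _; exact: IK. Qed.

Lemma mem_adjoins I ts t : t \in ts -> adjoins I ts t.
Proof. by move=> ht K _ _; apply. Qed.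

Lemma adjoins_sub I ts K : ideal K -> I `<=` K -> (forall t, t \in ts -> K t) ->
  adjoins I ts `<=` K.
Proof. by move=> iK IK tK x; apply. Qed.

Lemma adjoins_perm I ts ts' : ts =i ts' -> adjoins I ts = adjoins I ts'.
Proof.
move=> e; apply/seteqP; split; apply: adjoins_sub; try exact: adjoins_ideal;
  try exact: sub_adjoins; by move=> t ht; apply: mem_adjoins; rewrite ?e // -e.
Qed.

Lemma adjoins_nil I : ideal I -> adjoins I [::] = I.
Proof. by move=> iI; apply/seteqP; split; [apply: adjoins_sub | exact: sub_adjoins]. Qed.

Lemma adjoins_cons I t ts : ideal I -> adjoins I (t :: ts) = adjoins (adjoin I t) ts.
Proof.
move=> iI; apply/seteqP; split; apply: adjoins_sub; try exact: adjoins_ideal.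
- by apply: subset_trans (@sub_adjoin _ _ t) _; exact: sub_adjoins.
- move=> x; rewrite inE => /predU1P [->|]; last exact: mem_adjoins.
  by apply: sub_adjoins; exact: mem_adjoin.
- apply: adjoin_sub; [exact: adjoins_ideal | exact: sub_adjoins |].
  by apply: mem_adjoins; rewrite mem_head.
- by move=> x hx; apply: mem_adjoins; rewrite inE hx orbT.
Qed.

Lemma adjoinsS I J ts : I `<=` J -> adjoins I ts `<=` adjoins J ts.
Proof.
move=> IJ; apply: adjoins_sub; [exact: adjoins_ideal | | exact: mem_adjoins].
exact: subset_trans IJ (@sub_adjoins _ _).
Qed.

Lemma adjoin_adjoins I t ts : ideal I -> adjoins (adjoin I t) ts = adjoin (adjoins I ts) t.
Proof.
move=> iI; apply/seteqP; split.
- apply: adjoins_sub; first exact/adjoin_ideal/adjoins_ideal.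
    by apply: adjoinS; exact: sub_adjoins.
  by move=> x hx; apply: sub_adjoin; exact: mem_adjoins.
- apply: adjoin_sub; first exact: adjoins_ideal.
    by apply: adjoinsS; exact: sub_adjoin.
  by apply: sub_adjoins; exact: mem_adjoin.
Qed.

Section Local.
Hypothesis nB : noetherian B.
Variable mm : set B.
Hypothesis pm : prime_ideal mm.
Hypothesis unit_mm : forall x, ~ mm x -> exists y, y * x = 1.

Lemma proper_sub_local I : ideal I -> ~ I 1 -> I `<=` mm.
Proof.
move=> iI nI x Ix; apply: contrapT => /unit_mm [y e]; apply: nI; rewrite -e.
exact: idealMl.
Qed.

Definition has_chain l I : Prop :=
  exists P : nat -> set B, is_chain l P /\ I `<=` P 0%N.

Lemma prime_sub_local Q : prime_ideal Q -> Q `<=` mm.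
Proof. by case=> iQ Q1 _; exact: proper_sub_local. Qed.

Lemma has_chain_top l I : has_chain l I ->
  exists P : nat -> set B, [/\ is_chain l P, I `<=` P 0%N & P l = mm].
Proof.
move=> [P [[pP sP] IP]]; case: l pP sP => [|l] pP sP.
  exists (fun=> mm); split=> //.
  by apply: subset_trans IP (prime_sub_local (pP 0%N _)).
exists (fun i => if (i <= l)%N then P i else mm); split=> //; last by rewrite ltnn.
apply: is_chain_rcons => //; first by split=> i h; [apply: pP | apply: sP]; exact: ltnW.
have [h1 h2] := sP l (leqnn _); have h3 := prime_sub_local (pP l.+1 (leqnn _)).
by split; [exact: subset_trans h1 h3 | move=> h4; apply: h2; exact: subset_trans h3 h4].
Qed.

Lemma has_chain_shift l I t : ideal I -> mm t -> has_chain l.+1 I -> has_chain l (adjoin I t).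
Proof.
move=> iI mt /has_chain_top [P [cP IP eP]].
have [|P' [cP' P't PP' _]] := @chain_shift B nB l P t cP; first by rewrite eP.
exists P'; split=> //; apply: adjoin_sub => //; last exact: subset_trans IP PP'.
by case: cP' => pP' _; case: (pP' 0%N).
Qed.

(** Krull's height theorem: by [has_chain_shift], adjoining one generator shortens a chain by at
    most one, and no chain of positive length lies above [mm]. *)
Lemma chain_le_generators ts I l : ideal I -> adjoins I ts = mm -> has_chain l I ->
  (l <= size ts)%N.
Proof.
elim: ts I l => [|t ts IH] I [|l] iI //; last first.
  move=> e hc; apply: (IH (adjoin I t)); [exact: adjoin_ideal | by rewrite -adjoins_cons |].
  by apply: has_chain_shift => //; rewrite -e; apply: mem_adjoins; rewrite mem_head.
rewrite adjoins_nil // => -> [P [[pP sP] IP]].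
have [_ []] := sP 0%N (ltn0Sn _).
by apply: subset_trans IP; apply: prime_sub_local; exact: pP.
Qed.

(** The quotient by I is a regular local ring with regular system of parameters [ts]: the chain has
    the greatest length that [chain_le_generators] allows. *)
Definition regular_generators I ts : Prop :=
  [/\ ideal I, adjoins I ts = mm & has_chain (size ts) I].

Lemma regular_generators_perm I ts ts' : perm_eq ts ts' ->
  regular_generators I ts -> regular_generators I ts'.
Proof.
move=> e [iI et hc]; split=> //; last by rewrite -(perm_size e).
by rewrite -et; apply: adjoins_perm => x; rewrite (perm_mem e).
Qed.

Lemma regular_generators_cons I t ts : regular_generators I (t :: ts) ->
  regular_generators (adjoin I t) ts.
Proof.
move=> [iI e hc]; split; [exact: adjoin_ideal | by rewrite -adjoins_cons |].
by apply: has_chain_shift => //; rewrite -e; apply: mem_adjoins; rewrite mem_head.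
Qed.

(** A regular local ring is a domain. By induction I + (t) is prime, and the bottom P 0 of a longest
    chain above I lies in it but does not contain [t]. Hence P 0 is contained in I + t (P 0), and
    Nakayama gives P 0 = I. *)
Lemma regular_generators_prime I ts : regular_generators I ts -> prime_ideal I.
Proof.
elim: ts I => [|t ts IH] I gI.
  by case: gI => iI; rewrite adjoins_nil // => ->.
have gJ := regular_generators_cons gI; have pJ := IH _ gJ.
have [iI e /has_chain_top [P [cP IP eP]]] := gI.
have mt : mm t by rewrite -e; apply: mem_adjoins; rewrite mem_head.
have [iJ eJ _] := gJ.
have [|P' [cP' P't PP' _]] := @chain_shift B nB (size ts) P t cP; first by rewrite eP.
have JP' : adjoin I t `<=` P' 0%N.
  apply: adjoin_sub => //; last exact: subset_trans IP PP'.
  by case: cP' => pP' _; case: (pP' 0%N).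
(* Otherwise [adjoin I t] placed below [P'] makes a chain above [adjoin I t] longer than the number
   of generators [ts] allows. *)
have P'J : P' 0%N `<=` adjoin I t.
  apply: contrapT => nJ; have := @chain_le_generators ts _ (size ts).+1 iJ eJ.
  rewrite ltnn => h; suff : false by []; apply: h.
  exists (fun i => if i is j.+1 then P' j else adjoin I t); split=> //; split.
    by case=> [|i] // h; case: cP' => pP' _; exact: pP'.
  by case=> [|i] // h; case: cP' => _; apply.
have [pP0 sP0] : prime_ideal (P 0%N) /\ P 0%N `<` P 1%N.
  by case: cP => pP sP; split; [exact: pP | exact: sP].
(* If [t] were in P 0, the whole chain [P] would lie above [adjoin I t], again too long. *)
have nP0t : ~ P 0%N t.
  move=> P0t; have := @chain_le_generators ts _ (size ts).+1 iJ eJ.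
  rewrite ltnn => h; suff : false by []; apply: h.
  by exists P; split=> //; apply: adjoin_sub => //; case: pP0.
suff <- : P 0%N = I by [].
apply/seteqP; split=> //.
have [iP0 _ pM0] := pP0.
have [k [g eg]] := nB iP0.
suff h i : I (g i) by rewrite eg => _ [c ->]; apply: ideal_sum => // i _; exact: idealMl.
have [j|s /unit_mm [y ey] h] := @nakayama _ B^o mm I k g pm (ideal_submodule iI) _ i; last first.
  by rewrite -(mul1r (g i)) -ey -mulrA; exact: idealMl.
have : P 0%N (g j) by rewrite eg; exact: mem_ideal_gen.
move=> gj; have [u Iu [_ [b ->] ej]] := P'J _ (PP' _ gj).
have : P 0%N (b * t).
  by apply: (idealDr iP0 (IP _ Iu)); rewrite -ej.
move=> /pM0 [|//]; rewrite eg => -[c eb].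
exists 1, (fun l => t * c l); split; first by case: pm.
  by move=> l; apply: idealMr => //; case: pm.
rewrite scale1r (_ : \sum_j _ = b * t) ?ej ?addrK // eb mulr_suml.
by apply: eq_bigr => l _; rewrite -[LHS]/(t * c l * g l) -mulrA mulrC.
Qed.

Definition nonzerodivisor I t : Prop := forall u, I (u * t) -> I u.

Lemma regular_generators_head I t ts : regular_generators I (t :: ts) -> nonzerodivisor I t.
Proof.
move=> gI; have [iI e hc] := gI; have [_ _ pI] := regular_generators_prime gI.
have nt : ~ I t.
  move=> It; have := @chain_le_generators ts I (size ts).+1 iI.
  rewrite ltnn => h; suff : false by []; apply: h => //.
  rewrite -e adjoins_cons //; congr adjoins; apply/seteqP; split; first exact: sub_adjoin.
  exact: adjoin_sub.
by move=> u /pI [].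
Qed.

(** If u t is in I + (x^(e+1)), then u is w x modulo I because [t] is regular modulo I + (x);
    cancelling x puts w t in I + (x^e), and the case e applies to w. *)
Lemma nonzerodivisor_adjoin_pow I x t e : ideal I -> nonzerodivisor I x ->
  nonzerodivisor (adjoin I x) t -> nonzerodivisor (adjoin I (x ^+ e)) t.
Proof.
move=> iI nx nt; elim: e => [|e IH] u.
  by move=> _; rewrite expr0; apply: ideal_unit; [exact: adjoin_ideal | exact: mem_adjoin].
move=> [i Ii [_ [v ->] eu]].
have [j Ij [_ [w ->] ew]] : adjoin I x u.
  apply: nt; exists i => //.
  by exists (v * x ^+ e * x); [exists (v * x ^+ e) | rewrite -mulrA -exprSr].
have [j' Ij' [_ [w' ->] ew']] : adjoin I (x ^+ e) w.
  apply: IH; have : I (w * t - v * x ^+ e).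
    apply: nx; rewrite (_ : _ * x = i - j * t); first by apply: idealB => //; exact: idealMr.
    have : (j + w * x) * t = i + v * x ^+ e.+1 by rewrite -ew eu.
    rewrite exprSr mulrDl => h; rewrite mulrBl -(mulrA v).
    have -> : w * t * x = i + v * (x ^+ e * x) - j * t by rewrite -h addrC addKr mulrAC.
    by rewrite addrAC addrK.
  move=> h; exists (w * t - v * x ^+ e) => //.
  by exists (v * x ^+ e); [exists v | rewrite subrK].
exists (j + j' * x); first by apply: idealD => //; exact: idealMr.
exists (w' * x ^+ e.+1); first by exists w'.
by rewrite ew ew' mulrDl exprSr mulrA addrA.
Qed.

(** The generators in [xs] are raised to powers one at a time. Both premises of
    [nonzerodivisor_adjoin_pow] are instances of the claim: one for [x], with [t] moved among [ys],
    the other for [t] modulo I + (x). This uses that regular generators may be permuted. *)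
Lemma regular_generators_pow e I t xs ys : regular_generators I (t :: xs ++ ys) ->
  nonzerodivisor (adjoins I [seq x ^+ e | x <- xs]) t.
Proof.
elim: xs I t ys => [|x xs IH] I t ys gI.
  by rewrite adjoins_nil; [exact: regular_generators_head gI | case: gI].
have iI : ideal I by case: gI.
rewrite /= adjoins_cons // adjoin_adjoins //.
apply: nonzerodivisor_adjoin_pow; first exact: adjoins_ideal.
  apply: (IH _ _ (t :: ys)); apply: regular_generators_perm gI.
  rewrite -(cat1s t ((x :: xs) ++ ys)) -[x :: xs ++ t :: ys]/((x :: xs) ++ t :: ys) -(cat1s t ys).
  by rewrite perm_catCA.
rewrite -adjoin_adjoins //; apply: (IH _ _ ys).
apply: regular_generators_cons; apply: regular_generators_perm gI.
by rewrite /= (perm_catCA [:: t] [:: x]).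
Qed.

End Local.

End RegularSequences.

(** * Submodules of finitely generated modules over a Noetherian ring *)

Section FinitelyGenerated.
Variables (B : comNzRingType) (V : lmodType B).
Hypothesis nB : noetherian B.

Definition spanned k (g : 'I_k -> V) : set V :=
  [set v | exists c : 'I_k -> B, v = \sum_i c i *: g i].

Lemma submodule_fin_gen k (h : 'I_k -> V) (L : set V) : submodule L -> L `<=` spanned h ->
  exists l (g : 'I_l -> V), (forall i, L (g i)) /\ L `<=` spanned g.
Proof.
elim: k h L => [|k IH] h L sL Lh.
  exists 0%N, (fun=> 0); split; first by case.
  by move=> x /Lh [c ->]; exists (fun=> 0); rewrite !big_ord0.
pose h' i := h (widen_ord (leqnSn k) i).
(* The coefficients that elements of L can have at the last generator. Subtracting lifts of
   generators of this ideal leaves elements in the span of the first [k]. *)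
pose I : set B := [set a | exists2 x, L x & exists c : 'I_k -> B,
  x = \sum_i c i *: h' i + a *: h ord_max].
have iI : ideal I.
  split=> [|a b [x Lx [c ex]] [y Ly [d ey]]|b a [x Lx [c ex]]].
  - exists 0; first by case: sL.
    by exists (fun=> 0); rewrite big1 ?scale0r ?addr0 // => i _; rewrite scale0r.
  - exists (x + y); first exact: submoduleD.
    exists (fun i => c i + d i); rewrite ex ey scalerDl addrACA -big_split; congr (_ + _).
    by apply: eq_bigr => i _; rewrite scalerDl.
  - exists (b *: x); first exact: submoduleZ.
    exists (fun i => b * c i); rewrite ex scalerDr scalerA scaler_sumr; congr (_ + _).
    by apply: eq_bigr => i _; rewrite scalerA.
have [r [a ea]] := nB iI.
have hx i : exists x, L x /\ exists c : 'I_k -> B, x = \sum_j c j *: h' j + a i *: h ord_max.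
  have : I (a i) by rewrite ea; exact: mem_ideal_gen.
  by move=> [x Lx hx]; exists x.
pose x i := sval (cid (hx i)).
have Lx i : L (x i) by case: (svalP (cid (hx i))).
have Dx i : exists c : 'I_k -> B, x i = \sum_j c j *: h' j + a i *: h ord_max.
  by case: (svalP (cid (hx i))).
have sh' : submodule (spanned h').
  split=> [|b _ _ [c ->] [d ->]].
    by exists (fun=> 0); rewrite big1 // => i _; rewrite scale0r.
  exists (fun i => b * c i + d i); rewrite scaler_sumr -big_split.
  by apply: eq_bigr => i _; rewrite scalerDl scalerA.
have sL' : submodule (L `&` spanned h').
  split=> [|b y z [Ly hy] [Lz hz]]; first by split; [case: sL | case: sh'].
  by split; [case: sL => _; apply | case: sh' => _; apply].
have [l [g [Lg gS]]] := IH h' _ sL' (@subIsetr _ _ _).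
exists (r + l)%N, (fun i => match split i with inl i => x i | inr j => g j end); split.
  by move=> i; case: (split i) => // j; case: (Lg j).
move=> y Ly; have [c] := Lh _ Ly; rewrite big_ord_recr /= => ey.
have : I (c ord_max) by exists y => //; exists (fun i => c (widen_ord (leqnSn k) i)).
rewrite ea => -[d ed].
have [e ee] : spanned g (y - \sum_i d i *: x i).
  apply: gS; split.
    apply: submoduleD => //; apply: submoduleN => //.
    by apply: submodule_sum => // i _; exact: submoduleZ.
  pose f i := sval (cid (Dx i)).
  have ef i : x i = \sum_j f i j *: h' j + a i *: h ord_max by exact: (svalP (cid (Dx i))).
  exists (fun j => c (widen_ord (leqnSn k) j) - \sum_i d i * f i j).
  rewrite ey ed (eq_bigr (fun i => d i *: (\sum_j f i j *: h' j) + d i *: (a i *: h ord_max)));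
    last by move=> i _; rewrite ef scalerDr.
  rewrite big_split /= scaler_suml opprD addrACA.
  rewrite [X in _ + (X - _)](eq_bigr (fun i => d i *: (a i *: h ord_max))); last first.
    by move=> i _; rewrite scalerA.
  rewrite subrr addr0 [RHS](eq_bigr (fun j => c (widen_ord (leqnSn k) j) *: h' j
     - \sum_i (d i * f i j) *: h' j)); last by move=> j _; rewrite scalerBl scaler_suml.
  rewrite sumrB exchange_big; congr (_ - _); apply: eq_bigr => i _.
  by rewrite scaler_sumr; apply: eq_bigr => j _; rewrite scalerA.
exists (fun i => match split i with inl i => d i | inr j => e j end).
rewrite big_split_ord /= -[LHS](subrK (\sum_i d i *: x i)) ee addrC; congr (_ + _).
  by apply: eq_bigr => i _; rewrite (unsplitK (inr i)).
by apply: eq_bigr => i _; rewrite (unsplitK (inl i)).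
Qed.

End FinitelyGenerated.

(** * Spans of q-th powers of functions *)

Section PowerSpan.
Variables (A : comNzRingType) (q : nat).
Implicit Types T : Type.

(* The Frobenius pullback of S, seen inside the functions on T. *)
Definition pspan T (S : set (T -> A)) : set (T -> A) :=
  [set y | exists l (c : 'I_l -> A) (w : 'I_l -> T -> A),
     (forall i, S (w i)) /\ y = fun k => \sum_i c i * w i k ^+ q].

Definition fun_submodule T (S : set (T -> A)) : Prop :=
  S (fun=> 0) /\ forall a w w', S w -> S w' -> S (fun k => a * w k + w' k).

Lemma fun_submodule_sum T (S : set (T -> A)) (I : Type) (r : seq I) (c : I -> A) w :
  fun_submodule S -> (forall i, S (w i)) -> S (fun k => \sum_(i <- r) c i * w i k).
Proof.
move=> [S0 SD] Sw; elim: r => [|i r IH].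
  by rewrite (_ : (fun k => _) = fun=> 0) //; apply: funext => k; rewrite big_nil.
rewrite (_ : (fun k => _) = fun k => c i * w i k + \sum_(j <- r) c j * w j k); first exact: SD.
by apply: funext => k; rewrite big_cons.
Qed.

Lemma pspan0 T (S : set (T -> A)) : pspan S (fun=> 0).
Proof.
exists 0%N, (fun=> 0), (fun _ _ => 0); split; first by case.
by apply: funext => k; rewrite big_ord0.
Qed.

Lemma pspanD T (S : set (T -> A)) y z : pspan S y -> pspan S z -> pspan S (fun k => y k + z k).
Proof.
move=> [l [c [w [Sw ->]]]] [l' [c' [w' [Sw' ->]]]].
exists (l + l')%N, (fun i => match split i with inl i => c i | inr j => c' j end),
  (fun i => match split i with inl i => w i | inr j => w' j end).
split; first by move=> i; case: split.
apply: funext => k; rewrite big_split_ord /=; congr (_ + _).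
  by apply: eq_bigr => i _; rewrite (unsplitK (inl i)).
by apply: eq_bigr => i _; rewrite (unsplitK (inr i)).
Qed.

Lemma pspanZ T (S : set (T -> A)) a y : pspan S y -> pspan S (fun k => a * y k).
Proof.
move=> [l [c [w [Sw ->]]]]; exists l, (fun i => a * c i), w; split=> //.
by apply: funext => k; rewrite mulr_sumr; apply: eq_bigr => i _; rewrite mulrA.
Qed.

Lemma pspan_gen T (S : set (T -> A)) w : S w -> pspan S (fun k => w k ^+ q).
Proof.
move=> Sw; exists 1%N, (fun=> 1), (fun=> w); split=> //.
by apply: funext => k; rewrite big_ord1 mul1r.
Qed.

Lemma pspan_genZ T (S : set (T -> A)) a w : S w -> pspan S (fun k => a * w k ^+ q).
Proof. by move=> Sw; apply: pspanZ; exact: pspan_gen. Qed.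

Lemma pspan_submodule T (S : set (T -> A)) : fun_submodule (pspan S).
Proof. by split=> [|a w w' hw hw']; [exact: pspan0 | apply: pspanD => //; exact: pspanZ]. Qed.

Lemma pspan_sum T (S : set (T -> A)) (I : Type) (r : seq I) (y : I -> T -> A) :
  (forall i, pspan S (y i)) -> pspan S (fun k => \sum_(i <- r) y i k).
Proof.
move=> h; have := @fun_submodule_sum _ _ _ r (fun=> 1) y (pspan_submodule S) h.
by congr pspan; apply: funext => k; apply: eq_bigr => i _; rewrite mul1r.
Qed.

Lemma pspan_sub T (S : set (T -> A)) (Z : set (T -> A)) : fun_submodule Z ->
  (forall w, S w -> Z (fun k => w k ^+ q)) -> pspan S `<=` Z.
Proof. by move=> sZ h _ [l [c [w [Sw ->]]]]; apply: fun_submodule_sum => // i; exact: h. Qed.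

Lemma pspanS T (S S' : set (T -> A)) : S `<=` S' -> pspan S `<=` pspan S'.
Proof.
by move=> SS; apply: pspan_sub; [exact: pspan_submodule | move=> w /SS; exact: pspan_gen].
Qed.

End PowerSpan.

(** * Flatness of the q-th power map over a regular local ring *)

Section FrobeniusPower.
Variables (A : comNzRingType) (q : nat).

Definition additive_power : Prop :=
  (0 < q)%N /\ forall x y : A, (x + y) ^+ q = x ^+ q + y ^+ q.

Hypothesis fq : additive_power.

Lemma powq0 : (0 : A) ^+ q = 0.
Proof. by rewrite expr0n; case: fq => /gtn_eqF ->. Qed.

Lemma powqD (x y : A) : (x + y) ^+ q = x ^+ q + y ^+ q.
Proof. by case: fq. Qed.

Lemma powqN (x : A) : (- x) ^+ q = - x ^+ q.
Proof. by apply: (addrI (x ^+ q)); rewrite -powqD !subrr powq0. Qed.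

Lemma powqB (x y : A) : (x - y) ^+ q = x ^+ q - y ^+ q.
Proof. by rewrite powqD powqN. Qed.

Lemma powq_sum (I : Type) (r : seq I) (P : pred I) (F : I -> A) :
  (\sum_(i <- r | P i) F i) ^+ q = \sum_(i <- r | P i) F i ^+ q.
Proof. exact: (big_morph (fun x => x ^+ q) powqD powq0). Qed.

Lemma powq_nat (n : bool) : (n%:R : A) ^+ q = n%:R.
Proof. by case: n; rewrite ?expr1n ?powq0. Qed.

Definition syzygies (T : finType) (a : T -> A) : set (T -> A) :=
  [set w | \sum_i w i * a i = 0].

Definition row_flat (T : finType) (a : T -> A) : Prop :=
  forall y, \sum_i y i * a i ^+ q = 0 -> pspan q (syzygies a) y.

(* Flatness of the q-th power map, in its equational form. *)
Definition frob_flat : Prop := forall (T : finType) (a : T -> A), row_flat a.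

Definition generated (T : finType) (a : T -> A) : set A :=
  [set x | exists c : T -> A, x = \sum_i c i * a i].

(** For a family generating J, [row_flat] expresses that Tor_1 of A/J against A vanishes, A being a
    module over itself through the q-th power map. Quantifying over the families makes this a
    property of J. *)
Definition flat_quotient (J : set A) : Prop :=
  forall (T : finType) (a : T -> A), generated a = J -> row_flat a.

Lemma mem_generated (T : finType) (a : T -> A) i : generated a (a i).
Proof.
exists (fun j => (j == i)%:R); rewrite (bigD1 i) //= eqxx mul1r big1 ?addr0 //.
by move=> j /negPf ->; rewrite mul0r.
Qed.

Lemma generated_ideal (T : finType) (a : T -> A) : ideal (generated a).
Proof.
split=> [|x y [c ->] [d ->]|b x [c ->]].
- by exists (fun=> 0); rewrite big1 // => i _; rewrite mul0r.
- by exists (fun i => c i + d i); rewrite -big_split; apply: eq_bigr => i _; rewrite mulrDl.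
- by exists (fun i => b * c i); rewrite mulr_sumr; apply: eq_bigr => i _; rewrite mulrA.
Qed.

Lemma generated_sub (T : finType) (a : T -> A) J : ideal J -> (forall i, J (a i)) ->
  generated a `<=` J.
Proof. by move=> iJ h _ [c ->]; apply: ideal_sum => // i _; exact: idealMl. Qed.

(** Write b = m a and a = n b, and let [q] denote entrywise powers. A relation y on b^[q] equals y
    (1 - m n)^[q] + (y m^[q]) n^[q]; the rows of 1 - m n are syzygies of b, and y m^[q] is a
    relation on a^[q]. *)
Lemma row_flat_generated (T : finType) (a : T -> A) : row_flat a ->
  flat_quotient (generated a).
Proof.
move=> ra U b eab y hy.
have hm i : generated a (b i) by rewrite -eab; exact: mem_generated.
have hn j : generated b (a j) by rewrite eab; exact: mem_generated.
pose m i := sval (cid (hm i)); have em i : b i = \sum_j m i j * a j by exact: svalP (cid (hm i)).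
pose n j := sval (cid (hn j)); have en j : a j = \sum_i n j i * b i by exact: svalP (cid (hn j)).
pose v i k := (k == i)%:R - \sum_j m i j * n j k.
have sv i : syzygies b (v i).
  rewrite /syzygies /= (eq_bigr (fun k => (k == i)%:R * b k - \sum_j m i j * (n j k * b k))).
    rewrite sumrB (bigD1 i) //= eqxx mul1r big1 ?addr0; last by move=> k /negPf ->; rewrite mul0r.
    rewrite exchange_big em; apply/eqP; rewrite subr_eq0; apply/eqP/eq_bigr => j _.
    by rewrite en mulr_sumr.
  by move=> k _; rewrite mulrBl mulr_suml; congr (_ - _); apply: eq_bigr => j _; rewrite mulrA.
pose z j := \sum_i y i * m i j ^+ q.
have /ra [l [c [w [sw ez]]]] : \sum_j z j * a j ^+ q = 0.
  rewrite -[RHS]hy (eq_bigr (fun j => \sum_i y i * (m i j * a j) ^+ q)); last first.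
    by move=> j _; rewrite mulr_suml; apply: eq_bigr => i _; rewrite exprMn mulrA.
  by rewrite /= exchange_big; apply: eq_bigr => i _; rewrite em powq_sum mulr_sumr.
have -> : y = fun k => \sum_i y i * v i k ^+ q + \sum_i c i * (\sum_j w i j * n j k) ^+ q.
  apply: funext => k.
  have -> : \sum_i c i * (\sum_j w i j * n j k) ^+ q = \sum_j z j * n j k ^+ q.
    rewrite (eq_bigr (fun i => \sum_j c i * (w i j ^+ q * n j k ^+ q))); last first.
      by move=> i _; rewrite powq_sum mulr_sumr; apply: eq_bigr => j _; rewrite exprMn.
    rewrite exchange_big; apply: eq_bigr => j _.
    by rewrite ez mulr_suml; apply: eq_bigr => i _; rewrite mulrA.
  rewrite (eq_bigr (fun i => (i == k)%:R * y i - \sum_j y i * m i j ^+ q * n j k ^+ q)).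
    rewrite sumrB (bigD1 k) //= eqxx mul1r big1 ?addr0; last by move=> i /negPf ->; rewrite mul0r.
    rewrite exchange_big (eq_bigr (fun j => z j * n j k ^+ q)) ?subrK //.
    by move=> j _; rewrite mulr_suml.
  move=> i _; rewrite powqB powq_nat mulrBr mulrC eq_sym; congr (_ - _).
  rewrite powq_sum mulr_sumr; apply: eq_bigr => j _; by rewrite exprMn mulrA.
apply: pspanD; apply: pspan_sum => i; apply: pspan_genZ => //.
rewrite /syzygies /= (eq_bigr (fun k => \sum_j w i j * (n j k * b k))).
  rewrite exchange_big (eq_bigr (fun j => w i j * a j)) ?sw // => j _.
  by rewrite en mulr_sumr.
by move=> k _; rewrite mulr_suml; apply: eq_bigr => j _; rewrite mulrA.
Qed.

Definition extend (T : finType) (a : T -> A) (t : A) (i : T + 'I_1) : A :=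
  match i with inl i => a i | inr _ => t end.

Lemma generated_extend (T : finType) (a : T -> A) t :
  generated (extend a t) = adjoin (generated a) t.
Proof.
apply/seteqP; split.
  apply: generated_sub; first exact/adjoin_ideal/generated_ideal.
  case=> i; first by apply: sub_adjoin; exact: mem_generated.
  by apply: mem_adjoin; exact: generated_ideal.
apply: adjoin_sub; first exact: generated_ideal.
  apply: generated_sub; first exact: generated_ideal.
  by move=> i; exact: (mem_generated (extend a t) (inl i)).
exact: (mem_generated (extend a t) (inr ord0)).
Qed.

(* From a relation on a^[q] and flatness modulo (a, t): the syzygies of (a, t)
   that generate it, split into their a-part w and their t-part s. *)
Lemma flat_quotient_extend (T : finType) (a : T -> A) t y :
  flat_quotient (adjoin (generated a) t) -> \sum_i y i * a i ^+ q = 0 ->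
  exists l (c s : 'I_l -> A) (w : 'I_l -> T -> A),
    [/\ y = fun k => \sum_i c i * w i k ^+ q, \sum_i c i * s i ^+ q = 0
      & forall i, \sum_k w i k * a k + s i * t = 0].
Proof.
move=> fJ hy; have := fJ _ (extend a t) (generated_extend a t) (extend y 0).
rewrite big_sumType /= big_ord1 mul0r addr0 => /(_ hy) [l [c [w [sw ey]]]].
exists l, c, (fun i => w i (inr ord0)), (fun i k => w i (inl k)); split.
- by apply: funext => k; have := congr1 (fun f => f (inl k)) ey.
- by have := congr1 (fun f => f (inr ord0)) ey => /= <-.
- by move=> i; have := sw i; rewrite /syzygies /= big_sumType big_ord1.
Qed.

(** The middle term of the Tor sequence of 0 -> A/(J : t) -> A/J -> A/(J + (t)) -> 0, carried out on
    relations. *)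
Lemma flat_quotient_colon J t : ideal J -> noetherian A -> flat_quotient (colon J t) ->
  flat_quotient (adjoin J t) -> flat_quotient J.
Proof.
move=> iJ nA fc fa T a eJ y hy.
rewrite -eJ in fa; have [l [c [s [w [ey cs ws]]]]] := flat_quotient_extend fa hy.
have [r [b eb]] := nA _ (colon_ideal t iJ).
(* The [s i] need not generate the colon ideal, so they are padded with generators [b], which will
   receive coefficient 0. *)
pose sb (i : 'I_l + 'I_r) := match i with inl i => s i | inr j => b j end.
have Js i : colon J t (s i).
  rewrite /colon /= -eJ; exists (fun k => - w i k); rewrite (eq_bigr (fun k => - (w i k * a k))).
    by rewrite sumrN; apply/eqP; rewrite -addr_eq0 addrC ws.
  by move=> k _; rewrite mulNr.
have Jb i : colon J t (b i) by rewrite eb; exact: mem_ideal_gen.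
have gsb : generated sb = colon J t.
  apply/seteqP; split; first by apply: generated_sub; [exact: colon_ideal | case].
  rewrite eb => _ [d ->]; apply: ideal_sum; first exact: generated_ideal.
  by move=> i _; apply: idealMl; [exact: generated_ideal | exact: (mem_generated sb (inr i))].
have := fc _ sb gsb (fun i => match i with inl i => c i | inr _ => 0 end).
rewrite big_sumType /= [X in _ + X]big1 ?addr0; last by move=> i _; rewrite mul0r.
move=> /(_ cs) [L [e [beta [sbeta ee]]]].
have ec i : c i = \sum_j e j * beta j (inl i) ^+ q by have := congr1 (fun f => f (inl i)) ee.
have e0 i : 0 = \sum_j e j * beta j (inr i) ^+ q by have := congr1 (fun f => f (inr i)) ee.
(* Writing b_i t through [a] corrects the combinations of the [w i] into syzygies of [a]; by [e0]
   the corrections contribute nothing to [y]. *)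
have hf i : generated a (b i * t) by rewrite eJ; exact: Jb.
pose f i := sval (cid (hf i)).
have ef i : b i * t = \sum_k f i k * a k by exact: svalP (cid (hf i)).
have -> : y = fun k => \sum_j e j *
    (\sum_i beta j (inl i) * w i k - \sum_i beta j (inr i) * f i k) ^+ q.
  apply: funext => k; rewrite (eq_bigr (fun j => \sum_i e j * (beta j (inl i) * w i k) ^+ q
     - \sum_i e j * (beta j (inr i) * f i k) ^+ q)); last first.
    by move=> j _; rewrite powqB mulrBr !powq_sum !mulr_sumr.
  rewrite sumrB exchange_big [X in _ - X]exchange_big /= [X in _ - X]big1 ?subr0.
    rewrite ey; apply: eq_bigr => i _; rewrite ec mulr_suml; apply: eq_bigr => j _.
    by rewrite exprMn mulrA.
  move=> i _; rewrite (eq_bigr (fun j => e j * beta j (inr i) ^+ q * f i k ^+ q)).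
    by rewrite -mulr_suml -e0 mul0r.
  by move=> j _; rewrite exprMn mulrA.
apply: pspan_sum => j; apply: pspan_genZ; rewrite /syzygies /=.
rewrite (eq_bigr (fun k => \sum_i beta j (inl i) * (w i k * a k)
   - \sum_i beta j (inr i) * (f i k * a k))); last first.
  move=> k _; rewrite mulrBl !mulr_suml; congr (_ - _).
    by apply: eq_bigr => i _; rewrite mulrA.
  by apply: eq_bigr => i _; rewrite mulrA.
rewrite sumrB exchange_big [X in _ - X]exchange_big /=.
rewrite (eq_bigr (fun i => - (beta j (inl i) * s i * t))); last first.
  move=> i _; rewrite -mulr_sumr -mulrA -mulrN; congr (_ * _).
  by apply/eqP; rewrite -addr_eq0 ws.
rewrite sumrN [X in _ - X](eq_bigr (fun i => beta j (inr i) * b i * t)); last first.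
  by move=> i _; rewrite -mulr_sumr -ef mulrA.
rewrite -opprD -!mulr_suml -mulrDl.
have := sbeta j; rewrite /syzygies /= big_sumType /= => ->.
by rewrite mul0r oppr0.
Qed.

Section Local.
Hypothesis nA : noetherian A.
Variable mm : set A.
Hypothesis pm : prime_ideal mm.
Hypothesis unit_mm : forall x, ~ mm x -> exists y, y * x = 1.

(** The Tor sequence of multiplication by [t] on A/J gives Tor_1 = t^q Tor_1, since the next term
    vanishes; Tor_1 is finitely generated, so Nakayama kills it. *)
Lemma flat_quotient_nonzerodivisor J t : ideal J -> mm t -> nonzerodivisor J t ->
  flat_quotient (adjoin J t) -> flat_quotient J.
Proof.
move=> iJ mt nt fa T a eJ; rewrite -eJ in fa.
(* Finite functions form an A-module, to which [submodule_fin_gen] and [nakayama] apply. The Tor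
   group is the quotient of [Y] by [W]. *)
pose V := {ffun T -> A^o}.
pose Y : set V := [set y | \sum_i y i * a i ^+ q = 0].
pose W : set V := [set y : V | pspan q (syzygies a) (y : T -> A)].
have sY : submodule Y.
  split=> [|b y z hy hz]; first by rewrite /Y /= big1 // => i _; rewrite ffunE mul0r.
  rewrite /Y /= (eq_bigr (fun i => b * (y i * a i ^+ q) + z i * a i ^+ q)).
    by rewrite big_split /= -mulr_sumr hy hz mulr0 addr0.
  by move=> i _; rewrite !ffunE mulrDl -[_ *: _]/(b * y i) mulrA.
have sW : submodule W.
  have [S0 SD] := pspan_submodule q (syzygies a).
  split=> [|b y z hy hz]; rewrite /W /=.
    by apply: (eq_ind _ (pspan q (syzygies a)) S0); apply: funext => k; rewrite ffunE.
  apply: (eq_ind _ (pspan q (syzygies a)) (SD b _ _ hy hz)).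
  by apply: funext => k; rewrite !ffunE.
pose h (i : 'I_#|T|) : V := [ffun k => (k == enum_val i)%:R].
have Yh : Y `<=` spanned h.
  move=> y _; exists (fun i => y (enum_val i)); apply/ffunP => k; rewrite sum_ffunE.
  rewrite (bigD1 (enum_rank k)) //= big1 ?addr0.
    by rewrite !ffunE enum_rankK eqxx -[RHS]/(_ * _) mulr1.
  move=> i ni; rewrite !ffunE (_ : k == enum_val i = false) ?scaler0 //.
  by apply: contra_neqF ni => /eqP ->; rewrite enum_valK.
have [r [g [Yg gS]]] := submodule_fin_gen nA sY Yh.
suff Wg i : W (g i).
  move=> y hy; have [|d ed] := gS (finfun y : V).
    by rewrite /Y /= -[RHS]hy; apply: eq_bigr => i _; rewrite ffunE.
  have : W (finfun y : V) by rewrite ed; apply: submodule_sum => // i _; exact: submoduleZ.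
  by congr pspan; apply: funext => k; rewrite ffunE.
have [j|s /unit_mm [u eu] hs] := @nakayama _ V mm W r g pm sW _ i; last first.
  by rewrite -(scale1r (g i)) -eu -scalerA; exact: submoduleZ.
have [l [c [s [w [ey cs ws]]]]] := flat_quotient_extend fa (Yg j).
(* Since [t] is regular modulo J, s_i t in J puts s_i = z_i a in J. Then w_i + t z_i is a syzygy of
   [a], whence y + t^q y' lies in [W], with y' again in [Y]. *)
have hs i' : generated a (s i').
  rewrite eJ; apply: nt; rewrite -eJ; exists (fun k => - w i' k).
  rewrite (eq_bigr (fun k => - (w i' k * a k))); last by move=> k _; rewrite mulNr.
  by rewrite sumrN; apply/eqP; rewrite -addr_eq0 addrC ws.
pose z i' := sval (cid (hs i')).
have ez i' : s i' = \sum_k z i' k * a k by exact: svalP (cid (hs i')).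
pose y' : V := [ffun k => \sum_i c i * z i k ^+ q].
have [d ed] : spanned g y'.
  apply: gS; rewrite /Y /= -[RHS]cs.
  rewrite (eq_bigr (fun k => \sum_i c i * (z i k * a k) ^+ q)); last first.
    by move=> k _; rewrite ffunE mulr_suml; apply: eq_bigr => i' _; rewrite exprMn mulrA.
  by rewrite exchange_big; apply: eq_bigr => i' _; rewrite ez powq_sum mulr_sumr.
exists 1, (fun i => - (t ^+ q * d i)); split; first by case: pm.
  move=> i'; case: pm => im _ _; apply: idealN => //; apply: idealMr => //.
  by case: fq => q0 _; rewrite -(prednK q0) exprS; exact: idealMr.
rewrite scale1r (eq_bigr (fun i => - (t ^+ q *: (d i *: g i)))); last first.
  by move=> i' _; rewrite scaleNr scalerA.
rewrite sumrN opprK -scaler_sumr -ed.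
have h' : pspan q (syzygies a) (fun k => \sum_i c i * (w i k + t * z i k) ^+ q).
  apply: pspan_sum => i'; apply: pspan_genZ; rewrite /syzygies /=.
  rewrite (eq_bigr (fun k => w i' k * a k + t * (z i' k * a k))); last first.
    by move=> k _; rewrite mulrDl mulrA.
  by rewrite big_split /= -mulr_sumr -ez mulrC ws.
apply: (eq_ind _ (pspan q (syzygies a)) h'); apply: funext => k; rewrite !ffunE.
rewrite -[t ^+ q *: _]/(t ^+ q * _) ey mulr_sumr -big_split; apply: eq_bigr => i' _.
by rewrite powqD exprMn mulrDr; congr (_ + _); rewrite mulrCA.
Qed.

Lemma adjoins0_generated (T : finType) (f : T -> A) :
  adjoins [set 0] [seq f i | i <- enum T] = generated f.
Proof.
apply/seteqP; split.
  apply: adjoins_sub; [exact: generated_ideal | |].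
    by move=> _ ->; exact: ideal0 (generated_ideal f).
  by move=> _ /mapP [i _ ->]; exact: mem_generated.
apply: generated_sub; first exact: adjoins_ideal.
by move=> i; apply: mem_adjoins; apply: map_f; rewrite mem_enum.
Qed.

Lemma nonzerodivisor_pow (I : set A) t e : nonzerodivisor I t -> nonzerodivisor I (t ^+ e).
Proof.
move=> nt; elim: e => [|e IH] u; first by rewrite expr0 mulr1.
by rewrite exprS mulrA => /IH /nt.
Qed.

(** By [regular_generators_pow] the first coordinate of a relation lies in the ideal of the
    remaining q-th powers, so Koszul relations reduce the length by one. Koszul relations on q-th
    powers are q-th powers of Koszul relations. *)
Lemma regular_generators_row_flat ts (l : nat) (a : 'I_l -> A) :
  regular_generators mm [set 0] ([seq a i | i <- enum 'I_l] ++ ts) -> row_flat a.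
Proof.
elim: l ts a => [|l IH] ts a gI y hy.
  by rewrite (_ : y = fun=> 0); [exact: pspan0 | apply: funext; case].
pose a' i := a (lift ord0 i).
move: gI; rewrite enum_ordSl /= -map_comp => gI.
have eseq : [seq (a \o lift ord0) i | i <- enum 'I_l] = [seq a' i | i <- enum 'I_l] by [].
rewrite eseq in gI.
have nz := @regular_generators_pow _ nA mm pm unit_mm q _ _ _ _ gI.
have gJ : regular_generators mm [set 0] ([seq a' i | i <- enum 'I_l] ++ a ord0 :: ts).
  apply: regular_generators_perm gI.
  by rewrite -(cat1s _ ts) -[X in perm_eq X _]/([:: a ord0] ++ _) perm_catCA.
have {IH}IH := IH _ _ gJ.
have e0 : y ord0 * a ord0 ^+ q = - \sum_i y (lift ord0 i) * a' i ^+ q.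
  by apply/eqP; rewrite -addr_eq0; move/eqP: hy; rewrite big_ord_recl.
have [c ec] : generated (fun i => a' i ^+ q) (y ord0).
  rewrite -adjoins0_generated.
  have -> : [seq a' i ^+ q | i <- enum 'I_l] = [seq x ^+ q | x <- [seq a' i | i <- enum 'I_l]].
    exact: (map_comp (fun x => x ^+ q) a' (enum 'I_l)).
  apply: (nonzerodivisor_pow (e := q) nz); rewrite e0; apply: (idealN (adjoins_ideal _ _)).
  apply: (ideal_sum _ (adjoins_ideal _ _)) => i _; apply: (idealMl _ (adjoins_ideal _ _)).
  by apply: mem_adjoins; apply: map_f; apply: map_f; rewrite mem_enum.
pose y' i := y (lift ord0 i) + c i * a ord0 ^+ q.
have [|L [d [w [sw ey']]]] := IH y'.
  rewrite (eq_bigr (fun i => y (lift ord0 i) * a' i ^+ q + a ord0 ^+ q * (c i * a' i ^+ q))).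
    by rewrite big_split /= -mulr_sumr -ec mulrC e0 subrr.
  by move=> i _; rewrite mulrDl (mulrC (c i)) mulrA.
pose w' j k : A := if unlift ord0 k is Some i then w j i else 0.
(* The Koszul syzygy pairing [a ord0] with [a' j]. *)
pose v j k : A := if unlift ord0 k is Some i then - (i == j)%:R * a ord0 else a' j.
have -> : y = fun k => \sum_j c j * v j k ^+ q + \sum_j d j * w' j k ^+ q.
  apply: funext => k; rewrite /v /w'; case: unliftP => [i ->|->].
    have := congr1 (fun f => f i) ey' => /= <-; rewrite /y' (bigD1 i) //= eqxx.
    rewrite big1 ?addr0; first by rewrite mulN1r powqN mulrN addrCA addNr addr0.
    by move=> j; rewrite eq_sym => /negPf ->; rewrite oppr0 mul0r powq0 mulr0.
  by rewrite [X in _ + X]big1 ?addr0 // => j _; rewrite powq0 mulr0.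
apply: pspanD; apply: pspan_sum => j; apply: pspan_genZ; rewrite /syzygies /= big_ord_recl.
  rewrite /v unlift_none (eq_bigr (fun i => - (i == j)%:R * a ord0 * a' i)); last first.
    by move=> i _; rewrite liftK.
  rewrite (bigD1 j) //= eqxx big1 ?addr0; first by rewrite mulN1r mulNr mulrC subrr.
  by move=> i /negPf ->; rewrite oppr0 !mul0r.
rewrite /w' unlift_none mul0r add0r -[RHS](sw j).
by apply: eq_bigr => i _; rewrite liftK.
Qed.

(** Besides J = A and J = [mm], take t in [mm] outside J. Then J + (t) is larger than J. If t is a
    zero divisor modulo J, so is J : t and the exact sequence applies; otherwise Nakayama does. *)
Lemma local_frob_flat ts : regular_generators mm [set 0] ts -> frob_flat.
Proof.
move=> gm T a; suff h J : ideal J -> flat_quotient J by apply: (h _ (generated_ideal a)).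
move: J; apply: noetherian_ind => // J iJ IH.
have [J1|nJ1] := pselect (J 1).
  have <- : generated (fun _ : 'I_1 => 1) = J.
    apply/seteqP; split; first exact: generated_sub.
    by move=> x _; exists (fun=> x); rewrite big_ord1 mulr1.
  apply: row_flat_generated => y; rewrite big_ord1 expr1n mulr1 => y0.
  by rewrite (_ : y = fun=> 0); [exact: pspan0 | apply: funext => i; rewrite (ord1 i)].
have Jm := proper_sub_local unit_mm iJ nJ1.
have [mJ|nmJ] := pselect (mm `<=` J).
  have ets : ts = [seq ts`_i | i : 'I_(size ts) <- enum 'I_(size ts)].
    transitivity (map (nth 0 ts) (map val (enum 'I_(size ts)))).
      by rewrite val_enum_ord map_nth_iota0 // take_size.
    exact: esym (map_comp _ _ _).
  have <- : generated (fun i : 'I_(size ts) => ts`_i) = J.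
    rewrite -adjoins0_generated -ets.
    by have [_ -> _] := gm; apply/seteqP.
  apply: row_flat_generated; apply: (@regular_generators_row_flat [::]).
  by rewrite cats0 -ets.
have [t mt nt] : exists2 t, mm t & ~ J t.
  apply: contrapT => h; apply: nmJ => t mt; apply: contrapT => nt; apply: h.
  by exists t.
have fa : flat_quotient (adjoin J t).
  apply: IH; first exact: adjoin_ideal.
  by apply: properI nt; [exact: sub_adjoin | exact: mem_adjoin].
have [nz|nnz] := pselect (nonzerodivisor J t); first exact: flat_quotient_nonzerodivisor fa.
apply: flat_quotient_colon (fa) => //; apply: IH; first exact: colon_ideal.
have [u Ju nu] : exists2 u, J (u * t) & ~ J u.
  apply: contrapT => h; apply: nnz => u Ju; apply: contrapT => nu; apply: h.
  by exists u.
by apply: properI nu; [exact: sub_colon|].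
Qed.

End Local.
End FrobeniusPower.

(** * Iterates of Frobenius, and flatness for regular local rings *)

Section PowerSpanComposition.
Variable A : comNzRingType.

Lemma additive_power_pchar p e : p \in [pchar A] -> additive_power A (p ^ e).
Proof.
move=> cp; have pp := pcharf_prime cp; split; first by rewrite expn_gt0 prime_gt0.
move=> x y; apply: exprDn_pchar; rewrite pnatX; apply/orP; left.
by rewrite pnatE.
Qed.

Lemma pspan_pspan q q' (T : Type) (S : set (T -> A)) : additive_power A q' ->
  pspan q' (pspan q S) `<=` pspan (q * q') S.
Proof.
move=> fq; apply: pspan_sub; first exact: pspan_submodule.
move=> _ [l [c [w [Sw ->]]]].
rewrite (_ : (fun k => _) = fun k => \sum_i c i ^+ q' * w i k ^+ (q * q')).
  by apply: pspan_sum => i; apply: pspan_genZ.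
by apply: funext => k; rewrite powq_sum //; apply: eq_bigr => i _; rewrite exprMn exprM.
Qed.

Lemma frob_flat_mul q q' : additive_power A q' -> frob_flat A q -> frob_flat A q' ->
  frob_flat A (q * q').
Proof.
move=> fq h h' T a y hy; apply: pspan_pspan => //.
have : pspan q' (syzygies (fun i => a i ^+ q)) y.
  by apply: h'; rewrite -[RHS]hy; apply: eq_bigr => i _; rewrite exprM.
by apply: pspanS => w hw; apply: h.
Qed.

Lemma frob_flat_exp p e : p \in [pchar A] -> frob_flat A p -> frob_flat A (p ^ e).
Proof.
move=> cp h; elim: e => [|e IH].
  move=> T a y; rewrite expn0 => hy.
  rewrite (_ : y = fun k => y k ^+ 1); last by apply: funext => k; rewrite expr1.
  apply: pspan_gen; rewrite /syzygies /= -[RHS]hy.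
  by apply: eq_bigr => i _; rewrite expr1.
by rewrite expnSr; apply: frob_flat_mul => //; rewrite -[p]expn1; exact: additive_power_pchar.
Qed.

Lemma regular_local_frob_flat p : p \in [pchar A] -> regular_local A -> frob_flat A p.
Proof.
move=> cp [nA [mm [mmax muniq [d [[dchain _] [g eg]]]]]].
have um x : ~ mm x -> exists y, y * x = 1.
  move=> nx; have [[b e]|h] := pselect (principal x 1); first by exists b.
  have [P mP xP] := exists_maximal nA (principal_ideal x) h.
  by case: nx; rewrite -(muniq _ mP); apply: xP; exists 1; rewrite mul1r.
(* The generators [g] are as many as the Krull dimension, hence regular generators over the zero
   ideal. *)
apply: (@local_frob_flat _ _ _ nA mm (maximal_prime mmax) um [seq g i | i <- enum 'I_d]).
  by rewrite -[p]expn1; exact: additive_power_pchar.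
split; first exact: ideal_zero.
  by rewrite adjoins0_generated eg.
rewrite size_map size_enum_ord; have [P [pP sP]] := dchain.
exists P; split=> // _ ->; by case: (pP 0%N (leq0n _)) => -[].
Qed.

End PowerSpanComposition.

(** * Passage from localizations to the ring *)

Section Globalization.
Variables (A : comNzRingType) (P : set A) (hP : prime_ideal P).

Definition to_loc (a : A) : localization hP := loc_frac hP a (one_notin_prime hP).

Lemma to_locP a b : to_loc a = to_loc b <-> exists2 u, ~ P u & u * a = u * b.
Proof.
rewrite /to_loc /loc_frac; split=> [/loc_piP|h]; last apply/loc_piP.
  by rewrite !(numer_mkfrac, denom_mkfrac) !mulr1.
by rewrite !(numer_mkfrac, denom_mkfrac) !mulr1.
Qed.

Lemma to_locD : {morph to_loc : a b / a + b}.
Proof.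
move=> a b; rewrite -[RHS]/(loc_add _ _) loc_addE; apply/loc_piP.
exists 1; first exact: one_notin_prime.
by rewrite !(numer_mkfrac, denom_mkfrac) !mulr1.
Qed.

Lemma to_locM : {morph to_loc : a b / a * b}.
Proof.
move=> a b; rewrite -[RHS]/(loc_mul _ _) loc_mulE; apply/loc_piP.
exists 1; first exact: one_notin_prime.
by rewrite !(numer_mkfrac, denom_mkfrac) !mulr1.
Qed.

Lemma to_loc0 : to_loc 0 = 0. Proof. by []. Qed.
Lemma to_loc_sum (I : Type) (r : seq I) (F : I -> A) :
  to_loc (\sum_(i <- r) F i) = \sum_(i <- r) to_loc (F i).
Proof. exact: (big_morph to_loc to_locD to_loc0). Qed.

Lemma to_locX a n : to_loc (a ^+ n) = to_loc a ^+ n.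
Proof. by elim: n => [|n IH]; rewrite ?expr0 // !exprS to_locM IH. Qed.

Lemma to_loc_nat n : to_loc n%:R = n%:R.
Proof. by elim: n => // n IH; rewrite -!natr1 to_locD IH. Qed.

Lemma pchar_localization p : p \in [pchar A] -> p \in [pchar (localization hP)].
Proof.
move=> cp; rewrite inE (pcharf_prime cp) /= -to_loc_nat.
by move: cp; rewrite inE => /andP[_ /eqP ->]; rewrite to_loc0.
Qed.

Lemma loc_denominator (z : localization hP) : exists s a, ~ P s /\ to_loc s * z = to_loc a.
Proof.
elim/loc_piW: z => x; exists (denom x), (numer x); split; first exact: denomP.
rewrite -[LHS]/(loc_mul _ _) loc_mulE; apply/loc_piP.
exists 1; first exact: one_notin_prime.
by rewrite !(numer_mkfrac, denom_mkfrac) !mulr1 !mul1r mulrC.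
Qed.

Lemma common_multiple (I : finType) (Q : I -> A -> Prop) :
  (forall i u v, Q i u -> Q i (v * u)) -> (forall i, exists2 u, ~ P u & Q i u) ->
  exists2 u, ~ P u & forall i, Q i u.
Proof.
move=> QM h; pose u i := s2val (cid2 (h i)); exists (\prod_i u i).
  elim/big_ind: _ => [|x y|i _]; [exact: one_notin_prime | exact: mul_notin_prime |].
  exact: s2valP (cid2 (h i)).
move=> i; rewrite (bigD1 i) //= mulrC; apply: QM; exact: s2valP' (cid2 (h i)).
Qed.

Lemma common_denominator (I : finType) (z : I -> localization hP) :
  exists s (a : I -> A), ~ P s /\ forall i, to_loc s * z i = to_loc (a i).
Proof.
have [i u v [a e]|i|s hs h] := @common_multiple I (fun i s => exists a, to_loc s * z i = to_loc a).
- by exists (v * a); rewrite !to_locM -mulrA e.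
- by have [s [a [hs e]]] := loc_denominator (z i); exists s => //; exists a.
- by exists s, (fun i => sval (cid (h i))); split=> // i; exact: svalP (cid (h i)).
Qed.

End Globalization.

(** The s with s y in the span form an ideal D. If D were proper, flatness at a maximal ideal P
    containing D would yield, after clearing denominators, an element of D outside P. *)
Lemma frob_flat_local (A : comNzRingType) q : noetherian A ->
  (forall (P : set A) (hP : prime_ideal P), frob_flat (localization hP) q) -> frob_flat A q.
Proof.
move=> nA loc T a y hy.
pose D : set A := [set s | pspan q (syzygies a) (fun k => s * y k)].
have [S0 SD] := pspan_submodule q (syzygies a).
have iD : ideal D.
  split=> [|s t hs ht|b s hs].
  - by apply: (eq_ind _ (pspan q (syzygies a)) S0); apply: funext => k; rewrite mul0r.
  - apply: (eq_ind _ (pspan q (syzygies a)) (pspanD hs ht)).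
    by apply: funext => k; rewrite mulrDl.
  - apply: (eq_ind _ (pspan q (syzygies a)) (pspanZ b hs)).
    by apply: funext => k; rewrite mulrA.
have [D1|nD1] := pselect (D 1).
  by apply: (eq_ind _ (pspan q (syzygies a)) D1); apply: funext => k; rewrite mul1r.
have [P mP DP] := exists_maximal nA iD nD1; have hP := maximal_prime mP.
pose f := to_loc hP.
have [|l [c [w [sw ey]]]] := loc P hP T (f \o a) (f \o y).
  rewrite -[RHS](to_loc0 hP) -[X in _ = to_loc hP X]hy to_loc_sum; apply: eq_bigr => i _.
  by rewrite to_locM to_locX.
(* Denominators are cleared in stages: [s0] for the coefficients, [s1] for the vectors, [u] to make
   the vectors syzygies over A, [v] to turn the equality in the localization into one in A. Vectors
   enter through q-th powers, hence the factor (u s1)^q. *)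
have [s0 [c' [hs0 ec]]] := common_denominator c.
have [s1 [w' [hs1 ew]]] := common_denominator (fun i : 'I_l * T => w i.1 i.2).
have [i u v /= e|i|u hu eu] := @common_multiple _ P hP 'I_l
  (fun i u => u * \sum_k w' (i, k) * a k = 0).
- by rewrite -mulrA e mulr0.
- have /to_locP [u hu e] : to_loc hP (\sum_k w' (i, k) * a k) = to_loc hP 0.
    rewrite to_loc_sum to_loc0 (eq_bigr (fun k => f s1 * (w i k * f (a k)))).
      by rewrite -mulr_sumr (sw i) mulr0.
    by move=> k _; rewrite to_locM -ew mulrA.
  by exists u => //; rewrite e mulr0.
pose w'' i k := u * w' (i, k).
have [k v v' /= e|k|v hv ev] := @common_multiple _ P hP T
  (fun k v => v * (s0 * (u * s1) ^+ q * y k) = v * \sum_i c' i * w'' i k ^+ q).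
- by rewrite -!mulrA; rewrite -!mulrA in e; rewrite e.
- apply/(to_locP hP); rewrite to_locM -[to_loc hP (y k)]/((f \o y) k) ey to_loc_sum mulr_sumr.
  apply: eq_bigr => i _; rewrite !(to_locM, to_locX) -ec -(ew (i, k)) /=.
  by rewrite (mulrA (to_loc hP u)) [X in _ = _ * X]exprMn mulrACA.
suff /DP : D (v * (s0 * (u * s1) ^+ q)).
  have nP : ~ P (v * (s0 * (u * s1) ^+ q)).
    apply: mul_notin_prime => //; apply: mul_notin_prime => //.
    by move=> /(prime_pow hP); apply: mul_notin_prime.
  by move=> /nP.
have : pspan q (syzygies a) (fun k => v * \sum_i c' i * w'' i k ^+ q).
  apply: pspanZ; apply: pspan_sum => i; apply: pspan_genZ; rewrite /syzygies /=.
  by rewrite -[RHS](eu i) mulr_sumr; apply: eq_bigr => k _; rewrite mulrA.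
move=> h; apply: (eq_ind _ (pspan q (syzygies a)) h); apply: funext => k.
by rewrite -ev !mulrA.
Qed.

Theorem regular_frob_flat (A : comNzRingType) p e : p \in [pchar A] -> regular_ring A ->
  frob_flat A (p ^ e).
Proof.
move=> cp [nA rA]; apply: frob_flat_exp => //; apply: frob_flat_local => // P hP.
by apply: regular_local_frob_flat; [exact: pchar_localization | exact: rA].
Qed.

(** * Elimination of coordinates by flatness *)

Section Elimination.
Variables (A : comNzRingType) (q : nat).
Hypotheses (fq : additive_power A q) (flatA : frob_flat A q).

(** Pullback commutes with the kernel of evaluation at a point x: if the sum of the c_i w_i(x)^q is
    0, flatness expresses the c_i by q-th powers of syzygies of the w_i(x), and the vectors
    recombined along these vanish at x. *)
Lemma pspan_vanish (T : eqType) (S : set (T -> A)) (X : seq T) y : fun_submodule S ->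
  pspan q S y -> (forall x, x \in X -> y x = 0) ->
  pspan q [set w | S w /\ forall x, x \in X -> w x = 0] y.
Proof.
elim: X S => [|x X IH] S sS hy yX.
  by apply: pspanS hy => w Sw; split.
have [S0 SD] := sS.
pose S' : set (T -> A) := [set w | S w /\ w x = 0].
have sS' : fun_submodule S'.
  split; first by split.
  by move=> a w w' [Sw wx] [Sw' w'x]; split; [exact: SD | rewrite wx w'x mulr0 addr0].
suff hy' : pspan q S' y.
  apply: pspanS (IH S' sS' hy' _) => [w [[Sw wx] wX]|z zX]; last first.
    by apply: yX; rewrite inE zX orbT.
  by split=> // z; rewrite inE => /predU1P [->|]; [|exact: wX].
have [l [c [w [Sw ey]]]] := hy.
have /flatA [L [e [b [sb ec]]]] : \sum_i c i * w i x ^+ q = 0.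
  by rewrite -[RHS](yX x) ?mem_head // ey.
have -> : y = fun k => \sum_j e j * (\sum_i b j i * w i k) ^+ q.
  apply: funext => k; rewrite ey ec (eq_bigr (fun i => \sum_j e j * (b j i * w i k) ^+ q)).
    by rewrite exchange_big; apply: eq_bigr => j _; rewrite powq_sum // mulr_sumr.
  by move=> i _; rewrite mulr_suml; apply: eq_bigr => j _; rewrite exprMn mulrA.
apply: pspan_sum => j; apply: pspan_genZ.
by split; [exact: fun_submodule_sum | exact: sb].
Qed.

End Elimination.

(** * Division of exponents by p *)

Section Exponents.
Variables (N p : nat).
Hypothesis p_gt0 : (0 < p)%N.
Implicit Types u v : 'X_{1..N}.

Definition mnm_mod u : 'X_{1..N} := [multinom (u i %% p)%N | i < N].
Definition mnm_div u : 'X_{1..N} := [multinom (u i %/ p)%N | i < N].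
Definition mnm_small u : Prop := forall i, (u i < p)%N.

Lemma mnm_divmod u : u = (mnm_mod u + mnm_div u *+ p)%MM.
Proof. by apply/mnmP => i; rewrite mnmDE mulmnE !mnmE addnC -divn_eq. Qed.

Lemma mnm_mod_small u : mnm_small (mnm_mod u).
Proof. by move=> i; rewrite mnmE ltn_pmod. Qed.

Lemma mnm_modDM u v : mnm_mod (u + v *+ p)%MM = mnm_mod u.
Proof.
by apply/mnmP => i; rewrite [LHS]mnmE [RHS]mnmE mnmDE mulmnE addnC modnMDl.
Qed.

Lemma mnm_divDM u v : mnm_div (u + v *+ p)%MM = (mnm_div u + v)%MM.
Proof.
apply/mnmP => i; rewrite [LHS]mnmE [RHS]mnmDE mnmDE mulmnE [X in (_ = X + _)%N]mnmE.
by rewrite addnC divnMDl // addnC.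
Qed.

Lemma mnm_small_mod u : mnm_small u -> mnm_mod u = u.
Proof. by move=> h; apply/mnmP => i; rewrite mnmE modn_small. Qed.

Lemma mnm_small_div u : mnm_small u -> mnm_div u = 0%MM.
Proof. by move=> h; apply/mnmP => i; rewrite mnmE divn_small // mnm0E. Qed.

End Exponents.

Local Notation "a ** x" := (mpolyC _ a *: x) (at level 40, left associativity).

(** * Linear functionals on polynomials *)

Section LinearExtension.
Variables (A : comNzRingType) (N : nat).
Local Notation R := {mpoly A[N]}.
Implicit Types (f : 'X_{1..N} -> A) (r s : R).

Definition mlin f r : A := \sum_(u <- msupp r) r@_u * f u.

Lemma mlinE f r (X : seq 'X_{1..N}) : uniq X -> {subset msupp r <= X} ->
  mlin f r = \sum_(u <- X) r@_u * f u.
Proof.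
move=> uX sX; rewrite [RHS](bigID (mem (msupp r))) /= [X in _ + X]big1 ?addr0; last first.
  by move=> u hu; rewrite memN_msupp_eq0 ?mul0r.
rewrite -big_filter /mlin; apply: perm_big; apply: uniq_perm; rewrite ?msupp_uniq ?filter_uniq //.
by move=> u; rewrite mem_filter; case: (boolP (u \in msupp r)) => //= /sX ->.
Qed.

Lemma mlinD f r s : mlin f (r + s) = mlin f r + mlin f s.
Proof.
pose X := undup (msupp r ++ msupp s ++ msupp (r + s)).
have hX (t : R) : {subset msupp t <= msupp r ++ msupp s ++ msupp (r + s)} -> {subset msupp t <= X}.
  by move=> h u /h; rewrite mem_undup.
rewrite !(@mlinE f _ X) ?undup_uniq //; first last.
- by apply: hX => u hu; rewrite !mem_cat hu !orbT.
- by apply: hX => u hu; rewrite !mem_cat hu.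
- by apply: hX => u hu; rewrite !mem_cat hu !orbT.
by rewrite -big_split; apply: eq_bigr => u _; rewrite mcoeffD mulrDl.
Qed.

Lemma mlin0 f : mlin f 0 = 0.
Proof. by rewrite /mlin msupp0 big_nil. Qed.

Lemma mlin_sum f (I : Type) (r : seq I) (F : I -> R) :
  mlin f (\sum_(i <- r) F i) = \sum_(i <- r) mlin f (F i).
Proof. exact: (big_morph (mlin f) (mlinD f) (mlin0 f)). Qed.

Lemma mlinX f c u : mlin f (c *: 'X_[u]) = c * f u.
Proof.
rewrite (@mlinE f _ [:: u]) //.
  by rewrite big_seq1 mcoeffZ mcoeffX eqxx mulr1.
by move=> v /msuppZ_le; rewrite msuppX.
Qed.

End LinearExtension.

(** * The components of F_R(M) at exponents below p *)

Section TensorRelations.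
Variables (A : comNzRingType) (N p : nat).
Local Notation R := {mpoly A[N]}.
Variable M : lmodType R.
Hypothesis cp : p \in [pchar A].
Implicit Types (x y : M) (a b : A).

Let p_gt0 : (0 < p)%N. Proof. exact: prime_gt0 (pcharf_prime cp). Qed.
Let fp : additive_power A p.
Proof. by rewrite -[p]expn1; exact: additive_power_pchar. Qed.

Lemma additive_power_mpoly : additive_power R p.
Proof.
rewrite -[p]expn1; apply: additive_power_pchar; rewrite inE (pcharf_prime cp) /=.
by rewrite -mpolyC_nat; move: cp; rewrite inE => /andP[_ /eqP ->]; rewrite mpolyC0.
Qed.

(** Formal sums become elements of the free A-module on M, encoded as functions; [relations] is then
    the kernel of the map from that free module to M. *)
Definition pushforward (s : seq (A * M)) : M -> A :=
  fun y => \sum_(t <- s) t.1 * (y == t.2)%:R.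

Definition relations : set (M -> A) :=
  [set w | exists s, \sum_(t <- s) t.1 ** t.2 = 0 /\ w = pushforward s].

(* Under R = (+)_I A[x^p] x^I, with I < p, the coordinate at I of a formal sum in
   F_R(M) = (+)_I x^I (A (x)_F M). *)
Definition component (I : 'X_{1..N}) (s : seq (R * M)) : M -> A :=
  fun y => \sum_(t <- s)
    mlin (fun u => (mnm_mod p u == I)%:R * (y == 'X_[mnm_div p u] *: t.2)%:R) t.1.

Lemma powX (r : R) : r ^+ p = \sum_(v <- msupp r) r@_v ^+ p *: 'X_[(v *+ p)%MM].
Proof.
rewrite {1}[r]mpolyE (powq_sum additive_power_mpoly); apply: eq_bigr => v _.
by rewrite exprZn mpolyXn.
Qed.

Lemma mlin_bal (f : 'X_{1..N} -> A) (a r : R) : mlin f (a * r ^+ p) =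
  \sum_(u <- msupp a) a@_u * \sum_(v <- msupp r) r@_v ^+ p * f (u + v *+ p)%MM.
Proof.
rewrite {1}[a]mpolyE mulr_suml mlin_sum; apply: eq_bigr => u _.
rewrite powX [in LHS]mulr_sumr mlin_sum [in RHS]mulr_sumr; apply: eq_bigr => v _.
by rewrite -scalerAl -scalerAr scalerA -mpolyXD mlinX mulrA.
Qed.

(** So [component I] descends to F_R(M), with values in the free A-module on M modulo p-th powers of
    [relations]. Only two generators of the congruence produce relations: x + y against x and y, and
    r x against its monomial terms, both multiplied by the part of the monomial that moves through
    the tensor sign. *)
Lemma tensor_rel_component s t : tensor_rel p s t ->
  forall I, pspan p relations (fun y => component I s y - component I t y).
Proof.
elim=> {s t}.
- move=> s I; rewrite (_ : (fun y => _) = fun=> 0); first exact: pspan0.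
  by apply: funext => y; rewrite subrr.
- move=> s t _ IH I; rewrite (_ : (fun y => _) = fun y => -1 * (component I s y - component I t y)).
    exact: pspanZ.
  by apply: funext => y; rewrite mulN1r opprB.
- move=> s t u _ IH _ IH' I.
  rewrite (_ : (fun y => _) = fun y => (component I s y - component I t y)
    + (component I t y - component I u y)); first exact: pspanD.
  by apply: funext => y; rewrite addrA subrK.
- move=> s s' t t' _ IH _ IH' I.
  rewrite (_ : (fun y => _) = fun y => (component I s y - component I s' y)
    + (component I t y - component I t' y)); first exact: pspanD.
  by apply: funext => y; rewrite /component !big_cat /= opprD addrACA.
- move=> s t I; rewrite (_ : (fun y => _) = fun=> 0); first exact: pspan0.
  by apply: funext => y; rewrite /component !big_cat /= [X in _ - X]addrC subrr.
- move=> x I; rewrite (_ : (fun y => _) = fun=> 0); first exact: pspan0.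
  by apply: funext => y; rewrite /component big_seq1 big_nil mlin0 subrr.
- move=> a b x I; rewrite (_ : (fun y => _) = fun=> 0); first exact: pspan0.
  by apply: funext => y; rewrite /component big_seq1 big_cons big_seq1 mlinD subrr.
- move=> a x y I.
  pose s u : seq (A * M) := [:: (1, 'X_[mnm_div p u] *: (x + y));
    (-1, 'X_[mnm_div p u] *: x); (-1, 'X_[mnm_div p u] *: y)].
  rewrite (_ : (fun z => _) = fun z => \sum_(u <- msupp a)
     (a@_u * (mnm_mod p u == I)%:R) * pushforward (s u) z ^+ p).
    apply: pspan_sum => u; apply: pspan_genZ; exists (s u); split=> //.
    rewrite !big_cons big_nil /= addr0 mpolyCN mpolyC1 scale1r !scaleN1r scalerDr.
    by rewrite -opprD subrr.
  apply: funext => z; rewrite /component big_seq1 big_cons big_seq1 /= /mlin -big_split -sumrB.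
  apply: eq_bigr => u _; rewrite /pushforward !big_cons big_nil /= addr0 mul1r !mulN1r.
  rewrite !(powqD fp) !(powqN fp) !(powq_nat fp) -!mulrA -mulrDr -mulrBr.
  by congr (_ * _); rewrite -mulrDr -mulrBr opprD.
- move=> a r x I.
  pose s u : seq (A * M) := (1, 'X_[mnm_div p u] *: (r *: x)) ::
    [seq (- r@_v, 'X_[(mnm_div p u + v)%MM] *: x) | v <- msupp r].
  rewrite (_ : (fun z => _) = fun z => \sum_(u <- msupp a)
     (a@_u * (mnm_mod p u == I)%:R) * pushforward (s u) z ^+ p).
    apply: pspan_sum => u; apply: pspan_genZ; exists (s u); split=> //.
    rewrite big_cons big_map /= mpolyC1 scale1r {1}[r]mpolyE scaler_suml scaler_sumr -big_split.
    apply: big1 => v _ /=; rewrite mpolyCN scaleNr -mul_mpolyC mpolyXD !scalerA.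
    by rewrite mulrCA mulrA subrr.
  apply: funext => z; rewrite /component !big_seq1 /= mlin_bal /mlin -sumrB.
  apply: eq_bigr => u _; rewrite /pushforward big_cons [in RHS]big_map /= mul1r -mulrA -mulrBr.
  congr (_ * _); rewrite (powqD fp) (powq_nat fp) (powq_sum fp) mulrDr; congr (_ + _).
  rewrite -sumrN mulr_sumr. apply: eq_bigr => v _.
  rewrite mnm_modDM mnm_divDM // exprMn (powqN fp) (powq_nat fp) mulNr mulrN; congr (- _).
  by rewrite mulrCA.
Qed.

End TensorRelations.

(** * Vanishing in the Frobenius pullback of M over A *)

Section Separation.
Variables (A : comNzRingType) (N : nat).
Local Notation R := {mpoly A[N]}.
Variable M : lmodType R.
Implicit Types (x y : M) (a b : A).

Lemma conscaleD a b x : (a + b) ** x = a ** x + b ** x.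
Proof. by rewrite mpolyCD scalerDl. Qed.

Lemma conscaleM a b x : (a * b) ** x = a ** (b ** x).
Proof. by rewrite mpolyCM scalerA. Qed.

Lemma conscale0 x : 0 ** x = 0.
Proof. by rewrite mpolyC0 scale0r. Qed.

Lemma conscale1 x : 1 ** x = x.
Proof. by rewrite mpolyC1 scale1r. Qed.

Lemma conscaleN a x : (- a) ** x = - (a ** x).
Proof. by rewrite mpolyCN scaleNr. Qed.

Lemma conscale_suml (I : Type) (r : seq I) (P : pred I) (F : I -> A) x :
  (\sum_(i <- r | P i) F i) ** x = \sum_(i <- r | P i) F i ** x.
Proof. exact: (big_morph (fun c => c ** x) (fun a b => conscaleD a b x) (conscale0 x)). Qed.

Lemma conscaleX a (u : 'X_{1..N}) x : a ** ('X_[u] *: x) = 'X_[u] *: (a ** x).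
Proof. by rewrite !scalerA mulrC. Qed.

Definition relvec (K : finType) (u : K -> M) : set (K -> A) :=
  [set w | \sum_k w k ** u k = 0].

Lemma conscale_lin (K : finType) (P : pred K) (u : K -> M) a w w' :
  \sum_(k | P k) (a * w k + w' k) ** u k =
  a ** (\sum_(k | P k) w k ** u k) + \sum_(k | P k) w' k ** u k.
Proof.
rewrite scaler_sumr -big_split; apply: eq_bigr => k _.
by rewrite conscaleD conscaleM.
Qed.

Lemma relvec_submodule (K : finType) (u : K -> M) : fun_submodule (relvec u).
Proof.
split=> [|a w w' hw hw']; rewrite /relvec /=.
  by rewrite big1 // => k _; rewrite conscale0.
by rewrite conscale_lin hw hw' scaler0 addr0.
Qed.

Definition support_relations (X : seq M) : set (M -> A) :=
  [set w | (forall y, y \notin X -> w y = 0) /\ \sum_(y <- undup X) w y ** y = 0].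

Lemma support_relations_submodule X : fun_submodule (support_relations X).
Proof.
split; first by split=> //; rewrite big1 // => y _; rewrite conscale0.
move=> a w w' [w0 hw] [w'0 hw']; split; first by move=> y hy; rewrite w0 // w'0 // mulr0 addr0.
rewrite (eq_bigr (fun y => a ** (w y ** y) + w' y ** y)); last first.
  by move=> y _; rewrite conscaleD conscaleM.
by rewrite big_split /= -scaler_sumr hw hw' scaler0 addr0.
Qed.

Lemma sum_pushforward (X : seq M) (s : seq (A * M)) : {subset unzip2 s <= X} ->
  \sum_(y <- undup X) pushforward s y ** y = \sum_(t <- s) t.1 ** t.2.
Proof.
move=> sX; rewrite /pushforward.
rewrite (eq_bigr (fun y => \sum_(t <- s) (t.1 * (y == t.2)%:R) ** y)); last first.
  by move=> y _; rewrite conscale_suml.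
rewrite exchange_big /= big_seq [RHS]big_seq; apply: eq_bigr => t ts.
have tX : t.2 \in undup X by rewrite mem_undup; apply: sX; exact: map_f.
rewrite (bigD1_seq t.2) ?undup_uniq //= eqxx mulr1 big1 ?addr0 // => y /negPf ->.
by rewrite mulr0 conscale0.
Qed.

Lemma pushforward0 (X : seq M) (s : seq (A * M)) y : {subset unzip2 s <= X} -> y \notin X ->
  pushforward s y = 0.
Proof.
move=> sX yX; rewrite /pushforward big_seq big1 // => t ts.
case: eqP => [e|]; last by rewrite mulr0.
by move/negP: yX; case; rewrite e; apply: sX; exact: map_f.
Qed.

Section Flat.
Variable p : nat.
Hypothesis cp : p \in [pchar A].
Hypothesis flatA : forall e, frob_flat A (p ^ e).

Let fpe e : additive_power A (p ^ e). Proof. exact: additive_power_pchar. Qed.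
Let fp : additive_power A p. Proof. by have := fpe 1; rewrite expn1. Qed.
Let flatp : frob_flat A p. Proof. by have := @flatA 1%N; rewrite expn1. Qed.

(** The given relations may involve elements of M that are not values of [u]. Their supports lie in
    a finite list [X], and [pspan_vanish] replaces them by relations supported on the values of
    [u]. *)
Lemma pspan_relations_relvec (K : finType) (u : K -> M) (a : K -> A) :
  pspan p (@relations A N M) (pushforward [seq (a k, u k) | k <- enum K]) ->
  pspan p (relvec u) a.
Proof.
move=> [l [c [w [hw ew]]]].
pose s i := sval (cid (hw i)).
have s0 i : \sum_(t <- s i) t.1 ** t.2 = 0 by case: (svalP (cid (hw i))).
have es i : w i = pushforward (s i) by case: (svalP (cid (hw i))).
pose U := [seq u k | k <- enum K].
have memU k : u k \in U by apply: map_f; rewrite mem_enum.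
pose X := U ++ flatten [seq unzip2 (s i) | i <- enum 'I_l].
have UX : {subset U <= X} by move=> x hx; rewrite mem_cat hx.
have sX i : {subset unzip2 (s i) <= X}.
  move=> x hx; rewrite mem_cat; apply/orP; right; apply/flattenP.
  by exists (unzip2 (s i)) => //; apply: map_f; rewrite mem_enum.
have hX : pspan p (support_relations X) (pushforward [seq (a k, u k) | k <- enum K]).
  exists l, c, w; split=> // i; rewrite es; split; first by move=> y; exact: pushforward0.
  by rewrite sum_pushforward.
have uzU : unzip2 [seq (a k, u k) | k <- enum K] = U.
  by rewrite /unzip2 -map_comp; exact: eq_map.
have [|L [d [v [hv ev]]]] := pspan_vanish fp flatp (X := [seq x <- X | x \notin U])
    (support_relations_submodule X) hX.
  move=> x; rewrite mem_filter => /andP[xU _]; apply: (pushforward0 (X := U)) => //.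
  by rewrite uzU.
(* As [u] need not be injective, a relation between its values is lifted by placing each coefficient
   at one chosen index. *)
pose rep y := [pick k | u k == y].
have repU k : exists2 j, rep (u k) = Some j & u j = u k.
  by rewrite /rep; case: pickP => [j /eqP ej|/(_ k)]; [exists j | rewrite eqxx].
pose v' i k : A := (rep (u k) == Some k)%:R * v i (u k).
have v0 i y : y \notin U -> v i y = 0.
  have [[vX _] vU] := hv i; move=> yU; have [yX|/vX //] := boolP (y \in X).
  by apply: vU; rewrite mem_filter yU.
have ev' i : v i = pushforward [seq (v' i k, u k) | k <- enum K].
  apply: funext => y; rewrite /pushforward big_map big_enum /=.
  have [/mapP [k _ ->]|yU] := boolP (y \in U); last first.
    rewrite v0 // big1 // => k _; have [e|ne] := eqVneq y (u k); last by rewrite mulr0.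
    by rewrite e memU in yU.
  have [j ej ujk] := repU k; rewrite (bigD1 j) //= /v' ujk ej !eqxx mulr1 mul1r.
  rewrite big1 ?addr0 // => i' ni; have [e|ne] := eqVneq (u k) (u i'); last by rewrite mulr0.
  rewrite -e ej (_ : Some j == Some i' = false) ?mul0r //.
  by apply/eqP => -[e']; rewrite e' eqxx in ni.
have rv i : relvec u (v' i).
  have [[_ hs] _] := hv i; rewrite ev' sum_pushforward in hs.
    by move: hs; rewrite big_map big_enum.
  by rewrite (_ : unzip2 _ = U) // /unzip2 -map_comp; exact: eq_map.
(* The remainder sums to zero over each fibre of [u], hence is a combination of the relations [g k]
   below, each between an index and the representative of its fibre. *)
pose b k := a k - \sum_i d i * v' i k ^+ p.
have pb y : \sum_k b k * (y == u k)%:R = 0.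
  have := congr1 (fun f => f y) ev; rewrite {1}/pushforward big_map big_enum /= => e.
  rewrite (eq_bigr (fun k => a k * (y == u k)%:R - \sum_i d i * (v' i k * (y == u k)%:R) ^+ p)).
    rewrite sumrB e exchange_big /=; apply/eqP; rewrite subr_eq0; apply/eqP.
    apply: eq_bigr => i _; rewrite -mulr_sumr -(powq_sum fp) ev' /pushforward.
    by rewrite big_map big_enum.
  move=> k _; rewrite /b mulrBl mulr_suml; congr (_ - _); apply: eq_bigr => i _.
  by rewrite [in RHS]exprMn (powq_nat fp) mulrA.
pose g k j : A := (j == k)%:R - (rep (u k) == Some j)%:R.
have -> : a = fun j => \sum_k b k * g k j ^+ p + \sum_i d i * v' i j ^+ p.
  apply: funext => j; rewrite -[LHS](subrK (\sum_i d i * v' i j ^+ p)); congr (_ + _).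
  rewrite -/(b j) (eq_bigr (fun k => b k * (j == k)%:R - b k * (rep (u k) == Some j)%:R)).
    rewrite sumrB (bigD1 j) //= eqxx mulr1 big1 ?addr0; last first.
      by move=> k; rewrite eq_sym => /negPf ->; rewrite mulr0.
    have [ej|nej] := eqVneq (rep (u j)) (Some j).
      rewrite (eq_bigr (fun k => b k * (u j == u k)%:R)); first by rewrite pb subr0.
      move=> k _.
      congr (_ * (nat_of_bool _)%:R); apply/eqP/eqP => [ek|<- //].
      by have [j' ej' <-] := repU k; move: ek; rewrite ej' => -[<-].
    rewrite big1 ?subr0 // => k _; case: eqP => [ek|]; last by rewrite mulr0.
    have [j' ej' e] := repU k; move: ek; rewrite ej' => -[ejj]; subst j'.
    by move/eqP: nej; case; rewrite e.
  move=> k _; rewrite (powqB fp) !(powq_nat fp) mulrBr //.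
apply: pspanD; apply: pspan_sum => i; apply: pspan_genZ; last exact: rv.
rewrite /relvec /= (eq_bigr (fun k => (k == i)%:R ** u k - (rep (u i) == Some k)%:R ** u k)).
  have [j ej e] := repU i.
  rewrite sumrB (bigD1 i) //= eqxx conscale1 big1 ?addr0; last first.
    by move=> k /negPf ->; rewrite conscale0.
  rewrite (bigD1 j) //= ej eqxx conscale1 e big1 ?addr0 ?subrr // => k nk.
  rewrite (_ : Some j == Some k = false) ?conscale0 //.
  by apply/eqP => -[e']; rewrite e' eqxx in nk.
by move=> k _; rewrite conscaleD conscaleN.
Qed.

End Flat.
End Separation.

(** * The p-semilinear map phi and the separation of exponents *)

Section FrobeniusAction.
Variables (A : comNzRingType) (N p : nat).
Local Notation R := {mpoly A[N]}.
Variables (M : lmodType R) (theta : {linear M -> frob p M}) (theta' : frob p M -> M).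
Hypotheses (thetaK : cancel theta theta') (theta'K : cancel theta' theta).
Hypothesis cp : p \in [pchar A].
Hypothesis flatA : forall e, frob_flat A (p ^ e).
Implicit Types (x y : M) (r : R) (a : A).

Let p_gt0 : (0 < p)%N. Proof. exact: prime_gt0 (pcharf_prime cp). Qed.
Let fpe e : additive_power A (p ^ e). Proof. exact: additive_power_pchar. Qed.
Let fp : additive_power A p. Proof. by have := fpe 1; rewrite expn1. Qed.
Let flatp : frob_flat A p. Proof. by have := @flatA 1%N; rewrite expn1. Qed.

Lemma frob_pi_sum (s : seq (R * M)) : frob_pi p s = \sum_(t <- s) tens p t.1 t.2.
Proof.
elim: s => [|t s IH]; first by rewrite big_nil.
rewrite big_cons -IH -[RHS]/(frob_add _ _) frob_addE; congr frob_pi.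
by case: t.
Qed.

Lemma scale_tens r s x : r *: tens p s x = tens p (r * s) x.
Proof. by rewrite -[LHS]/(frob_scale _ _) frob_scaleE. Qed.

Lemma tensDr r x y : tens p r (x + y) = tens p r x + tens p r y.
Proof. by rewrite -[RHS]/(frob_add _ _) frob_addE; apply/frob_piP; exact: tensor_Dr. Qed.

Lemma tensZr r s x : tens p r (s *: x) = tens p (r * s ^+ p) x.
Proof. by apply/frob_piP; exact: tensor_bal. Qed.

Definition phi x : M := theta' (tens p 1 x).

Lemma theta'Z r (x : frob p M) : theta' (r *: x) = r *: theta' x.
Proof. by apply: (can_inj thetaK); rewrite linearZ_LR !theta'K. Qed.

Lemma theta'D (x y : frob p M) : theta' (x + y) = theta' x + theta' y.
Proof. by apply: (can_inj thetaK); rewrite linearD !theta'K. Qed.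

Lemma theta'_tens r x : theta' (tens p r x) = r *: phi x.
Proof. by rewrite /phi -theta'Z scale_tens mulr1. Qed.

Lemma phiD x y : phi (x + y) = phi x + phi y.
Proof. by rewrite /phi tensDr theta'D. Qed.

Lemma phiZ r x : phi (r *: x) = r ^+ p *: phi x.
Proof. by rewrite {1}/phi tensZr theta'_tens mul1r. Qed.

Definition phis e x : M := iter e phi x.

Lemma phisS e x : phis e.+1 x = phi (phis e x). Proof. by []. Qed.

Lemma phisD e x y : phis e (x + y) = phis e x + phis e y.
Proof. by elim: e => // e IH; rewrite !phisS IH phiD. Qed.

Lemma phisZ e r x : phis e (r *: x) = r ^+ (p ^ e) *: phis e x.
Proof. by elim: e => [|e IH]; rewrite ?expr1 // !phisS IH phiZ -exprM expnSr. Qed.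

Lemma phis0 e : phis e 0 = 0.
Proof. by apply: (addrI (phis e 0)); rewrite -phisD !addr0. Qed.

Lemma phis_sum e (I : Type) (s : seq I) (P : pred I) (F : I -> M) :
  phis e (\sum_(i <- s | P i) F i) = \sum_(i <- s | P i) phis e (F i).
Proof. exact: (big_morph (phis e) (phisD e) (phis0 e)). Qed.

Lemma phis_conscale e a x : phis e (a ** x) = (a ^+ (p ^ e)) ** phis e x.
Proof. by rewrite phisZ rmorphXn. Qed.

Lemma phiX (u : 'X_{1..N}) x : phi ('X_[u] *: x) = 'X_[(u *+ p)%MM] *: phi x.
Proof. by rewrite phiZ mpolyXn. Qed.

Lemma phisX e (u : 'X_{1..N}) x : phis e ('X_[u] *: x) = 'X_[(u *+ (p ^ e))%MM] *: phis e x.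
Proof. by rewrite phisZ mpolyXn. Qed.

Section Vectors.
Variable K : finType.
Implicit Types (I : K -> 'X_{1..N}) (u : K -> M).

Definition seprel I u : set (K -> A) :=
  [set w | forall J, \sum_(k | I k == J) w k ** u k = 0].

Lemma seprel_submodule I u : fun_submodule (seprel I u).
Proof.
split=> [|a w w' hw hw'] J; first by rewrite big1 // => k _; rewrite conscale0.
by rewrite conscale_lin hw hw' scaler0 addr0.
Qed.

Definition restrict (P : pred K) (w : K -> A) (k : K) : A := if P k then w k else 0.

Lemma restrict_sum (T : eqType) (f : K -> T) (w : K -> A) :
  w = fun k => \sum_(J <- undup [seq f k | k <- enum K]) restrict (fun k => f k == J) w k.
Proof.
apply: funext => k; rewrite (bigD1_seq (f k)) ?undup_uniq //=.
  rewrite /restrict eqxx big1 ?addr0 // => J; by rewrite eq_sym => /negPf ->.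
by rewrite mem_undup; apply: map_f; rewrite mem_enum.
Qed.

Lemma pspan_restrict q (S : set (K -> A)) (P : pred K) (w : K -> A) : additive_power A q ->
  frob_flat A q -> fun_submodule S -> pspan q S (restrict P w) ->
  pspan q [set v | S v /\ forall k, ~~ P k -> v k = 0] (restrict P w).
Proof.
move=> fq flq sS h.
have hX k : k \in [seq k <- enum K | ~~ P k] -> restrict P w k = 0.
  by rewrite mem_filter /restrict => /andP[/negPf ->].
apply: pspanS (pspan_vanish fq flq sS h hX) => v [Sv vX]; split=> // k nP.
by apply: vX; rewrite mem_filter nP mem_enum.
Qed.

(** Through [theta] the sum becomes a vanishing tensor. Its component at J is the formal sum of the
    terms with exponent J, to which [pspan_relations_relvec] applies. *)
Lemma phi_separate I u (a : K -> A) : (forall k, mnm_small p (I k)) ->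
  \sum_k a k ** ('X_[I k] *: phi (u k)) = 0 -> pspan p (seprel I u) a.
Proof.
move=> sI ha.
have ht : tensor_rel p [seq (a k *: 'X_[I k], u k) | k <- enum K] [::].
  apply/frob_piP; rewrite !frob_pi_sum big_nil big_map big_enum /=.
  apply: (can_inj theta'K); rewrite (big_morph _ theta'D (_ : theta' 0 = 0)); last first.
    by apply: (can_inj thetaK); rewrite theta'K linear0.
  rewrite (_ : theta' 0 = 0); last by apply: (can_inj thetaK); rewrite theta'K linear0.
  rewrite -[RHS]ha; apply: eq_bigr => k _.
  by rewrite theta'_tens -mul_mpolyC scalerA.
rewrite (restrict_sum I a); apply: pspan_sum => J.
have hJ : pspan p (relvec u) (restrict (fun k => I k == J) a).
  apply: (pspan_relations_relvec cp flatA).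
  apply: (eq_ind _ (pspan p (@relations A N M)) (tensor_rel_component cp ht J)).
  apply: funext => y; rewrite /component big_nil subr0 /pushforward.
  rewrite [LHS]big_map [RHS]big_map !big_enum /=.
  apply: eq_bigr => k _; rewrite mlinX mnm_small_mod // mnm_small_div // mpolyX0 scale1r.
  by rewrite /restrict mulrA; case: eqP => _; rewrite ?mulr1 ?mulr0.
apply: pspanS (pspan_restrict fp flatp (relvec_submodule u) hJ) => w [rw wJ] J'.
have [->|nJ] := eqVneq J' J; last first.
  by rewrite big1 // => k /eqP e; rewrite wJ ?conscale0 // e.
rewrite -[RHS]rw [RHS](bigID (fun k => I k == J)) /= [X in _ = _ + X]big1 ?addr0 //.
by move=> k nk; rewrite wJ // conscale0.
Qed.

(** Write I = I0 + p I1 with I0 below p, so that x^I phi^(e+1)(u) = x^I0 phi(x^I1 phi^e(u)). One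
    application of [phi_separate] separates the I0; the induction hypothesis separates the I1 in
    each relation obtained. *)
Lemma phis_separate e I u (a : K -> A) : (forall k, mnm_small (p ^ e) (I k)) ->
  \sum_k a k ** ('X_[I k] *: phis e (u k)) = 0 -> pspan (p ^ e) (seprel I u) a.
Proof.
elim: e I u a => [|e IH] I u a sI ha.
  have I0 k : I k = 0%MM.
    by apply/mnmP => i; have := sI k i; rewrite expn0 ltnS leqn0 mnm0E => /eqP.
  rewrite (_ : a = fun k => a k ^+ (p ^ 0)); last by apply: funext => k; rewrite expr1.
  apply: pspan_gen => J; have [->|nJ] := eqVneq J 0%MM.
    rewrite -[RHS]ha; apply: eq_big => [k|k _]; first by rewrite I0 eqxx.
    by rewrite I0 mpolyX0 scale1r.
  by rewrite big1 // => k /eqP e; case/eqP: nJ; rewrite -e I0.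
pose Im k := mnm_mod p (I k); pose Id k := mnm_div p (I k).
rewrite expnSr; apply: (pspan_pspan fp).
have h1 : pspan p (seprel Im (fun k => 'X_[Id k] *: phis e (u k))) a.
  apply: phi_separate; first by move=> k; exact: mnm_mod_small.
  rewrite -[RHS]ha; apply: eq_bigr => k _; congr (_ *: _).
  by rewrite phiX scalerA -mpolyXD -mnm_divmod.
apply: pspanS h1 => w hw; rewrite (restrict_sum Im w); apply: pspan_sum => J.
have h2 : pspan (p ^ e) (seprel Id u) (restrict (fun k => Im k == J) w).
  apply: IH => [k i|].
    by rewrite mnmE ltn_divLR // -expnSr; exact: sI.
  rewrite -[RHS](hw J) [RHS]big_mkcond; apply: eq_bigr => k _.
  by rewrite /restrict; case: eqP => // _; rewrite conscale0.
(* Confining the relations to indices of residue J lets residue and quotient together recover the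
   full exponent. *)
apply: pspanS (pspan_restrict (fpe e) (@flatA e) (seprel_submodule _ _) h2) => v [sv vJ] J'.
have [eJ|nJ] := eqVneq (mnm_mod p J') J; last first.
  by rewrite big1 // => k /eqP ek; rewrite vJ ?conscale0 // /Im ek.
rewrite -[RHS](sv (mnm_div p J')) [RHS](bigID (fun k => Im k == J)) /= [X in _ = _ + X]big1 ?addr0.
  apply: eq_bigl => k; apply/eqP/andP => [ek|[/eqP ed /eqP em]].
    by rewrite /Id /Im ek eJ !eqxx.
  by rewrite (mnm_divmod p (I k)) (mnm_divmod p J') eJ -em -ed.
by move=> k /andP[_ nk]; rewrite vJ // conscale0.
Qed.

(** By semilinearity, phi^e turns a relation of the u_k into its q-th power on the phi^e(u_k). After
    [phis_separate], this strips the monomials: a vanishing sum of terms vanishes exponent by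
    exponent, without the factor x^J. *)
Lemma seprel_phis e I u (a : K -> A) J : pspan (p ^ e) (seprel I u) a ->
  \sum_(k | I k == J) a k ** phis e (u k) = 0.
Proof.
move=> h; suff : pspan (p ^ e) (seprel I u) `<=` seprel I (fun k => phis e (u k)) by apply.
apply: pspan_sub; first exact: seprel_submodule.
move=> w hw J'; rewrite (eq_bigr (fun k => phis e (w k ** u k))); last first.
  by move=> k _; rewrite phis_conscale.
by rewrite -phis_sum hw phis0.
Qed.

End Vectors.
End FrobeniusAction.

(** * Bidegrees and bigraded modules *)

Section Bidegrees.
Variables (m n : nat).
Local Notation N := (m + n)%N.
Implicit Types (u v : 'X_{1..N}) (d : bidegree).

Lemma bideg_mnmD u v : bideg_mnm (u + v)%MM = bideg_mnm u + bideg_mnm v.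
Proof.
rewrite /bideg_mnm; congr pair; rewrite -PoszD -big_split; congr Posz.
  by apply: eq_bigr => i _; rewrite mnmDE.
by apply: eq_bigr => i _; rewrite mnmDE.
Qed.

Lemma bideg_mnm0 : bideg_mnm (0%MM : 'X_{1..N}) = 0.
Proof. by rewrite /bideg_mnm !big1 // => i _; rewrite mnm0E. Qed.

Lemma bideg_mnmM u k : bideg_mnm (u *+ k)%MM = bideg_mnm u *+ k.
Proof.
elim: k => [|k IH]; first by rewrite mulm0n bideg_mnm0.
by rewrite mulmS bideg_mnmD IH mulrS.
Qed.

Lemma bidegMn_inj k : (0 < k)%N -> injective (fun d : bidegree => d *+ k).
Proof.
move=> k0 [a b] [c d] e.
have e1 := congr1 fst e; have e2 := congr1 snd e; move: e1 e2.
rewrite !raddfMn /= => e1 e2.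
by congr pair; [exact: (pmulrnI k0 e1) | exact: (pmulrnI k0 e2)].
Qed.

Lemma bihomogC (A : comNzRingType) (a : A) : bihomog (0 : bidegree) (a%:MP_[N]).
Proof.
move=> u; rewrite msuppC; case: eqP => // _; rewrite inE => /eqP ->; exact: bideg_mnm0.
Qed.

Lemma bihomogX (A : comNzRingType) u : bihomog (bideg_mnm u) ('X_[u] : {mpoly A[N]}).
Proof. by move=> v; rewrite msuppX inE => /eqP ->. Qed.

End Bidegrees.

Section Gradings.
Variables (A : comNzRingType) (m n p : nat).
Local Notation N := (m + n)%N.
Local Notation R := {mpoly A[N]}.
Variables (M : lmodType R) (G : bidegree -> set M).
Hypothesis gG : is_bigrading G.
Implicit Types (x y : M) (d : bidegree).

Lemma graded0 d : G d 0. Proof. by case: gG => h _ _ _; case: (h d). Qed.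

Lemma gradedB d x y : G d x -> G d y -> G d (x - y).
Proof. by case: gG => h _ _ _; case: (h d) => _; apply. Qed.

Lemma gradedN d x : G d x -> G d (- x).
Proof. by move=> h; rewrite -sub0r; apply: gradedB => //; exact: graded0. Qed.

Lemma gradedD d x y : G d x -> G d y -> G d (x + y).
Proof. by move=> hx hy; rewrite -(opprK y); apply: gradedB => //; exact: gradedN. Qed.

Lemma graded_sum d (I : Type) (r : seq I) (P : pred I) (F : I -> M) :
  (forall i, P i -> G d (F i)) -> G d (\sum_(i <- r | P i) F i).
Proof. by move=> h; elim/big_ind: _ => //; [exact: graded0 | move=> x y; exact: gradedD]. Qed.

Lemma graded_conscale d a x : G d x -> G d (a ** x).
Proof.
case: gG => _ h _ _ gx; rewrite -[d]add0r; apply: h => //; exact: bihomogC.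
Qed.

Lemma gradedX d u x : G d x -> G (bideg_mnm u + d) ('X_[u] *: x).
Proof. by case: gG => _ h _ _ gx; apply: h => //; exact: bihomogX. Qed.

(** The grading axiom takes one element per degree, so summands sharing a degree are first collected
    in [c]. *)
Lemma graded_sum0 (K : finType) (P : pred K) (x : K -> M) (f : K -> bidegree) :
  (forall k, G (f k) (x k)) -> \sum_(k | P k) x k = 0 ->
  forall d, \sum_(k | P k && (f k == d)) x k = 0.
Proof.
move=> gx s0 d; pose s := undup [seq f k | k <- enum K].
pose c d := \sum_(k | P k && (f k == d)) x k.
have gc d' : G d' (c d') by apply: graded_sum => k /andP[_ /eqP <-].
have [ds|nds] := boolP (d \in s); last first.
  rewrite big1 // => k /andP[_ /eqP e]; case/negP: nds.
  by rewrite /s mem_undup -e; apply: map_f; rewrite mem_enum.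
have [_ _ _ h] := gG; apply: (h s c) => //; first exact: undup_uniq.
rewrite /c (eq_bigr (fun d => \sum_(k | P k) if f k == d then x k else 0)); last first.
  by move=> d' _; rewrite big_mkcondr.
rewrite exchange_big -[RHS]s0; apply: eq_bigr => k _.
rewrite (bigD1_seq (f k)) ?undup_uniq //=; last first.
  by rewrite mem_undup; apply: map_f; rewrite mem_enum.
rewrite eqxx big1 ?addr0 // => d'; by rewrite eq_sym => /negPf ->.
Qed.

End Gradings.

(** * Expansions into terms a x^I phi^e(v), and annihilators *)

Section Expansions.
Variables (A : comNzRingType) (m n p : nat).
Local Notation N := (m + n)%N.
Local Notation R := {mpoly A[N]}.
Variables (M : lmodType R) (theta : {linear M -> frob p M}) (theta' : frob p M -> M).
Hypotheses (thetaK : cancel theta theta') (theta'K : cancel theta' theta).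
Hypothesis cp : p \in [pchar A].
Hypothesis flatA : forall e, frob_flat A (p ^ e).
Implicit Types (x y : M) (a : A) (d : bidegree) (S T : bidegree -> set M).

Local Notation phi := (phi theta').
Local Notation phis := (phis theta').
Local Notation term := (A * 'X_{1..N} * M * bidegree)%type.

Let p_gt0 : (0 < p)%N. Proof. exact: prime_gt0 (pcharf_prime cp). Qed.
Let q_gt0 e : (0 < p ^ e)%N. Proof. by rewrite expn_gt0 p_gt0. Qed.

(* (a, I, v, d) stands for the element a x^I phi^e(v), with v of degree d. *)
Definition term_val e (t : term) : M := t.1.1.1 ** ('X_[t.1.1.2] *: phis e t.1.2).
Definition term_deg e (t : term) : bidegree := bideg_mnm t.1.1.2 + t.2 *+ (p ^ e).
Definition term_ok e S (t : term) : Prop := mnm_small (p ^ e) t.1.1.2 /\ S t.2 t.1.2.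

Definition expansion e S d : set M := [set x | exists s : seq term,
  (forall t, t \in s -> term_ok e S t /\ term_deg e t = d) /\ x = \sum_(t <- s) term_val e t].

Lemma expansion0 e S d : expansion e S d 0.
Proof. by exists [::]; split=> //; rewrite big_nil. Qed.

Lemma expansionD e S d x y : expansion e S d x -> expansion e S d y -> expansion e S d (x + y).
Proof.
move=> [s [hs ->]] [t [ht ->]]; exists (s ++ t); split; last by rewrite big_cat.
by move=> u; rewrite mem_cat => /orP[/hs|/ht].
Qed.

Lemma expansion_conscale e S d a x : expansion e S d x -> expansion e S d (a ** x).
Proof.
move=> [s [hs ->]]; exists [seq (a * t.1.1.1, t.1.1.2, t.1.2, t.2) | t <- s]; split.
  by move=> _ /mapP [t /hs h ->].
rewrite scaler_sumr big_map; apply: eq_bigr => t _.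
by rewrite /term_val /= conscaleM.
Qed.

Lemma expansionN e S d x : expansion e S d x -> expansion e S d (- x).
Proof. by move=> /(expansion_conscale (-1)); rewrite conscaleN conscale1. Qed.

Lemma expansion_sum e S d (I : eqType) (r : seq I) (P : pred I) (F : I -> M) :
  (forall i, i \in r -> P i -> expansion e S d (F i)) ->
  expansion e S d (\sum_(i <- r | P i) F i).
Proof.
move=> h; rewrite big_seq_cond; elim/big_ind: _ => //.
- exact: expansion0.
- by move=> x y; exact: expansionD.
- by move=> i /andP[]; exact: h.
Qed.

Lemma expansion_term e S a u v d : mnm_small (p ^ e) u -> S d v ->
  expansion e S (bideg_mnm u + d *+ (p ^ e)) (a ** ('X_[u] *: phis e v)).
Proof.
move=> su Sv; exists [:: (a, u, v, d)]; split; last by rewrite big_seq1.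
by move=> t; rewrite inE => /eqP ->.
Qed.

Lemma expansion_id S d v : S d v -> expansion 0 S d v.
Proof.
move=> Sv; have := @expansion_term 0 S 1 0%MM v d _ Sv.
rewrite bideg_mnm0 add0r mulr1n mpolyX0 conscale1 scale1r; apply.
by move=> i; rewrite mnm0E.
Qed.

Lemma expansion_phi e S d x : expansion e S d x -> forall u, mnm_small p u ->
  expansion e.+1 S (bideg_mnm u + d *+ p) ('X_[u] *: phi x).
Proof.
move=> [s [hs ->]] u su.
rewrite (big_morph phi (phiD thetaK theta'K) (phis0 thetaK theta'K 1)) scaler_sumr.
apply: expansion_sum => t ts _; have [[st St] <-] := hs t ts.
rewrite /term_val /term_deg (phiZ thetaK theta'K) (phiZ thetaK theta'K) mpolyXn -rmorphXn.
rewrite -conscaleX [X in expansion _ _ _ (_ *: X)]scalerA -mpolyXD.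
have -> : bideg_mnm u + (bideg_mnm t.1.1.2 + t.2 *+ p ^ e) *+ p =
    bideg_mnm (u + t.1.1.2 *+ p)%MM + t.2 *+ p ^ e.+1.
  by rewrite bideg_mnmD bideg_mnmM mulrnDl addrA -mulrnA expnSr.
apply: expansion_term => // i; rewrite mnmDE mulmnE.
apply: (@leq_trans (p + t.1.1.2 i * p)); first by rewrite ltn_add2r.
by rewrite -mulSn expnSr leq_mul2r st orbT.
Qed.

Lemma expansionS e S T d : (forall d', T d' `<=` expansion e S d') ->
  expansion 1 T d `<=` expansion e.+1 S d.
Proof.
move=> TS _ [s [hs ->]]; apply: expansion_sum => t ts _.
have [[st Tt] <-] := hs t ts; apply: expansion_conscale.
by rewrite /term_deg expn1; apply: expansion_phi; [exact: TS | rewrite -[p]expn1].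
Qed.

(** Each monomial of [r] is a small monomial times a q-th power, and the latter moves inside
    [phis e]; hence the closure of [S] under monomials. *)
Lemma expansion_homog S d1 d2 (r : R) x :
  (forall d u v, S d v -> S (bideg_mnm u + d) ('X_[u] *: v)) ->
  bihomog d1 r -> S d2 x -> forall e, expansion e S (d1 + d2 *+ (p ^ e)) (r *: phis e x).
Proof.
move=> SX hr Sx e; rewrite {1}[r]mpolyE scaler_suml; apply: expansion_sum => u ur _.
rewrite -mul_mpolyC -scalerA -(hr u ur) [in 'X_[u]](mnm_divmod (p ^ e) u) mpolyXD -scalerA.
rewrite -(phisX thetaK theta'K).
have -> : bideg_mnm u + d2 *+ p ^ e = bideg_mnm (mnm_mod (p ^ e) u)
    + (bideg_mnm (mnm_div (p ^ e) u) + d2) *+ p ^ e.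
  by rewrite {1}(mnm_divmod (p ^ e) u) bideg_mnmD bideg_mnmM mulrnDl addrA.
by apply: expansion_term; [exact: mnm_mod_small | exact: SX].
Qed.

Definition annA x : set A := [set a | a ** x = 0].

Lemma annA_X e (I : 'X_{1..N}) (s : seq term) : mnm_small (p ^ e) I ->
  annA ('X_[I] *: \sum_(t <- s) t.1.1.1 ** phis e t.1.2) =
  annA (\sum_(t <- s) t.1.1.1 ** phis e t.1.2).
Proof.
move=> sI; apply/seteqP; split=> b hb; last by rewrite /annA /= conscaleX hb scaler0.
pose tt := tnth (in_tuple s).
have := @phis_separate _ _ _ _ _ _ thetaK theta'K cp flatA 'I_(size s) e (fun=> I)
  (fun k => (tt k).1.2) (fun k => b * (tt k).1.1.1) (fun=> sI) _.
case=> [|l h]; last first.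
  have := seprel_phis thetaK theta'K I (ex_intro _ l h).
  move=> h'; rewrite /annA /= -[RHS]h' scaler_sumr [LHS]big_tnth; apply: eq_big => [k|k _].
    by rewrite eqxx.
  by rewrite conscaleM.
rewrite -[RHS]hb scaler_sumr scaler_sumr [RHS]big_tnth; apply: eq_bigr => k _.
by rewrite conscaleM -conscaleX.
Qed.

(** By separation P kills the coefficient z_I of every x^I. If each z_I were also killed by some b_I
    outside P, the product of the b_I would kill x, against the primality of P. *)
Lemma annA_component e S d x P : expansion e S d x -> prime_ideal P -> P = annA x ->
  exists (I : 'X_{1..N}) (d' : bidegree) (s : seq term),
  [/\ mnm_small (p ^ e) I, bideg_mnm I + d' *+ (p ^ e) = d,
      forall t, t \in s -> S d' t.1.2 & P = annA (\sum_(t <- s) t.1.1.1 ** phis e t.1.2)].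
Proof.
move=> [s [hs ->]] pP eP; have [iP P1 pM] := pP.
pose z I := \sum_(t <- s | t.1.1.2 == I) t.1.1.1 ** phis e t.1.2.
pose L := undup [seq t.1.1.2 | t : term <- s].
have ez : \sum_(t <- s) term_val e t = \sum_(I <- L) 'X_[I] *: z I.
  rewrite (eq_bigr (fun I => \sum_(t <- s) if t.1.1.2 == I then term_val e t else 0)); last first.
    move=> I _; rewrite /z big_mkcond scaler_sumr; apply: eq_bigr => t _.
    by case: eqP => [<-|]; rewrite ?scaler0 // /term_val conscaleX.
  rewrite exchange_big big_seq [RHS]big_seq; apply: eq_bigr => t ts.
  rewrite (bigD1_seq t.1.1.2) ?undup_uniq //=; last by rewrite mem_undup; exact: map_f.
  by rewrite eqxx big1 ?addr0 // => I; rewrite eq_sym => /negPf ->.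
pose tt := tnth (in_tuple s).
have zP b I : P b -> b ** z I = 0.
  rewrite eP /annA /= big_tnth scaler_sumr => hb.
  have hsep : pspan (p ^ e) (seprel (fun k => (tt k).1.1.2) (fun k => (tt k).1.2))
      (fun k => b * (tt k).1.1.1).
    apply: (phis_separate thetaK theta'K cp flatA).
      by move=> k; have [[]] := hs _ (mem_tnth k (in_tuple s)).
    by rewrite -[RHS]hb; apply: eq_bigr => k _; rewrite /term_val conscaleM.
  have := seprel_phis thetaK theta'K I hsep.
  move=> h; rewrite -[RHS]h /z [in LHS]big_tnth scaler_sumr; apply: eq_bigr => k _.
  by rewrite conscaleM.
have [I IL eI] : exists2 I, I \in L & P = annA (z I).
  apply: contrapT => none.
  have hb I : exists b, I \in L -> b ** z I = 0 /\ ~ P b.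
    have [IL|] := boolP (I \in L); last by exists 0.
    apply: contrapT => h; apply: none; exists I => //; apply/seteqP; split.
      by move=> b; exact: zP.
    by move=> b hb; apply: contrapT => nP; apply: h; exists b.
  pose b I := sval (cid (hb I)).
  have hbI I : I \in L -> b I ** z I = 0 /\ ~ P (b I) by exact: (svalP (cid (hb I))).
  have nP (L' : seq 'X_{1..N}) : {subset L' <= L} -> ~ P (\prod_(I <- L') b I).
    elim: L' => [|I L' IH] sL; first by rewrite big_nil.
    rewrite big_cons => /pM [].
      by have [] := hbI I (sL _ (mem_head _ _)).
    by apply: IH => J hJ; apply: sL; rewrite inE hJ orbT.
  apply: (nP L) => //; rewrite eP /annA /= ez scaler_sumr big_seq big1 // => I IL.
  rewrite (bigD1_seq I) ?undup_uniq //= mulrC conscaleM conscaleX.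
  by have [-> _] := hbI I IL; rewrite !scaler0.
have [t ts et] : exists2 t : term, t \in s & I = t.1.1.2.
  by move: IL; rewrite mem_undup => /mapP.
exists I, t.2, [seq t <- s | t.1.1.2 == I]; split.
- by rewrite et; have [[]] := hs t ts.
- by rewrite et; have [_] := hs t ts.
- move=> t'; rewrite mem_filter => /andP[/eqP et' ts'].
  have [[_ St'] dt'] := hs t' ts'; have [_ dt] := hs t ts.
  (* Within one exponent I the vectors share a degree, since q times that degree is d - deg I. *)
  suff -> : t.2 = t'.2 by [].
  apply: (bidegMn_inj (q_gt0 e)); apply: (addrI (bideg_mnm I)).
  by transitivity d; [rewrite et -dt | rewrite -et' -dt'].
- by rewrite big_filter.
Qed.

End Expansions.

(** * Compatibility of phi with the bigrading, and transfer of associated primes *)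

Section GradedAction.
Variables (A : comNzRingType) (m n p : nat).
Local Notation N := (m + n)%N.
Local Notation R := {mpoly A[N]}.
Variables (M : lmodType R) (theta : {linear M -> frob p M}) (theta' : frob p M -> M).
Hypotheses (thetaK : cancel theta theta') (theta'K : cancel theta' theta).
Hypothesis cp : p \in [pchar A].
Hypothesis flatA : forall e, frob_flat A (p ^ e).
Variable G : bidegree -> set M.
Hypotheses (gG : is_bigrading G) (thetaG : bidegree_preserving G theta).
Implicit Types (x y : M) (a : A) (d : bidegree) (S T : bidegree -> set M).

Local Notation phi := (phi theta').
Local Notation phis := (phis theta').
Local Notation term := (A * 'X_{1..N} * M * bidegree)%type.
Local Notation expansion := (expansion theta').

Let p_gt0 : (0 < p)%N. Proof. exact: prime_gt0 (pcharf_prime cp). Qed.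
Let q_gt0 e : (0 < p ^ e)%N. Proof. by rewrite expn_gt0 p_gt0. Qed.

Lemma expand1 d x : G d x -> expansion 1 G d x.
Proof.
move=> /thetaG [s [hs e]].
have -> : x = \sum_(t <- s) t.1 *: phi t.2.
  rewrite -(thetaK x) e (big_morph theta' (theta'D thetaK theta'K) (_ : theta' 0 = 0)).
    by apply: eq_bigr => t _; rewrite (theta'_tens thetaK theta'K).
  by apply: (can_inj thetaK); rewrite theta'K linear0.
apply: expansion_sum => t ts _; have [d1 [d2 [h1 h2 ->]]] := hs t ts.
have SX d' u v : G d' v -> G (bideg_mnm u + d') ('X_[u] *: v) by exact: gradedX.
by have := expansion_homog thetaK theta'K cp SX h1 h2 1; rewrite expn1.
Qed.

Lemma expand e d x : G d x -> expansion e G d x.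
Proof.
elim: e d x => [|e IH] d x gx; first exact: (expansion_id theta' cp).
by apply: (expansionS thetaK theta'K IH); exact: expand1.
Qed.

Lemma seprel_terms (K : finType) e (I : K -> 'X_{1..N}) (u : K -> M) (a : K -> A) :
  pspan (p ^ e) (seprel I u) a -> \sum_k a k ** ('X_[I k] *: phis e (u k)) = 0.
Proof.
move=> h; pose L := undup [seq I k | k <- enum K].
rewrite (eq_bigr (fun k => \sum_(J <- L) if I k == J then
    'X_[J] *: (a k ** phis e (u k)) else 0)); last first.
  move=> k _; rewrite (bigD1_seq (I k)) ?undup_uniq //=; last first.
    by rewrite mem_undup; apply: map_f; rewrite mem_enum.
  by rewrite eqxx conscaleX big1 ?addr0 // => J; rewrite eq_sym => /negPf ->.
rewrite exchange_big big1 //= => J _; rewrite -big_mkcond -scaler_sumr.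
by rewrite (seprel_phis thetaK theta'K J h) scaler0.
Qed.

Lemma pspan_restrict_closed (K : finType) q (S : set (K -> A)) (P : pred K) (a : K -> A) :
  additive_power A q -> (forall w, S w -> S (restrict P w)) ->
  pspan q S a -> pspan q S (restrict P a).
Proof.
move=> fq hS [l [c [w [Sw ->]]]]; exists l, c, (fun i => restrict P (w i)); split.
  by move=> i; exact: hS.
apply: funext => k; rewrite /restrict; case: ifP => // _.
by rewrite big1 // => i _; rewrite (powq0 fq) mulr0.
Qed.

(** Over a fixed exponent, prescribing the total degree prescribes the degree of [u k], so the
    restricted relation is a homogeneous component of the given one. *)
Lemma seprel_restrict (K : finType) e (I : K -> 'X_{1..N}) (u : K -> M) (f : K -> bidegree)
    D (w : K -> A) :
  (forall k, G (f k) (u k)) -> seprel I u w ->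
  seprel I u (restrict (fun k => bideg_mnm (I k) + f k *+ (p ^ e) == D) w).
Proof.
move=> gu hw J.
pose P k := bideg_mnm (I k) + f k *+ (p ^ e) == D.
rewrite (eq_bigr (fun k => if P k then w k ** u k else 0)); last first.
  by move=> k _; rewrite /restrict -/(P k); case: ifP => // _; rewrite conscale0.
rewrite -big_mkcondr /=.
have [/existsP [k0 /andP[/eqP I0 /eqP P0]]|none] := boolP [exists k, (I k == J) && P k].
  rewrite -[RHS](graded_sum0 gG (fun k => graded_conscale gG (w k) (gu k)) (hw J) (f k0)).
  apply: eq_bigl => k; case: (I k =P J) => //= ek; rewrite /P -P0 I0 ek.
  apply/eqP/eqP => [/addrI|-> //]; exact: bidegMn_inj.
by rewrite big1 // => k hk; case/negP: none; apply/existsP; exists k.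
Qed.

(** Stands in for the directness of the grading on F_R(M), at a stage where terms are not yet known
    to be homogeneous in M. All the terms satisfy one relation; its restriction to degree D is again
    a relation, and there the terms add up to y. *)
Lemma expansion1_independent D y (s : seq bidegree) (c : bidegree -> M) :
  expansion 1 G D y -> (forall d, expansion 1 G d (c d)) ->
  y = \sum_(d <- s | d != D) c d -> y = 0.
Proof.
move=> [s1 [h1 ey]] hc ey'.
have [s2 [h2 e2]] : exists s2 : seq term, (forall t, t \in s2 ->
    term_ok p 1 G t /\ term_deg p 1 t != D) /\
    - \sum_(d <- s | d != D) c d = \sum_(t <- s2) term_val theta' 1 t.
  rewrite -sumrN; elim/big_ind: _ => [|x1 x2 [t1 [ht1 ->]] [t2 [ht2 ->]]|d nd].
  - by exists [::]; split=> //; rewrite big_nil.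
  - exists (t1 ++ t2); split; last by rewrite big_cat.
    by move=> t; rewrite mem_cat => /orP[/ht1|/ht2].
  - have [t [ht ->]] := expansionN (hc d); exists t; split=> // t' /ht [ok ->]; by split.
pose tt := tnth (in_tuple (s1 ++ s2)).
have htt k : term_ok p 1 G (tt k).
  by have := mem_tnth k (in_tuple (s1 ++ s2)); rewrite mem_cat => /orP[/h1 []|/h2 []].
have hsum : \sum_k (tt k).1.1.1 ** ('X_[(tt k).1.1.2] *: phis 1 (tt k).1.2) = 0.
  have : \sum_(t <- s1 ++ s2) term_val theta' 1 t = 0.
    by rewrite big_cat /= -ey -e2 -ey' subrr.
  by rewrite big_tnth.
have fp1 := additive_power_pchar 1 cp.
have hP := phis_separate thetaK theta'K cp flatA (fun k => (htt k).1) hsum.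
have := seprel_terms (pspan_restrict_closed fp1 (fun w => @seprel_restrict _ 1 _ _ _ D w
  (fun k => (htt k).2)) hP).
move=> h0; rewrite -[RHS]h0 ey.
transitivity (\sum_(t <- s1 ++ s2 | term_deg p 1 t == D) term_val theta' 1 t).
  rewrite big_cat /= [X in _ = _ + X]big_seq_cond [X in _ = _ + X]big1 ?addr0; last first.
    by move=> t /andP[/h2 [_ /negPf ->]].
  rewrite big_seq_cond [RHS]big_seq_cond; apply: eq_bigl => t.
  by rewrite andbT; case: (boolP (t \in s1)) => //= /h1 [_ ->]; rewrite eqxx.
rewrite big_tnth big_mkcond; apply: eq_bigr => k _.
by rewrite /restrict; case: ifP => // _; rewrite conscale0.
Qed.

(** Subtract from phi(v) its component of degree p d. The difference is a sum of components of other
    degrees, yet it has an expansion of degree p d, so [expansion1_independent] makes it zero. *)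
Lemma phi_graded d v : G d v -> G (d *+ p) (phi v).
Proof.
move=> gv; have [_ _ dec _] := gG; have [s [c [gc e]]] := dec (phi v).
pose x' := \sum_(d' <- s | d' == d *+ p) c d'.
have gx' : G (d *+ p) x' by apply: graded_sum => // d' /eqP <-.
have ey : phi v - x' = \sum_(d' <- s | d' != d *+ p) c d'.
  by rewrite e (bigID (fun d' => d' == d *+ p)) /= -/x' [LHS]addrC addKr.
suff e0 : phi v - x' = 0 by rewrite -(subrK x' (phi v)) e0 add0r.
apply: (expansion1_independent (D := d *+ p) _ (fun d' => expand1 (gc d')) ey).
apply: expansionD; last by apply: expansionN; exact: expand1.
have := @expansion_term _ m n p _ theta' 1 G 1 0%MM v d.
rewrite bideg_mnm0 add0r mpolyX0 conscale1 scale1r expn1; apply=> // i.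
by rewrite mnm0E.
Qed.

Lemma phis_graded e d v : G d v -> G (d *+ (p ^ e)) (phis e v).
Proof.
by elim: e => // e IH gv; rewrite expnSr mulrnA; apply: phi_graded; exact: IH.
Qed.

Lemma AssA_transfer e d1 d2 :
  (forall c (I : 'X_{1..N}), mnm_small (p ^ e) I -> bideg_mnm I + c *+ (p ^ e) = d1 ->
    exists2 I' : 'X_{1..N}, mnm_small (p ^ e) I' & bideg_mnm I' + c *+ (p ^ e) = d2) ->
  AssA (G d1) `<=` AssA (G d2).
Proof.
move=> tr P [pP [x gx eP]]; split=> //.
have [I [c [s [sI hI hs eP']]]] := annA_component thetaK theta'K cp flatA (expand e gx) pP eP.
have [I' sI' hI'] := tr c I sI hI.
exists ('X_[I'] *: \sum_(t <- s) t.1.1.1 ** phis e t.1.2); last first.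
  by rewrite eP' -(annA_X thetaK theta'K cp flatA s sI').
rewrite -hI'; apply: (gradedX gG).
rewrite big_seq; apply: (graded_sum gG) => t /hs h.
by apply: (graded_conscale gG); exact: phis_graded.
Qed.

End GradedAction.

(** * Degrees reachable with exponents below q *)

Section SectorArithmetic.

Lemma bounded_sum k q s : (s <= k * q)%N ->
  exists f : 'I_k -> nat, (forall i, (f i <= q)%N) /\ (\sum_i f i = s)%N.
Proof.
elim: k s => [|k IH] s hs.
  by exists (fun=> 0%N); split=> //; rewrite big_ord0; move: hs; rewrite mul0n leqn0 => /eqP.
have [|f [hf sf]] := IH (s - minn s q)%N; first by move: hs; rewrite mulSn; lia.
exists (fun i => if unlift ord0 i is Some j then f j else minn s q); split.
  by move=> i; case: unliftP => [j _|_] //; exact: geq_minr.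
rewrite big_ord_recl unlift_none (eq_bigr f) ?sf; last by move=> i _; rewrite liftK.
by lia.
Qed.

Lemma mnm_with_degree m n q s t : (0 < q)%N -> (s <= m * q.-1)%N -> (t <= n * q.-1)%N ->
  exists2 I : 'X_{1..m + n}, mnm_small q I & bideg_mnm I = (Posz s, Posz t).
Proof.
move=> q0 /bounded_sum [f [hf sf]] /bounded_sum [g [hg sg]].
exists [multinom (match split i with inl j => f j | inr j => g j end) | i < (m + n)%N].
  by move=> i; rewrite mnmE -(prednK q0) ltnS; case: (split i).
rewrite /bideg_mnm -[in RHS]sf -[in RHS]sg; congr (Posz _, Posz _).
  by apply: eq_bigr => i _; rewrite mnmE (unsplitK (inl i)).
by apply: eq_bigr => i _; rewrite mnmE (unsplitK (inr i)).
Qed.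

Lemma bideg_mnm_bound m n q (I : 'X_{1..m + n}) : (0 < q)%N -> mnm_small q I ->
  exists s t : nat, [/\ (s <= m * q.-1)%N, (t <= n * q.-1)%N & bideg_mnm I = (Posz s, Posz t)].
Proof.
move=> q0 sI; eexists; eexists; split; last reflexivity.
  rewrite -[X in (_ <= X * _)%N]card_ord -sum_nat_const; apply: leq_sum => i _.
  by rewrite -ltnS prednK.
rewrite -[X in (_ <= X * _)%N]card_ord -sum_nat_const; apply: leq_sum => i _.
by rewrite -ltnS prednK.
Qed.

Definition same_sector (k : nat) (a b : int) : Prop :=
  a = b \/ (0 <= a /\ 0 <= b) \/ (a <= - k%:Z /\ b <= - k%:Z).

(** The degrees reached over [c] fill the interval from c q to c q + k (q - 1). If a >= 0 then -k <
    c <= 0, and the interval contains 0, ..., q - k; if a <= -k then -k <= c < 0, and it contains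
    -q, ..., -k. The bound on q places b there. *)
Lemma same_sector_transfer k (a b c : int) (q s : nat) : (0 < k)%N -> same_sector k a b ->
  (`|a| + `|b| + k < q)%N -> (s <= k * q.-1)%N -> Posz s + c *+ q = a ->
  exists2 s' : nat, (s' <= k * q.-1)%N & Posz s' + c *+ q = b.
Proof.
move=> k0 sab hq hs; have q0 : (0 < q)%N by lia.
have [r er] : exists r : nat, (k * q.-1 + k)%N = r /\ r = (k * q)%N.
  by exists (k * q)%N; split=> //; rewrite -mulnSr prednK.
rewrite -mulr_natr natz => ha.
suff [h1 h2] : 0 <= b - c * q%:Z /\ b - c * q%:Z + k%:Z <= (k * q)%N%:Z.
  exists (absz (b - c * q%:Z)%R); last by rewrite gez0_abs ?subrK.
  by case: er; lia.
case: sab => [<-|[[a0 b0]|[a0 b0]]].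
- by case: er; lia.
- have c0 : c <= 0 by nia.
  have ck : - k%:Z + 1 <= c by nia.
  by split; nia.
- have c0 : c <= -1 by nia.
  have ck : - k%:Z <= c by nia.
  by split; nia.
Qed.

End SectorArithmetic.

Lemma AssA_same_sector (A : comNzRingType) (m n p : nat) (M : lmodType {mpoly A[(m + n)%N]})
    (theta : {linear M -> frob p M}) (theta' : frob p M -> M) (G : bidegree -> set M) :
  cancel theta theta' -> cancel theta' theta -> p \in [pchar A] ->
  (forall e, frob_flat A (p ^ e)) -> is_bigrading G -> bidegree_preserving G theta ->
  (0 < m)%N -> (0 < n)%N ->
  forall a1 a2 b1 b2 : int, same_sector m a1 b1 -> same_sector n a2 b2 ->
  AssA (G (a1, a2)) `<=` AssA (G (b1, b2)).
Proof.
move=> tK t'K cp fl gG tG m0 n0 a1 a2 b1 b2 s1 s2.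
(* Since e < p^e, this exponent makes q large enough for both coordinates at once. *)
pose e := (`|a1| + `|b1| + m + (`|a2| + `|b2| + n))%N.
have he : (e < p ^ e)%N by apply: ltn_expl; exact: prime_gt1 (pcharf_prime cp).
apply: (AssA_transfer tK t'K cp fl gG tG (e := e)) => -[c1 c2] I sI hI.
have q0 : (0 < p ^ e)%N by lia.
have [s [t [hs ht eI]]] := bideg_mnm_bound q0 sI.
move: hI; rewrite eI => hI.
have h1 : Posz s + c1 *+ (p ^ e) = a1 by have := congr1 fst hI; rewrite /= raddfMn.
have h2 : Posz t + c2 *+ (p ^ e) = a2 by have := congr1 snd hI; rewrite /= raddfMn.
have [|s' hs' es'] := same_sector_transfer m0 s1 _ hs h1; first by lia.
have [|t' ht' et'] := same_sector_transfer n0 s2 _ ht h2; first by lia.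
have [I' sI' eI'] := mnm_with_degree q0 hs' ht'.
exists I' => //; rewrite eI' -es' -et'; congr pair; congr (_ + _).
- exact: (raddfMn (@fst int int) _ (c1, c2)).
- exact: (raddfMn (@snd int int) _ (c1, c2)).
Qed.

(** * Submodules as modules in their own right *)

Section SubmoduleType.
Variables (R : comNzRingType) (V : lmodType R) (L : set V) (sL : submodule L).

(** The proof of [submodule L] is an argument so that the closure instance below can be attached to
    the predicate. *)
Definition submodule_pred_of of submodule L : {pred V} := fun x => `[< L x >].
Definition submodule_pred := submodule_pred_of sL.
Definition submodule_type : predArgType := {x : V | submodule_pred x}.

Lemma submodule_pred_closed : GRing.submod_closed submodule_pred.
Proof.
split; first by apply/asboolP; case: sL.
by move=> a x y /asboolP hx /asboolP hy; apply/asboolP; case: sL => _; apply.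
Qed.

HB.instance Definition _ :=
  GRing.isSubmodClosed.Build R V submodule_pred submodule_pred_closed.
HB.instance Definition _ := SubChoice.on submodule_type.
HB.instance Definition _ :=
  [SubChoice_isSubLmodule of submodule_type by <:].

End SubmoduleType.

(** * A direct limit is the union of the images *)

Section DirectLimits.
Variables (R : comNzRingType) (X : nat -> lmodType R).
Variables (f : forall e, {linear X e -> X e.+1}) (V : lmodType R).
Variable (iota : forall e, {linear X e -> V}).
Hypothesis lim : is_direct_limit f iota.

Definition union_images : set V := [set v | exists e x, v = iota e x].

Lemma iota_le e e' (x : X e) : (e <= e')%N -> exists y : X e', iota e x = iota e' y.
Proof.
move=> /subnK <-; elim: (e' - e)%N => [|k [y ->]]; first by exists x.
by exists (f (k + e) y); rewrite (proj1 lim).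
Qed.

Lemma union_images_submodule : submodule union_images.
Proof.
split=> [|a _ _ [e [x ->]] [e' [y ->]]]; first by exists 0%N, 0; rewrite linear0.
have [x' ->] := iota_le x (leq_maxl e e'); have [y' ->] := iota_le y (leq_maxr e e').
by exists (maxn e e'), (a *: x' + y'); rewrite linearP.
Qed.

Local Notation U := (submodule_type union_images_submodule).

Lemma iota_union e x : submodule_pred union_images_submodule (iota e x).
Proof. by apply/asboolP; exists e, x. Qed.

Definition iota_sub e (x : X e) : U := exist _ (iota e x) (iota_union x).

Lemma iota_sub_linear e : linear (@iota_sub e).
Proof. by move=> a x y; apply: val_inj; rewrite /= linearP. Qed.

HB.instance Definition _ e :=
  GRing.isLinear.Build R (X e) U _ (@iota_sub e) (@iota_sub_linear e).

(* The retraction of V onto the union, followed by the inclusion, is the identity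
   by uniqueness of the maps out of a direct limit. *)
Lemma direct_limit_union v : union_images v.
Proof.
have compat e x : iota_sub (f e x) = iota_sub x by apply: val_inj; exact: (proj1 lim).
have [h [hE _]] := proj2 lim U (fun e => @iota_sub e : {linear X e -> U}) compat.
have [k [_ kU]] := proj2 lim V iota (proj1 lim).
have e1 := kU (\val \o h : {linear V -> V}) (fun e x => congr1 val (hE e x)).
have e2 := kU (idfun : {linear V -> V}) (fun e x => erefl).
rewrite -[v]/(idfun v) e2 -e1 /=; exact/asboolP/(valP (h v)).
Qed.

End DirectLimits.

(** * Generation of M by iterates of phi *)

Section GeneratingMorphism.
Variables (A : comNzRingType) (N p : nat).
Local Notation R := {mpoly A[N]}.
Variables (M : lmodType R) (theta : {linear M -> frob p M}) (theta' : frob p M -> M).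
Hypotheses (thetaK : cancel theta theta') (theta'K : cancel theta' theta).

Lemma frob_map_comp (X Y Z : lmodType R) (f : {linear X -> Y}) (g : {linear Y -> Z})
    (h : {linear X -> Z}) : (forall x, g (f x) = h x) ->
  forall z, frob_map (p := p) g (frob_map f z) = frob_map h z.
Proof.
move=> gf; elim/frob_piW=> s; rewrite !frob_mapE; congr frob_pi.
by rewrite /map_seq -map_comp; apply: eq_map => t /=; rewrite gf.
Qed.

(** Because theta (iota_(e+1) z) = F(iota_e) z, the map iota_(e+1) sends r (x) y to r phi(iota_e y).
    Each stage of the limit is thus spanned by phi^e of the images of the generators of U. *)
Lemma generating_morphism_span (U : lmodType R) (beta : {linear U -> frob p U}) k (g : 'I_k -> U) :
  generating_morphism theta beta ->
  (forall u, exists c : 'I_k -> R, u = \sum_i c i *: g i) ->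
  exists g' : 'I_k -> M, forall x, exists e (c : 'I_k -> R),
    x = \sum_i c i *: phis theta' e (g' i).
Proof.
move=> [_ [iota [lim thE]]] gU; exists (fun i => iota 0%N (g i)) => x.
have [e [y ->]] := direct_limit_union lim x.
have [compat _] := lim; exists e.
have step e' z : theta (iota e'.+1 z) = frob_map (iota e') z.
  by rewrite thE; exact: (frob_map_comp (compat e')).
elim: e y => [|e IH] y.
  have [c ->] := gU y; exists c; rewrite linear_sum.
  by apply: eq_bigr => i _; rewrite linearZ.
elim/frob_piW: y => s.
have -> : iota e.+1 (frob_pi p s) = \sum_(t <- s) t.1 *: phi theta' (iota e t.2).
  apply: (can_inj thetaK); rewrite step frob_pi_sum linear_sum linear_sum.
  apply: eq_bigr => t _; rewrite /= frob_map_tens -(theta'_tens thetaK theta'K).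
  by rewrite theta'K.
elim: s => [|t s [c IHs]].
  by exists (fun=> 0); rewrite big_nil big1 // => i _; rewrite scale0r.
have [d ed] := IH t.2.
exists (fun i => t.1 * d i ^+ p + c i); rewrite big_cons IHs ed.
rewrite (big_morph (phi theta') (phiD thetaK theta'K) (phis0 thetaK theta'K 1)).
rewrite scaler_sumr -big_split; apply: eq_bigr => i _.
by rewrite (phiZ thetaK theta'K) scalerA scalerDl.
Qed.

End GeneratingMorphism.

(** * Prime filtrations of finitely generated A-submodules *)

Section PrimeFiltrations.
Variables (A : comNzRingType) (N : nat).
Local Notation R := {mpoly A[N]}.
Variable M : lmodType R.
Implicit Types (x y z h : M) (hs : seq M) (a b : A).

Fixpoint cspan hs : set M :=
  if hs is h :: hs' then [set x | exists2 y, cspan hs' y & exists a, x = y + a ** h]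
  else [set 0].

Lemma cspan0 hs : cspan hs 0.
Proof.
elim: hs => //= h hs IH; exists 0 => //.
by exists 0; rewrite conscale0 addr0.
Qed.

Lemma cspanD hs x y : cspan hs x -> cspan hs y -> cspan hs (x + y).
Proof.
elim: hs x y => [|h hs IH] x y /=; first by move=> -> ->; rewrite addr0.
move=> [x' hx [a ->]] [y' hy [b ->]]; exists (x' + y'); first exact: IH.
by exists (a + b); rewrite conscaleD addrACA.
Qed.

Lemma cspanZ hs c x : cspan hs x -> cspan hs (c ** x).
Proof.
elim: hs x => [|h hs IH] x /=; first by move=> ->; rewrite scaler0.
move=> [x' hx [a ->]]; exists (c ** x'); first exact: IH.
by exists (c * a); rewrite scalerDr conscaleM.
Qed.

Lemma cspan_behead h hs x : cspan hs x -> cspan (h :: hs) x.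
Proof. by move=> hx; exists x => //; exists 0; rewrite conscale0 addr0. Qed.

Lemma mem_cspan hs h : h \in hs -> cspan hs h.
Proof.
elim: hs => // h' hs IH; rewrite inE => /predU1P [->|/IH]; last exact: cspan_behead.
by exists 0; [exact: cspan0 | exists 1; rewrite conscale1 add0r].
Qed.

Lemma cspan_nth hs x : cspan hs x -> exists c : nat -> A, x = \sum_(i < size hs) c i ** hs`_i.
Proof.
elim: hs x => [|h hs IH] x /=.
  by move=> ->; exists (fun=> 0); rewrite big_ord0.
move=> [y /IH [c ->] [a ->]]; exists (fun i => if i is j.+1 then c j else a).
by rewrite big_ord_recl addrC.
Qed.

Lemma nth_cspan hs (c : nat -> A) : cspan hs (\sum_(i < size hs) c i ** hs`_i).
Proof.
elim/big_ind: _ => [|x y|i _]; [exact: cspan0 | exact: cspanD |].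
by apply: cspanZ; apply: mem_cspan; exact: mem_nth.
Qed.

(** The quotient of [cspan (h :: hs)] by [cspan hs] is isomorphic to A modulo this ideal. *)
Definition cquot hs h : set A := [set a | cspan hs (a ** h)].

Lemma cquot_ideal hs h : ideal (cquot hs h).
Proof.
split=> [|a b ha hb|a b hb]; rewrite /cquot /=.
- by rewrite conscale0; exact: cspan0.
- by rewrite conscaleD; exact: cspanD.
- by rewrite conscaleM; exact: cspanZ.
Qed.

Fixpoint prime_filtration hs : Prop :=
  if hs is h :: hs' then prime_filtration hs' /\ prime_ideal (cquot hs' h) else True.

Fixpoint filtration_primes hs : set (set A) :=
  if hs is h :: hs' then [set cquot hs' h] `|` filtration_primes hs' else set0.

Lemma finite_filtration_primes hs : finite_set (filtration_primes hs).
Proof.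
elim: hs => [|h hs IH] /=; first exact: finite_set0.
by rewrite finite_setU; split=> //; exact: finite_set1.
Qed.

(** Noetherian induction on the annihilator I of g modulo the span. If x y is in I but x and y are
    not, adjoin x g first, whose annihilator I : x contains y; after that the annihilator of g
    contains x. *)
Lemma extend_filtration hs g : noetherian A -> prime_filtration hs ->
  exists hs', [/\ prime_filtration hs', cspan hs `<=` cspan hs' & cspan hs' g].
Proof.
move=> nA; have [I eI] : exists I, I = cquot hs g by exists (cquot hs g).
have iI : ideal I by rewrite eI; exact: cquot_ideal.
move: I iI hs g eI; apply: noetherian_ind => // I iI IH hs g eI ph.
have [I1|nI1] := pselect (I 1).
  by exists hs; split=> //; move: I1; rewrite eI /cquot /= conscale1.
have [pI|npI] := pselect (prime_ideal I).
  exists (g :: hs); split; [by split=> //; rewrite -eI | exact: cspan_behead |].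
  by apply: mem_cspan; rewrite mem_head.
have [x [y [Ixy nIx nIy]]] : exists x y : A, [/\ I (x * y), ~ I x & ~ I y].
  apply: contrapT => h; apply: npI; split=> // x y Ixy; apply: contrapT => /not_orP [nx ny].
  by apply: h; exists x, y.
have ec : colon I x = cquot hs (x ** g).
  by apply/seteqP; split=> b; rewrite /colon /cquot eI /cquot /= -conscaleM.
have [|hs1 [ph1 s1 g1]] := IH (colon I x) (colon_ideal x iI) _ hs (x ** g) ec ph.
  by apply: properI nIy; [exact: sub_colon | rewrite /colon /= mulrC].
have [|hs2 [ph2 s2 g2]] := IH (cquot hs1 g) (cquot_ideal hs1 g) _ hs1 g erefl ph1.
  by apply: properI nIx; [rewrite eI => b; exact: s1 | exact: g1].
by exists hs2; split=> //; exact: subset_trans s1 s2.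
Qed.

Lemma exists_filtration (gs : seq M) : noetherian A ->
  exists hs, prime_filtration hs /\ forall g, g \in gs -> cspan hs g.
Proof.
move=> nA; elim: gs => [|g gs [hs [ph hg]]]; first by exists [::].
have [hs' [ph' ss gg]] := extend_filtration g nA ph; exists hs'; split=> // x.
by rewrite inE => /predU1P [-> //|/hg/ss].
Qed.

End PrimeFiltrations.

(** * Associated primes of the spans of phi^e *)

Section AssociatedPrimes.
Variables (A : comNzRingType) (m n p : nat).
Local Notation N := (m + n)%N.
Local Notation R := {mpoly A[N]}.
Variables (M : lmodType R) (theta : {linear M -> frob p M}) (theta' : frob p M -> M).
Hypotheses (thetaK : cancel theta theta') (theta'K : cancel theta' theta).
Hypothesis cp : p \in [pchar A].
Hypothesis flatA : forall e, frob_flat A (p ^ e).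
Implicit Types (x y z h : M) (hs : seq M) (a b : A) (P : set A).

Local Notation phis := (phis theta').

Lemma phis_cspan e hs x : cspan hs x -> cspan [seq phis e h | h <- hs] (phis e x).
Proof.
elim: hs x => [|h hs IH] x /=; first by move=> ->; exact: (phis0 thetaK theta'K).
move=> [y /IH hy [a ->]]; exists (phis e y) => //; exists (a ^+ (p ^ e)).
by rewrite (phisD thetaK theta'K) (phis_conscale thetaK theta'K).
Qed.

(* Flatness of Frobenius: a coefficient of phi^e(h) modulo phi^e of the span of hs
   that is killed by s lies in the Frobenius power of cquot hs h : s. *)
Lemma phis_coefficient e hs h y s a : prime_ideal (cquot hs h) -> ~ cquot hs h s ->
  cspan [seq phis e h | h <- hs] y -> s ** (y + a ** phis e h) = 0 ->
  cspan [seq phis e h | h <- hs] (a ** phis e h).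
Proof.
move=> pQ nQs /cspan_nth [c ->]; rewrite size_map => s0.
have q_gt0 : (0 < p ^ e)%N by rewrite expn_gt0 (prime_gt0 (pcharf_prime cp)).
pose v (k : 'I_(size hs).+1) := (h :: hs)`_k.
pose al (k : 'I_(size hs).+1) := s * (if val k is j.+1 then c j else a).
have small0 (k : 'I_(size hs).+1) : mnm_small (p ^ e) (0%MM : 'X_{1..N}).
  by move=> i; rewrite mnm0E.
have [|l [d [w [hw ew]]]] := phis_separate thetaK theta'K cp flatA (u := v) (a := al) small0.
  rewrite big_ord_recl /= mpolyX0 scale1r -[RHS]s0 scalerDr addrC scaler_sumr; congr (_ + _).
    apply: eq_bigr => i _; rewrite scale1r /al /v /= conscaleM.
    by rewrite (nth_map 0).
  by rewrite /al /v /= conscaleM.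
have Qw i : cquot hs h (w i ord0).
  have := hw i 0%MM; rewrite (eq_bigl xpredT); last by move=> k; rewrite eqxx.
  rewrite big_ord_recl /v /= => e0.
  have -> : cquot hs h (w i ord0) = cspan hs (w i ord0 ** h) by [].
  rewrite -[w i ord0 ** h](addrK (\sum_(j < size hs) w i (lift ord0 j) ** hs`_j)) e0 sub0r.
  rewrite -scaleN1r -mpolyC1 -mpolyCN; apply: cspanZ.
  have := nth_cspan hs (fun j => w i (inord j.+1)).
  congr cspan; apply: eq_bigr => j _; congr (w i _ ** _); apply: val_inj.
  by rewrite /= inordK // ltnS.
have ea : s * a = \sum_i d i * w i ord0 ^+ (p ^ e) by exact: (congr1 (fun f => f ord0) ew).
(* Multiplying [ea] by s^(q-1) gives a relation on the q-th powers of s and the w_i. By flatness [a]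
   is a combination of q-th powers of elements z with z s in the ideal of the w_i, so z lies in the
   prime [cquot hs h]. *)
pose be (k : 'I_l.+1) := if unlift ord0 k is Some i then - (s ^+ (p ^ e).-1 * d i) else a.
pose ga (k : 'I_l.+1) := if unlift ord0 k is Some i then w i ord0 else s.
have [|L [c' [z [hz ez]]]] := @flatA e _ ga be.
  rewrite big_ord_recl /be /ga unlift_none -(prednK q_gt0) exprSr mulrA -{1}(mulrC (s ^+ _)).
  rewrite -mulrA (mulrC a) ea (prednK q_gt0) mulr_sumr -big_split; apply: big1 => i _ /=.
  by rewrite liftK mulNr mulrA subrr.
have ea' : a = \sum_j c' j * z j ord0 ^+ (p ^ e).
  by have := congr1 (fun f => f ord0) ez; rewrite /be unlift_none.
have [iQ _ pM] := pQ.
have Qz j : cquot hs h (z j ord0).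
  have := hz j; rewrite /syzygies /= big_ord_recl /ga unlift_none => e0.
  have : cquot hs h (z j ord0 * s).
    apply: (idealDr iQ (x := \sum_(i < l) z j (lift ord0 i) * w i ord0)).
      by apply: (ideal_sum _ iQ) => i _; apply: idealMl.
    rewrite addrC (eq_bigr (fun i => z j (lift ord0 i) * (if unlift ord0 (lift ord0 i) is
      Some i then w i ord0 else s))); last by move=> i _; rewrite liftK.
    by rewrite e0; exact: ideal0.
  by move=> /pM [].
rewrite ea' conscale_suml; elim/big_ind: _ => [|x1 x2|j _]; [exact: cspan0 | exact: cspanD |].
rewrite conscaleM -(phis_conscale thetaK theta'K); apply: cspanZ; apply: phis_cspan.
exact: Qz.
Qed.

(** The primes obtained do not depend on e, whence finiteness. If b z is in the smaller span for
    some b outside P, it has the same annihilator as z. Otherwise P is the top prime Q: for s in Q,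
    s^q phi^e(h) = phi^e(s h) moves s^q z into the smaller span; for s in P outside Q,
    [phis_coefficient] would move z itself there. *)
Lemma annA_filtration e hs z P : prime_filtration hs -> cspan [seq phis e h | h <- hs] z ->
  prime_ideal P -> P = annA z -> filtration_primes hs P.
Proof.
elim: hs z => [|h hs IH] z /=.
  by move=> _ -> [_ P1 _] eP; case: P1; rewrite eP /annA /= scaler0.
move=> [ph pQ] [y hy [a ez]] pP eP; have [iP P1 pM] := pP.
have [[b nPb hb]|none] := pselect (exists2 b, ~ P b & cspan [seq phis e h | h <- hs] (b ** z)).
  right; apply: (IH (b ** z)) => //; apply/seteqP; split=> c; rewrite /annA /= -conscaleM.
    by move=> Pc; have : P (c * b) by [exact: idealMr]; rewrite eP.
  by move=> hc; have : P (c * b) by [rewrite eP]; move=> /pM [].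
left; apply/seteqP; split=> s Ps; last first.
  apply: contrapT => nPs; have nPq : ~ P (s ^+ (p ^ e)) by move/(prime_pow pP).
  apply: none; exists (s ^+ (p ^ e)) => //; rewrite ez scalerDr.
  apply: cspanD; first exact: cspanZ.
  rewrite -conscaleM mulrC conscaleM -(phis_conscale thetaK theta'K).
  by apply: cspanZ; exact: phis_cspan.
apply: contrapT => nQs; apply: none; exists 1 => //.
rewrite conscale1 ez; apply: cspanD => //.
by apply: (phis_coefficient pQ nQs hy); move: Ps; rewrite eP /annA /= ez.
Qed.

End AssociatedPrimes.

(** * Finiteness of the associated primes in nonpositive degrees *)

Section Finiteness.
Variables (A : comNzRingType) (m n p : nat).
Local Notation N := (m + n)%N.
Local Notation R := {mpoly A[N]}.
Variables (M : lmodType R) (theta : {linear M -> frob p M}) (theta' : frob p M -> M).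
Hypotheses (thetaK : cancel theta theta') (theta'K : cancel theta' theta).
Hypothesis cp : p \in [pchar A].
Hypothesis flatA : forall e, frob_flat A (p ^ e).
Variable G : bidegree -> set M.
Hypotheses (gG : is_bigrading G) (thetaG : bidegree_preserving G theta).
Implicit Types (x y : M) (a : A) (d : bidegree) (gs : seq (M * bidegree)).

Local Notation phis := (phis theta').

Lemma graded_component (K : finType) (x : K -> M) (f : K -> bidegree) d y :
  G d y -> (forall k, G (f k) (x k)) -> y = \sum_k x k -> y = \sum_(k | f k == d) x k.
Proof.
move=> gy gx ey.
pose x' (i : K + 'I_1) := match i with inl k => x k | inr _ => - y end.
pose f' (i : K + 'I_1) := match i with inl k => f k | inr _ => d end.
have gx' i : G (f' i) (x' i) by case: i => [k|b] /=; [exact: gx | exact: gradedN].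
have s0 : \sum_i x' i = 0 by rewrite big_sumType /= big_ord1 -ey subrr.
have := graded_sum0 gG gx' s0 d.
rewrite big_sumType /= [X in _ + X]big_mkcond /= big_ord1 eqxx => /eqP.
by rewrite subr_eq0 => /eqP.
Qed.

Definition frob_generates gs : Prop := forall x, exists e (s : seq (R * (M * bidegree))),
  (forall w, w \in s -> w.2 \in gs) /\ x = \sum_(w <- s) w.1 *: phis e w.2.1.

(** As [phis e] is additive, the homogeneous components in M of the given generators generate as
    well. *)
Lemma homogeneous_generators k (g : 'I_k -> M) :
  (forall x, exists e (c : 'I_k -> R), x = \sum_i c i *: phis e (g i)) ->
  exists gs, (forall t, t \in gs -> G t.2 t.1) /\ frob_generates gs.
Proof.
move=> gen; have [_ _ dec _] := gG.
have hs i : exists s : seq (M * bidegree),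
    (forall t, t \in s -> G t.2 t.1) /\ g i = \sum_(t <- s) t.1.
  have [s [c [gc ->]]] := dec (g i); exists [seq (c d, d) | d <- s]; split.
    by move=> _ /mapP [d _ ->].
  by rewrite big_map.
pose s i := sval (cid (hs i)).
have gs i t : t \in s i -> G t.2 t.1 by case: (svalP (cid (hs i))) => h _; exact: h.
have es i : g i = \sum_(t <- s i) t.1 by case: (svalP (cid (hs i))).
exists (flatten [seq s i | i <- enum 'I_k]); split.
  by move=> t /flattenP [_ /mapP [i _ ->]]; exact: gs.
move=> x; have [e [c ->]] := gen x.
exists e, [seq (c i, t) | i <- enum 'I_k, t <- s i]; split.
  move=> w /allpairsPdep [i [t [_ ts ->]]] /=; apply/flattenP.
  by exists (s i) => //; apply: map_f; rewrite mem_enum.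
rewrite big_allpairs_dep big_enum; apply: eq_bigr => i _ /=.
by rewrite es (phis_sum thetaK theta'K) scaler_sumr.
Qed.

(** Closing the generators under monomials is what [expansion_homog] demands. *)
Definition monomial_multiples gs d : set M :=
  [set v | exists t (J : 'X_{1..N}), [/\ t \in gs, v = 'X_[J] *: t.1 & bideg_mnm J + t.2 = d]].

Lemma monomial_multiplesX gs d u v : monomial_multiples gs d v ->
  monomial_multiples gs (bideg_mnm u + d) ('X_[u] *: v).
Proof.
move=> [t [J [tg -> <-]]]; exists t, (u + J)%MM; split=> //.
  by rewrite mpolyXD scalerA.
by rewrite bideg_mnmD addrA.
Qed.

(** Splitting the coefficients into monomials gives terms that are homogeneous by [phis_graded];
    those of degree d already sum to x. *)
Lemma generated_expansion gs e d x (s : seq (R * (M * bidegree))) :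
  (forall t, t \in gs -> G t.2 t.1) -> G d x ->
  (forall w, w \in s -> w.2 \in gs) -> x = \sum_(w <- s) w.1 *: phis e w.2.1 ->
  expansion theta' e (monomial_multiples gs) d x.
Proof.
move=> ggs gx hs ex.
pose L := [seq (w.1@_u, u, w.2) | w <- s, u <- msupp w.1].
have hL z : z \in L -> z.2 \in gs.
  by move=> /allpairsPdep [w [u [ws _ ->]]]; exact: hs.
pose tt := tnth (in_tuple L).
pose y k := (tt k).1.1 ** ('X_[(tt k).1.2] *: phis e (tt k).2.1).
pose f k := bideg_mnm (tt k).1.2 + (tt k).2.2 *+ (p ^ e).
have gy k : G (f k) (y k).
  apply: (graded_conscale gG); apply: (gradedX gG).
  apply: (phis_graded thetaK theta'K cp flatA gG thetaG); apply: ggs; apply: hL.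
  exact: mem_tnth.
have ex' : x = \sum_k y k.
  transitivity (\sum_(z <- L) z.1.1 ** ('X_[z.1.2] *: phis e z.2.1)); last by rewrite big_tnth.
  rewrite ex big_allpairs_dep; apply: eq_bigr => w _ /=.
  rewrite {1}[w.1]mpolyE scaler_suml; apply: eq_bigr => u _.
  by rewrite -mul_mpolyC scalerA.
rewrite (graded_component gx gy ex'); apply: expansion_sum => k _ /eqP <-.
apply: expansion_conscale.
have Sx : monomial_multiples gs (tt k).2.2 (tt k).2.1.
  exists (tt k).2, 0%MM; split; last by rewrite bideg_mnm0 add0r.
  - by apply: hL; exact: mem_tnth.
  - by rewrite mpolyX0 scale1r.
exact: (expansion_homog thetaK theta'K cp (@monomial_multiplesX gs)
  (@bihomogX m n A (tt k).1.2) Sx e).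
Qed.

Definition bounded_multiples gs B : seq M :=
  [seq 'X_[[multinom (val (f i)) | i < N]] *: t.1 |
    f : {ffun 'I_N -> 'I_B.+1} <- enum {ffun 'I_N -> 'I_B.+1}, t : M * bidegree <- gs].

Lemma mem_bounded_multiples gs : exists B, forall d v, (d.1 <= 0) -> (d.2 <= 0) ->
  monomial_multiples gs d v -> v \in bounded_multiples gs B.
Proof.
(* When deg J + deg t <= 0 in both coordinates, the entries of J are bounded by the absolute degrees
   of t. *)
pose B := (\sum_(t <- gs) (`|t.2.1|%N + `|t.2.2|%N))%N; exists B.
move=> d v d1 d2 [t [J [tg -> eJ]]].
have tB : (`|t.2.1|%N + `|t.2.2|%N <= B)%N.
  by rewrite /B (big_rem t) //= leq_addr.
have e1 : (Posz (\sum_(i < m) J (lshift n i)) + t.2.1 = d.1) by rewrite -eJ.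
have e2 : (Posz (\sum_(j < n) J (rshift m j)) + t.2.2 = d.2) by rewrite -eJ.
have JB i : (J i <= B)%N.
  rewrite -(splitK i); case: (split i) => j /=.
    have : (J (lshift n j) <= \sum_(i < m) J (lshift n i))%N by rewrite (bigD1 j) //= leq_addr.
    by lia.
  have : (J (rshift m j) <= \sum_(i < n) J (rshift m i))%N by rewrite (bigD1 j) //= leq_addr.
  by lia.
have -> : J = [multinom (val (([ffun i => inord (J i)] : {ffun 'I_N -> 'I_B.+1}) i)) | i < N].
  by apply/mnmP => i; rewrite mnmE ffunE /= inordK // ltnS.
by apply: (allpairs_f (fun (f : {ffun 'I_N -> 'I_B.+1}) (t : M * bidegree) =>
  'X_[[multinom (val (f i)) | i < N]] *: t.1)); rewrite ?mem_enum.
Qed.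

Lemma finite_AssA_nonpositive k (g : 'I_k -> M) : noetherian A ->
  (forall x, exists e (c : 'I_k -> R), x = \sum_i c i *: phis e (g i)) ->
  exists F : set (set A), finite_set F /\
    forall d, d.1 <= 0 -> d.2 <= 0 -> AssA (G d) `<=` F.
Proof.
move=> nA /homogeneous_generators [gs [ggs gen]].
have [B hB] := mem_bounded_multiples gs.
have [hs [ph hhs]] := exists_filtration (bounded_multiples gs B) nA.
exists (filtration_primes hs); split; first exact: finite_filtration_primes.
move=> d d1 d2 P [pP [x gx eP]]; have [e [s [hsg ex]]] := gen x.
have xe := generated_expansion ggs gx hsg ex.
have [I [d' [t [sI hI ht eP']]]] := annA_component thetaK theta'K cp flatA xe pP eP.
apply: (annA_filtration thetaK theta'K cp flatA (e := e) ph _ pP eP').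
have q_gt0 : (0 < p ^ e)%N by rewrite expn_gt0 (prime_gt0 (pcharf_prime cp)).
(* The monomial has nonnegative degree, so q d' <= d <= 0 coordinatewise. *)
have d'1 : d'.1 <= 0.
  have := congr1 fst hI; rewrite /= raddfMn -mulr_natr natz /= => e1.
  by nia.
have d'2 : d'.2 <= 0.
  have := congr1 snd hI; rewrite /= raddfMn -mulr_natr natz /= => e2.
  by nia.
rewrite big_seq; elim/big_ind: _ => [|x1 x2|w wt]; [exact: cspan0 | exact: cspanD |].
apply: cspanZ; apply: (phis_cspan thetaK theta'K); apply: hhs.
exact: hB d'1 d'2 (ht w wt).
Qed.

End Finiteness.
Theorem theoremE (p : nat) (k : fieldType) (A : comNzRingType)
    (inc : {rmorphism k -> A}) (m n : nat) (M : lmodType {mpoly A[(m + n)%N]})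
    (G : bidegree -> set M) (theta : {linear M -> frob p M})
    (chark : p \in [pchar k]) (regA : regular_ring A)
    (m_ge1 : (1 <= m)%N) (n_ge1 : (1 <= n)%N)
    (HM : bigraded_F_finite G theta) :
  finite_set (\bigcup_(d in [set: bidegree]) AssA (G d)) /\
  (forall a b : int, 0 <= a -> 0 <= b -> AssA (G (a, b)) = AssA (G (0, 0))) /\
  (forall a b : int, a <= - m%:Z -> 0 <= b ->
     AssA (G (a, b)) = AssA (G (- m%:Z, 0))) /\
  (forall a b : int, a <= - m%:Z -> b <= - n%:Z ->
     AssA (G (a, b)) = AssA (G (- m%:Z, - n%:Z))) /\
  (forall a b : int, 0 <= a -> b <= - n%:Z ->
     AssA (G (a, b)) = AssA (G (0, - n%:Z))).
Proof.
have [gG [theta' thetaK theta'K] thetaG [U [H [beta [[r [g gU]] _ _ gen]]]]] := HM.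
have cp : p \in [pchar A].
  rewrite inE (pcharf_prime chark) /= -(rmorph_nat inc).
  by move: chark; rewrite inE => /andP[_ /eqP ->]; rewrite rmorph0.
have flatA e : frob_flat A (p ^ e) by exact: regular_frob_flat.
have sub := AssA_same_sector thetaK theta'K cp flatA gG thetaG m_ge1 n_ge1.
have same a a' b b' : same_sector m a a' -> same_sector n b b' ->
    AssA (G (a, b)) = AssA (G (a', b')).
  move=> sa sb; apply/seteqP; split; apply: sub => //.
    by case: sa => [->|[[? ?]|[? ?]]]; [left | right; left | right; right].
  by case: sb => [->|[[? ?]|[? ?]]]; [left | right; left | right; right].
split; last first.
  do 3?[split]; move=> a b ha hb; apply: same; right;
    by [left; split | right; split].
have [g' gen'] := generating_morphism_span thetaK theta'K gen gU.
have [nA _] := regA.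
have [F [finF hF]] := finite_AssA_nonpositive thetaK theta'K cp flatA gG thetaG nA gen'.
apply: sub_finite_set finF => P [[a b] _ hP].
(* Each coordinate shares its sector with a nonpositive one: 0 if it is nonnegative, itself
   otherwise. *)
have [a' [a'0 sa]] : exists a' : int, a' <= 0 /\ same_sector m a a'.
  have [a0|/ltW a0] := lerP 0 a; [exists 0 | exists a]; split=> //; last by left.
  by right; left.
have [b' [b'0 sb]] : exists b' : int, b' <= 0 /\ same_sector n b b'.
  have [b0|/ltW b0] := lerP 0 b; [exists 0 | exists b]; split=> //; last by left.
  by right; left.
by apply: (hF (a', b')) => //; rewrite -(same _ _ _ _ sa sb).
Qed.
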